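(* Let $R$ be a Noetherian commutative ring of Krull dimension $\le4$, let $P_0$ be a finitely generated projective $R$-module of constant rank $2$ and let $\theta_0:R\xrightarrow{\cong}\det(P_0)$ be a trivialization of its determinant. Let $P_4=P_0\oplus Re_3\oplus Re_4$ and $P_5=P_4\oplus Re_5$, and assume that $SL(P_5)$ acts transitively on $Um(P_5)$. Then the orbit space $Um(P_0\oplus R)/SL(P_0\oplus R)$ is trivial if and only if $W_{SL}(R)$ is trivial and $SL(P_4)e_4=Sp(\chi_0\perp\psi_2)e_4$.
   Context: For a finitely generated projective $R$-module $P$, $Um(P)$ is the set of epimorphisms $P\to R$; $SL(P)$ is the group of automorphisms of determinant $1$, acting on the right on $Um(P)$ by precomposition and on the left on $P$. For a non-degenerate alternating form $\chi$ on $P$, $Sp(\chi)=\{\varphi\in\mathrm{Aut}(P):\varphi^t\chi\varphi=\chi\}$, where $\varphi^t\chi\varphi(p,q)=\chi(\varphi p,\varphi q)$. $Re_3,Re_4,Re_5$ are free of rank one on the indicated generators; $SL(P_4)e_4$ and $Sp(\chi)e_4$ denote the orbits of $e_4\in P_4$. $\chi_0$ is the form on $P_0$ given by $\chi_0(p,q)=\theta_0^{-1}(p\wedge q)$; $\psi_2=\begin{pmatrix}0&1\\-1&0\end{pmatrix}$ is regarded as a form on $Re_3\oplus Re_4$. Let $A_{2n}(R)$ be the set of invertible alternating $2n\times2n$ matrices over $R$, $\psi_{2n+2}=\psi_{2n}\perp\psi_2$, $A(R)=\mathrm{colim}_n A_{2n}(R)$ along $M\mapsto M\perp\psi_2$.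 Write $M\sim_{SL}N$ ($M\in A_{2m}(R)$, $N\in A_{2n}(R)$) if $M\perp\psi_{2n+2s}=E^t(N\perp\psi_{2m+2s})E$ for some $s\in\mathbb N$ and $E\in SL_{2m+2n+2s}(R)$. $W'_{SL}(R)=A(R)/{\sim_{SL}}$ is an abelian group under $\perp$, and $W_{SL}(R)$ is the kernel of the Pfaffian homomorphism $\mathit{Pf}:W'_{SL}(R)\to R^{\times}$. *)

(* Defs.v *)
From HB Require Import structures.
From mathcomp Require Import all_boot all_order all_algebra.
From mathcomp Require Import classical_sets.

Set Implicit Arguments.
Unset Strict Implicit.
Unset Printing Implicit Defensive.

Import GRing.Theory.
Local Open Scope classical_set_scope.
Local Open Scope ring_scope.

(* Rings are [comPzRingType]s, so that the zero ring is allowed.  The regular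
   module R^o plays the role of the free module of rank one. *)

Section CommutativeAlgebra.
Variable R : comPzRingType.

Definition is_ideal (I : set R) : Prop :=
  [/\ I 0, forall x y, I x -> I y -> I (x + y) & forall a x, I x -> I (a * x)].

Definition prime_ideal (p : set R) : Prop :=
  [/\ is_ideal p, ~ p 1 & forall x y, p (x * y) -> p x \/ p y].

Definition noetherian : Prop :=
  forall I : set R, is_ideal I -> exists (n : nat) (g : 'I_n -> R),
    forall x, I x <-> exists c : 'I_n -> R, x = \sum_i c i * g i.

(* Only p 0, ..., p n matter: p 0 < p 1 < ... < p n has length n. *)
Definition prime_chain (n : nat) (p : nat -> set R) : Prop :=
  (forall i, (i <= n)%N -> prime_ideal (p i)) /\
  (forall i, (i < n)%N -> p i `<` p i.+1).

Definition krull_dim_le (d : nat) : Prop :=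
  forall n p, prime_chain n p -> (n <= d)%N.

Definition finitely_generated (P : lmodType R) : Prop :=
  exists (n : nat) (g : 'I_n -> P),
    forall x, exists c : 'I_n -> R, x = \sum_i c i *: g i.

Definition projective (P : lmodType R) : Prop :=
  forall (M N : lmodType R) (g : {linear M -> N}) (f : {linear P -> N}),
    (forall y, exists x, g x = y) ->
    exists h : {linear P -> M}, forall x, g (h x) = f x.

End CommutativeAlgebra.

Definition free_of_rank (S : comPzRingType) (M : lmodType S) (n : nat) : Prop :=
  exists e : 'I_n -> M,
    forall x, exists! c : 'rV[S]_n, x = \sum_i c 0 i *: e i.

Section Localization.
Variables (R : comPzRingType) (p : set R).

(* f exhibits Rp as the localization of R at the prime ideal p. *)
Definition is_localization (Rp : comPzRingType) (f : {rmorphism R -> Rp})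
    : Prop :=
  [/\ forall s, ~ p s -> exists t, f s * t = 1,
      forall y, exists x s, ~ p s /\ f s * y = f x
    & forall x, f x = 0 -> exists s, ~ p s /\ s * x = 0].

(* g exhibits Mp as the localization at p of the R-module M. *)
Definition is_localized_module (Rp : comPzRingType) (f : {rmorphism R -> Rp})
    (M : lmodType R) (Mp : lmodType Rp) (g : {additive M -> Mp}) : Prop :=
  [/\ forall a x, g (a *: x) = f a *: g x,
      forall y, exists x s, ~ p s /\ f s *: y = g x
    & forall x, g x = 0 -> exists s, ~ p s /\ s *: x = 0].

End Localization.

(* P_p is free of rank n over R_p for every prime p; since R_p and P_p are
   determined up to isomorphism, it does not matter which model is used. *)
Definition constant_rank (R : comPzRingType) (P : lmodType R) (n : nat)
    : Prop :=
  forall p : set R, prime_ideal p ->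
    exists (Rp : comPzRingType) (f : {rmorphism R -> Rp})
           (Pp : lmodType Rp) (g : {additive P -> Pp}),
      [/\ is_localization p f, is_localized_module p f g & free_of_rank Pp n].

Section BilinearMaps.
Variable R : comPzRingType.

Definition alternating_bilinear (P M : lmodType R) (w : P -> P -> M) : Prop :=
  [/\ forall a x y z, w (a *: x + y) z = a *: w x z + w y z,
      forall a x y z, w z (a *: x + y) = a *: w z x + w z y
    & forall x, w x x = 0].

(* (L, w) is the exterior square of P, w x y being the class x /\ y: it is
   characterized by its universal property. *)
Definition is_exterior_square (P L : lmodType R) (w : P -> P -> L) : Prop :=
  alternating_bilinear w /\
  forall (M : lmodType R) (b : P -> P -> M), alternating_bilinear b ->
    exists h : {linear L -> M},
      (forall x y, h (w x y) = b x y) /\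
      (forall h' : {linear L -> M},
         (forall x y, h' (w x y) = b x y) -> h' =1 h).

(* The form chi _|_ psi_2 on P (+) R e (+) R e', where psi_2 (e, e') = 1. *)
Definition perp_psi2 (P : lmodType R) (chi : P -> P -> R)
    (x y : P * R^o * R^o) : R :=
  chi x.1.1 y.1.1 + (x.1.2 * y.2 - x.2 * y.1.2).

Definition is_Sp (P : lmodType R) (chi : P -> P -> R) (phi : {linear P -> P})
    : Prop :=
  bijective phi /\ forall x y, chi (phi x) (phi y) = chi x y.

Definition Sp_orbit (P : lmodType R) (chi : P -> P -> R) (x : P) : set P :=
  [set y | exists phi : {linear P -> P}, is_Sp chi phi /\ phi x = y].

End BilinearMaps.

Section Determinant.
Variables (R : comPzRingType) (P : lmodType R).

(* The matrix of phi (+) id_Q on R^n = P (+) Q, where Q is the kernel of the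
   retraction r of the embedding i : P -> R^n. *)
Definition ext_mx (n : nat) (i : P -> 'rV[R]_n) (r : 'rV[R]_n -> P)
    (phi : P -> P) : 'M[R]_n :=
  lin1_mx (fun u => i (phi (r u)) + (u - i (r u))).

(* d is the determinant of the endomorphism phi of the finitely generated
   projective module P: choose P (+) Q = R^n, and take the determinant of
   phi (+) id_Q.  By has_det_inj it does not depend on the choice. *)
Definition has_det (phi : {linear P -> P}) (d : R) : Prop :=
  exists (n : nat) (i : {linear P -> 'rV[R]_n}) (r : {linear 'rV[R]_n -> P}),
    cancel i r /\ d = \det (ext_mx i r phi).

Definition is_SL (phi : {linear P -> P}) : Prop :=
  bijective phi /\ has_det phi 1.

Definition SL_orbit (x : P) : set P :=
  [set y | exists phi : {linear P -> P}, is_SL phi /\ phi x = y].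

Definition is_Um (a : {linear P -> R^o}) : Prop := forall c, exists x, a x = c.

Definition Um_equiv (a b : {linear P -> R^o}) : Prop :=
  exists phi : {linear P -> P}, is_SL phi /\ forall x, b x = a (phi x).

Definition SL_transitive_on_Um : Prop :=
  forall a b : {linear P -> R^o}, is_Um a -> is_Um b -> Um_equiv a b.

(* Um(P) / SL(P) has exactly one element. *)
Definition Um_orbit_space_trivial : Prop :=
  exists a : {linear P -> R^o},
    is_Um a /\ forall b : {linear P -> R^o}, is_Um b -> Um_equiv a b.

Lemma det_1DM (m n : nat) (A : 'M[R]_(m, n)) (B : 'M[R]_(n, m)) :
  \det (1%:M + A *m B) = \det (1%:M + B *m A).
Proof.
have e1 : block_mx (1%:M + A *m B) A 0 1%:M *m block_mx 1%:M 0 (- B) 1%:M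
        = block_mx 1%:M A (- B) 1%:M :> 'M[R]_(m + n).
  by rewrite mulmx_block !mulmx1 !mulmx0 !mul1mx mulmxN addrK ?add0r ?addr0.
have e2 : block_mx 1%:M 0 (- B) 1%:M *m block_mx 1%:M A 0 (1%:M + B *m A)
        = block_mx 1%:M A (- B) 1%:M :> 'M[R]_(m + n).
  rewrite mulmx_block !mulmx1 !mulmx0 !mul1mx !mul0mx ?mulNmx.
  by rewrite addrCA addNr ?addr0.
have := congr1 (fun M => \det M) (etrans e1 (esym e2)).
by rewrite !det_mulmx !det_ublock !det_lblock !det1 !(mulr1, mul1r).
Qed.

Lemma has_det_inj (phi : {linear P -> P}) (d d' : R) :
  has_det phi d -> has_det phi d' -> d = d'.
Proof.
case=> n [i [r [ir ->]]] [n' [i' [r' [ir' ->]]]].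
pose psi x := phi x - x.
have psiL : linear psi.
  by move=> a x y; rewrite /psi linearP scalerBr opprD addrACA.
pose psi' := HB.pack_for {linear P -> P} psi
               (GRing.isLinear.Build _ _ _ _ psi psiL).
have rowL a b (f : 'rV[R]_a -> 'rV[R]_b) l :
    row l (lin1_mx f) = f (delta_mx 0 l).
  by apply/rowP=> k; rewrite !mxE.
have E k (j : {linear P -> 'rV[R]_k}) (q : {linear 'rV[R]_k -> P}) :
    ext_mx j q phi = 1%:M + lin1_mx (j \o psi' \o q).
  apply/row_matrixP=> l; rewrite linearD /= !rowL row1 /=.
  by rewrite /psi linearB addrCA.
have M a b c (f : {linear 'rV[R]_a -> 'rV[R]_b})
    (g : {linear 'rV[R]_b -> 'rV[R]_c}) :
    lin1_mx f *m lin1_mx g = lin1_mx (g \o f).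
  by apply/row_matrixP=> l; rewrite row_mul !rowL /= mul_rV_lin1.
rewrite !E.
have -> : lin1_mx (i \o psi' \o r)
        = lin1_mx (i' \o r) *m lin1_mx (i \o psi' \o r').
  by rewrite M; apply/row_matrixP=> l; rewrite !rowL /= ir'.
rewrite det_1DM M; congr (\det (_ + _)).
by apply/row_matrixP=> l; rewrite !rowL /= ir.
Qed.

End Determinant.

Section WSL.
Variable R : comPzRingType.

Definition perp (m n : nat) (M : 'M[R]_m) (N : 'M[R]_n) : 'M[R]_(m + n) :=
  block_mx M 0 0 N.

Definition psi2 : 'M[R]_2 :=
  \matrix_(i, j) ((i < j)%N%:R - (j < i)%N%:R).

Lemma double_add2 n : (n.*2 + 2 = n.+1.*2)%N.
Proof. by rewrite addn2. Qed.

(* psi n is the matrix usually written psi_{2n}. *)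
Fixpoint psi (n : nat) : 'M[R]_(n.*2) :=
  if n is n'.+1 then
    castmx (double_add2 n', double_add2 n') (perp (psi n') psi2)
  else 0.

Definition alternating_mx (n : nat) (M : 'M[R]_n) : Prop :=
  M^T = - M /\ forall i, M i i = 0.

Definition invertible_mx (n : nat) (M : 'M[R]_n) : Prop :=
  exists N : 'M[R]_n, M *m N = 1%:M /\ N *m M = 1%:M.

Definition in_A (n : nat) (M : 'M[R]_(n.*2)) : Prop :=
  alternating_mx M /\ invertible_mx M.

(* The Pfaffian, by expansion along the first row. *)
Fixpoint pf (n : nat) : 'M[R]_n -> R :=
  match n return 'M[R]_n -> R with
  | 0 => fun _ => 1
  | 1 => fun _ => 0
  | m.+2 => fun M => \sum_(j < m.+1) (-1) ^+ j * M ord0 (lift ord0 j) *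
      pf (\matrix_(k < m, l < m) M (lift ord0 (lift j k)) (lift ord0 (lift j l)))
  end.

Lemma perp_size m n k : (n.*2 + (m + k).*2 = m.*2 + (n + k).*2)%N.
Proof. by rewrite -!doubleD addnCA. Qed.

(* M ~_SL N; the cast only identifies the two ways of writing the size
   2m + 2n + 2s. *)
Definition SL_equiv_mx (m n : nat) (M : 'M[R]_(m.*2)) (N : 'M[R]_(n.*2))
    : Prop :=
  exists (s : nat) (E : 'M[R]_(m.*2 + (n + s).*2)),
    \det E = 1 /\
    perp M (psi (n + s)) =
      E^T *m castmx (perp_size m n s, perp_size m n s) (perp N (psi (m + s)))
        *m E.

(* Every class in the kernel of the Pfaffian W'_SL(R) -> R^* is the neutral
   class, which is the class of psi_2. *)
Definition WSL_trivial : Prop :=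
  forall (n : nat) (M : 'M[R]_(n.*2)),
    in_A M -> pf M = 1 -> SL_equiv_mx M (psi 1).

End WSL.

(* Main.v *)
Require Import Defs.
From HB Require Import structures.
From mathcomp Require Import all_boot all_order all_algebra.
From mathcomp Require Import boolp classical_sets.
From mathcomp Require Import ring.

(** Write P3, P4, P5 for the sums of P0 with one, two and three free summands,
    e4 for the last basis vector of P4, and om0 = chi0 _|_ psi_2.

    The proof is a comparison of two actions of SL(P4): on the alternating forms
    on P4 of Pfaffian one relative to om0, and on the orbit of e4.  A form chi
    of Pfaffian one gives the unimodular functional chi(-, e4) on P3, and chi
    is recovered from this functional together with a section of it, up to
    shears that fix e4.  Explicitly, a functional a with a section (s0, c) gives
    the form [section_form], the analogue for a module of rank two of the
    alternating matrix of size four that Vaserstein attaches to a unimodular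
    row of length three.  Hence Um(P3)/SL(P3) is the set of forms of Pfaffian
    one modulo the stabilizer of e4 in SL(P4).  This set is a single orbit if
    and only if SL(P4) acts transitively on the forms of Pfaffian one and the
    stabilizer Sp(om0) of om0 acts transitively on the orbit SL(P4) e4.  What
    remains is that the first of these two conditions amounts to the triviality
    of W_SL(R).

    From transitivity to W_SL: a matrix M of Pfaffian one is added to chi0, and
    the sum is split into hyperbolic planes one at a time.  Each step
    ([split_hyperbolic]) needs transitivity on the unimodular functionals of
    P0 (+) R^k with k odd.  For k = 1 this is the assumption of the implication,
    for k = 3 the hypothesis on P5, and for larger k it follows from the stable
    range.  The end result is c chi0 plus a standard form, and the Pfaffian
    shows that c = 1.

    From W_SL to transitivity: if W_SL is trivial, a form of Pfaffian one on P4
    and om0 become isometric after adding hyperbolic planes.  The planes are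
    removed again with symplectic transvections ([cancel_hyperbolic]); this
    takes place on modules of rank at least six, which are in the stable range.

    Three pieces of theory carry the argument.

    First, a stable range theorem for P0 (+) R^k over a Noetherian ring of
    dimension at most four ([general_position]).  Every free coordinate makes
    the bad primes one step higher ([general_position_free]), and P0 itself
    accounts for two steps ([general_position_rank2]).  That part uses chi0: the
    value chi0(z, q) stays in the order ideal of z when multiples of q are added
    to z.

    Second, Pfaffians.  Expansion along the first entry is interior
    multiplication, which squares to zero ([contract_contract]); so the
    Pfaffian of a Gram matrix is an alternating multilinear function of the
    vectors and is multiplied by the determinant under a change of variables
    ([alternating_det]).

    Third, the Pfaffian of a form on P4 is by definition that of its extension
    to a free module in which P4 is an orthogonal summand, and it has to be
    computed in terms of P0 ([relative_pfE]).  Since P0 is not free, for any two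
    vectors x and y the summand P0 is exchanged with a free plane by means of a
    map whose determinant divides a power of chi0(x, y); these powers generate
    the unit ideal.

    The module P0 enters only through the fact that chi0 is a
    [symplectic_plane]: a vector z is determined by its pairings with x and y
    up to the factor chi0(x, y), and the values of chi0 generate the unit
    ideal.  This is checked at each prime, in local coordinates
    ([symplectic_plane_of_rank2]). *)

Set Implicit Arguments.
Unset Strict Implicit.
Unset Printing Implicit Defensive.

Import GRing.Theory.
Local Open Scope ring_scope.

Section LinOf.
Variables (R : pzRingType) (U V : lmodType R) (f : U -> V).
Hypothesis fL : linear f.
Definition lin_of : {linear U -> V} :=
  HB.pack_for {linear U -> V} f (GRing.isLinear.Build _ _ _ _ f fL).
End LinOf.

(** * Prime ideals of a Noetherian ring *)

Section Primes.
Local Open Scope classical_set_scope.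
Variable R : comPzRingType.
Implicit Types (I J P : set R).

Lemma ideal_sum I (T : finType) (A : pred T) (F : T -> R) :
  is_ideal I -> (forall i, A i -> I (F i)) -> I (\sum_(i | A i) F i).
Proof. by case=> I0 ID _ h; apply: big_ind. Qed.

Lemma ideal_mul I a x : is_ideal I -> I x -> I (a * x).
Proof. by case=> _ _; apply. Qed.

Lemma ideal_mulr I a x : is_ideal I -> I x -> I (x * a).
Proof. by rewrite mulrC; apply: ideal_mul. Qed.

Lemma ideal_add I x y : is_ideal I -> I x -> I y -> I (x + y).
Proof. by case=> _ h _; apply: h. Qed.

Lemma ideal0 I : is_ideal I -> I 0.
Proof. by case. Qed.

Lemma ideal_opp I x : is_ideal I -> I x -> I (- x).
Proof. by move=> hI hx; rewrite -mulN1r; apply: ideal_mul. Qed.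

Lemma ideal_subr I x y : is_ideal I -> I (x + y) -> I y -> I x.
Proof.
by move=> hI h1 h2; rewrite -(addrK y x); apply: ideal_add => //; apply: ideal_opp.
Qed.

Lemma prime_is_ideal P : prime_ideal P -> is_ideal P. Proof. by case. Qed.

(** Failing the conclusion at one ideal would, by choice, produce a strictly
    increasing sequence of ideals; finitely many generators of its union all
    lie in one term. *)
Lemma noetherian_ind (C : set R -> Prop) : noetherian R ->
  (forall I, is_ideal I ->
     (forall J, is_ideal J -> I `<` J -> C J) -> C I) ->
  forall I, is_ideal I -> C I.
Proof.
move=> noeth ind I0 idI0; apply: contrapT => nC0.
pose S := {I : set R | is_ideal I /\ ~ C I}.
have next (s : S) : exists t : S, sval s `<` sval t.
  case: s => I [idI nC] /=; apply: contrapT => none; apply: nC.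
  apply: ind => // J idJ ltIJ; apply: contrapT => nCJ; apply: none.
  by exists (exist _ J (conj idJ nCJ)).
have [f fP] := choice next.
pose u n := sval (iter n f (exist _ I0 (conj idI0 nC0) : S)).
have uid n : is_ideal (u n) by rewrite /u; case: (iter n f _) => J [].
have ult n : u n `<` u n.+1 by apply: fP.
have ule m n : (m <= n)%N -> u m `<=` u n.
  elim: n => [|n IH]; first by rewrite leqn0 => /eqP->.
  rewrite leq_eqVlt => /orP[/eqP->//|/IH h]; apply: subset_trans h _.
  by apply: properW; apply: ult.
pose U : set R := fun x => exists n, u n x.
have idU : is_ideal U.
  split; first by exists 0%N; apply: ideal0.
  - move=> x y [m hx] [n hy]; exists (maxn m n).
    apply: ideal_add => //.
      by apply: ule hx; apply: leq_maxl.
    by apply: ule hy; apply: leq_maxr.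
  - by move=> a x [m hx]; exists m; apply: ideal_mul.
have [k [g gP]] := noeth U idU.
have gU i : U (g i).
  apply/gP; exists (fun j => (j == i)%:R).
  rewrite (bigD1 i) //= eqxx mul1r big1 ?addr0 // => j /negbTE->.
  by rewrite mul0r.
have [N NP] := choice gU.
pose M := (\max_i N i)%N.
have gM i : u M (g i) by apply: (ule (N i)) (NP i); apply: leq_bigmax.
have [_ []] := ult M; move=> x hx.
have /gP[c ->] : U x by exists M.+1.
by apply: ideal_sum => // i _; apply: ideal_mul.
Qed.

Definition adjoin I x : set R := fun z => exists i c, I i /\ z = i + c * x.

Lemma adjoin_ideal I x : is_ideal I -> is_ideal (adjoin I x).
Proof.
move=> hI; split.
- by exists 0, 0; rewrite mul0r addr0; split=> //; apply: ideal0.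
- move=> _ _ [i [c [hi ->]]] [j [d [hj ->]]]; exists (i + j), (c + d).
  by split; [apply: ideal_add | ring].
- move=> a _ [i [c [hi ->]]]; exists (a * i), (a * c).
  by split; [apply: ideal_mul | ring].
Qed.

Lemma adjoin_sup I x : is_ideal I -> I `<=` adjoin I x.
Proof.
by move=> hI i hi; exists i, 0; split=> //; rewrite mul0r addr0.
Qed.

Lemma adjoin_proper I x : is_ideal I -> ~ I x -> I `<` adjoin I x.
Proof.
move=> hI nx; split; last first.
  move=> h; apply: nx; apply: h; exists 0, 1.
  by split; [apply: ideal0 | rewrite mul1r add0r].
exact: adjoin_sup.
Qed.

Lemma adjoin_sub I J x : is_ideal J -> I `<=` J -> J x -> adjoin I x `<=` J.
Proof.
move=> hJ IJ hx _ [i [c [hi ->]]]; apply: ideal_add => //; first exact: IJ.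
exact: ideal_mul.
Qed.

Lemma nonprime_split I : is_ideal I -> ~ I 1 -> ~ prime_ideal I ->
  exists x y, [/\ I (x * y), ~ I x & ~ I y].
Proof.
move=> hI n1 nP; apply: contrapT => h; apply: nP; split=> // x y hxy.
have [hx|hx] := pselect (I x); first by left.
have [hy|hy] := pselect (I y); first by right.
by case: h; exists x, y.
Qed.

(** Noetherian induction again: an improper product [x * y] in [I] with
    neither factor in [I] reduces [I] to the larger ideals [I + (x)] and
    [I + (y)], whose product lies in [I]. *)
Lemma proper_sub_prime I : noetherian R -> is_ideal I -> ~ I 1 ->
  exists P, prime_ideal P /\ I `<=` P.
Proof.
move=> noeth idI; move: I idI; apply: (noetherian_ind noeth) => I hI IH n1.
have [pI|npI] := pselect (prime_ideal I); first by exists I; split.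
have [x [y [hxy hx hy]]] := nonprime_split hI n1 npI.
have [[i [c [hi ei]]]|nx] := pselect (adjoin I x 1); last first.
  have [P [pP sP]] := IH _ (adjoin_ideal x hI) (adjoin_proper hI hx) nx.
  by exists P; split=> //; apply: subset_trans sP; apply: adjoin_sup.
have [[j [d [hj ej]]]|ny] := pselect (adjoin I y 1); last first.
  have [P [pP sP]] := IH _ (adjoin_ideal y hI) (adjoin_proper hI hy) ny.
  by exists P; split=> //; apply: subset_trans sP; apply: adjoin_sup.
case: n1.
have -> : 1 = (j + d * y) * i + (c * x) * j + (c * d) * (x * y).
  rewrite -[LHS]mulr1 {1}ei {1}ej; ring.
apply: ideal_add => //; last exact: ideal_mul.
by apply: ideal_add => //; apply: ideal_mul.
Qed.

Definition prime_cover I m (p : 'I_m -> set R) : Prop :=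
  [/\ forall i, prime_ideal (p i), forall i, I `<=` p i
    & forall P, prime_ideal P -> I `<=` P -> exists i, p i `<=` P].

Lemma prime_cover_exists I : noetherian R -> is_ideal I ->
  exists m (p : 'I_m -> set R), prime_cover I p.
Proof.
move=> noeth; move: I; apply: (noetherian_ind noeth) => I hI IH.
have [h1|n1] := pselect (I 1).
  exists 0%N, (fun _ => I); split=> [i|i|P [_ nP1 _] IP]; first by case: i.
    by case: i.
  by case: nP1; apply: IP.
have [pI|npI] := pselect (prime_ideal I).
  by exists 1%N, (fun _ => I); split=> [i|i|P pP IP] //; exists ord0.
have [x [y [hxy hx hy]]] := nonprime_split hI n1 npI.
have [m [p [p1 p2 p3]]] := IH _ (adjoin_ideal x hI) (adjoin_proper hI hx).
have [n [q [q1 q2 q3]]] := IH _ (adjoin_ideal y hI) (adjoin_proper hI hy).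
exists (m + n)%N, (fun i => match split i with inl j => p j | inr j => q j end).
split.
- by move=> i; case: (split i).
- move=> i; case: (split i) => j.
    by apply: subset_trans (p2 j); apply: adjoin_sup.
  by apply: subset_trans (q2 j); apply: adjoin_sup.
move=> P pP IP; have idP := prime_is_ideal pP.
have [_ _ /(_ x y (IP _ hxy)) []] := pP => hP.
  have [i hi] := p3 P pP (adjoin_sub idP IP hP).
  by exists (lshift n i); rewrite (unsplitK (inl i)).
have [i hi] := q3 P pP (adjoin_sub idP IP hP).
by exists (rshift m i); rewrite (unsplitK (inr i)).
Qed.

(** A covering family of the least possible size has no inclusions between
    its members: the larger of two comparable members could be dropped. *)
Lemma minimal_primes I : noetherian R -> is_ideal I ->
  exists m (p : 'I_m -> set R),
    prime_cover I p /\ forall i j, p i `<=` p j -> i = j.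
Proof.
move=> noeth hI.
have ex : exists m, `[< exists p : 'I_m -> set R, prime_cover I p >].
  by have [m [p h]] := prime_cover_exists noeth hI; exists m; apply/asboolP; exists p.
case: (ex_minnP ex) => m /asboolP[p cp] mmin; exists m, p; split=> // i j pij.
apply: contrapT => nij; case: m p cp mmin i j pij nij => [|m] p [p1 p2 p3] mmin i j.
  by case: i.
move=> pij nij; have: (m.+1 <= m)%N; last by rewrite ltnn.
apply: mmin; apply/asboolP; exists (p \o lift j); split=> [k|k|P pP IP] /=.
- exact: p1.
- exact: p2.
have [k pk] := p3 P pP IP.
have [ejk|ejk] := eqVneq j k.
  subst k; have [l el] : exists l, i = lift j l.
    by case: (unliftP j i) => [l ->|eij]; [exists l | case: nij].
  by exists l; rewrite /= -el; apply: subset_trans pk.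
case: (unliftP j k) => [l el|ekj]; first by exists l; rewrite /= -el.
by rewrite ekj eqxx in ejk.
Qed.

Lemma prime_prod P (T : finType) (F : T -> R) : prime_ideal P ->
  (forall i, ~ P (F i)) -> ~ P (\prod_i F i).
Proof.
case=> _ n1 pm h; apply: (big_ind (fun x => ~ P x)) => // x y hx hy hxy.
by case: (pm _ _ hxy).
Qed.

Lemma ideal_prod I (T : finType) (F : T -> R) i : is_ideal I ->
  I (F i) -> I (\prod_j F j).
Proof. by move=> hI h; rewrite (bigD1 i) //=; apply: ideal_mulr. Qed.

(** Each [s i] is a product of witnesses of non-inclusions into the prime
    [p i].  Sums weighted by the [s i] prescribe residues prime by prime, as in
    the Chinese remainder theorem. *)
Lemma separate m (p : 'I_m -> set R) n (J : 'I_n -> set R)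
    (B : 'I_m -> Prop) (C : 'I_n -> Prop) :
  (forall i, prime_ideal (p i)) -> (forall i j, p i `<=` p j -> i = j) ->
  (forall j, C j -> is_ideal (J j)) ->
  (forall i j, B i -> C j -> ~ (J j `<=` p i)) ->
  exists s : 'I_m -> R,
    [/\ forall i, B i -> ~ p i (s i), forall i, ~ B i -> s i = 0,
        forall i j, j != i -> p j (s i) & forall i j, C j -> J j (s i)].
Proof.
move=> pp anti idJ nJ.
have pid i := prime_is_ideal (pp i).
have h i : exists s, [/\ B i -> ~ p i s, ~ B i -> s = 0,
    forall j, j != i -> p j s & forall j, C j -> J j s].
  have [Bi|nBi] := pselect (B i); last first.
    by exists 0; split=> // j h; apply: ideal0 => //; apply: idJ.
  have ht j : exists t, (j != i -> p j t) /\ ~ p i t.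
    have [->|ji] := eqVneq j i.
      by exists 1; split=> //; case: (pp i).
    have : ~ (p j `<=` p i) by move=> /anti e; rewrite e eqxx in ji.
    by move=> /existsNP[x /not_implyP[x1 x2]]; exists x.
  have hu j : exists u, (C j -> J j u) /\ ~ p i u.
    have [Cj|nC] := pselect (C j); last first.
      by exists 1; split=> //; case: (pp i).
    have /existsNP[x /not_implyP[x1 x2]] := nJ _ _ Bi Cj.
    by exists x.
  have [t tP] := choice ht; have [u uP] := choice hu.
  exists ((\prod_j t j) * (\prod_j u j)); split=> // [_|j ji|j Cj].
  - case: (pp i) => _ _ /[apply] -[].
      by apply: prime_prod => // j; case: (tP j).
    by apply: prime_prod => // j; case: (uP j).
  - by apply: ideal_mulr => //; apply: (ideal_prod (i := j)) => //; apply: (tP j).1.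
  apply: ideal_mul; first exact: idJ.
  by apply: (ideal_prod (i := j)); [apply: idJ | apply: (uP j).1].
have [s sP] := choice h.
by exists s; split=> [i|i|i|i]; case: (sP i).
Qed.

Definition depth_ge P (d : nat) : Prop :=
  exists p, prime_chain d p /\ p d = P.

Lemma depth_ge0 P : prime_ideal P -> depth_ge P 0.
Proof. by move=> pP; exists (fun _ => P). Qed.

Lemma depth_geS P P' d : depth_ge P d -> prime_ideal P' -> P `<` P' ->
  depth_ge P' d.+1.
Proof.
case=> p [[c1 c2] ep] pP' lt; exists (fun i => if (i <= d)%N then p i else P').
split; last by rewrite ltnn.
split=> i hi.
  by case: ifP => // h; apply: c1.
rewrite -ltnS hi; case: ifP => h; first exact: c2.
have -> : i = d by apply/eqP; rewrite eqn_leq -ltnS hi leqNgt h.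
by rewrite ep.
Qed.

End Primes.

(** * General position of an element of a module *)

Section StableRange.
Local Open Scope classical_set_scope.
Variable R : comPzRingType.
Hypothesis noeth : noetherian R.

(** Over a projective module this says that the class of [z] in the fibre at
    [P] is zero. *)
Definition vanishes_at (Q : lmodType R) (P : set R) (z : Q) : Prop :=
  forall f : {linear Q -> R^o}, P (f z).

(** The inductive form of the theorems of Bass and Serre: a multiple of [a]
    can be added to [z] so that the new element vanishes only at primes that
    contain [a] or have height at least [d]. *)
Definition general_position (Q : lmodType R) (d : nat) : Prop :=
  forall (a : R) (z : Q), exists w, forall P, prime_ideal P ->
    vanishes_at P (z + a *: w) -> ~ P a -> depth_ge P d.

Section Vanish.
Variables (Q : lmodType R) (P : set R).
Hypothesis idP : is_ideal P.

Lemma vanishes_at0 : vanishes_at P (0 : Q).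
Proof. by move=> f; rewrite linear0; apply: ideal0. Qed.

Lemma vanishes_atD (x y : Q) :
  vanishes_at P x -> vanishes_at P y -> vanishes_at P (x + y).
Proof. by move=> hx hy f; rewrite linearD; apply: ideal_add. Qed.

Lemma vanishes_at_subr (x y : Q) :
  vanishes_at P (x + y) -> vanishes_at P y -> vanishes_at P x.
Proof.
move=> h hy f; have := h f; rewrite linearD => h'.
by apply: (ideal_subr idP h'); apply: hy.
Qed.

Lemma vanishes_atZ a (x : Q) : vanishes_at P x -> vanishes_at P (a *: x).
Proof. by move=> hx f; rewrite linearZ; apply: ideal_mul. Qed.

Lemma vanishes_at_coef a (x : Q) : P a -> vanishes_at P (a *: x).
Proof. by move=> ha f; rewrite linearZ; apply: ideal_mulr. Qed.

Lemma vanishes_at_sum (T : finType) (A : pred T) (F : T -> Q) :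
  (forall i, A i -> vanishes_at P (F i)) -> vanishes_at P (\sum_(i | A i) F i).
Proof.
by move=> h; apply: (big_ind (vanishes_at P)) => //;
  [exact: vanishes_at0 | exact: vanishes_atD].
Qed.

End Vanish.

Lemma vanishes_at_prime (Q : lmodType R) P a (x : Q) : prime_ideal P ->
  ~ P a -> vanishes_at P (a *: x) -> vanishes_at P x.
Proof.
by move=> [_ _ pm] na h f; have := h f; rewrite linearZ => /pm[].
Qed.

Definition order_ideal (Q : lmodType R) (z : Q) : set R :=
  fun c => exists f : {linear Q -> R^o}, c = f z.

Lemma order_ideal_ideal (Q : lmodType R) (z : Q) : is_ideal (order_ideal z).
Proof.
split.
- have L : linear (fun _ : Q => 0 : R^o) by move=> a x y; rewrite scaler0 addr0.
  by exists (lin_of L).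
- move=> _ _ [f ->] [g ->].
  have L : linear (fun x => f x + g x : R^o).
    by move=> a x y; rewrite !linearP scalerDr addrACA.
  by exists (lin_of L).
- move=> a _ [f ->].
  have L : linear (fun x => a * f x : R^o).
    move=> b x y; rewrite linearP mulrDr; congr (_ + _).
    by rewrite /GRing.scale /= mulrCA.
  by exists (lin_of L).
Qed.

Lemma order_idealP (Q : lmodType R) (z : Q) P :
  order_ideal z `<=` P <-> vanishes_at P z.
Proof. by split=> [h f | h _ [f ->]]; [apply: h; exists f | apply: h]. Qed.

(** One more free coordinate gains one unit of height: off [a], the bad primes
    of height exactly [d] are among the finitely many minimal primes of the
    order ideal reached so far, and the new coordinate can be moved off all of
    these at once. *)
Lemma general_position_free (Q : lmodType R) d :
  general_position Q d -> general_position (Q * R^o)%type d.+1.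
Proof.
move=> gp a [q r]; have [w wP] := gp a q.
have [m [p [[p1 p2 p3] anti]]] := minimal_primes noeth (order_ideal_ideal (q + a *: w)).
have pid i := prime_is_ideal (p1 i).
have [s [s1 s2 s3 _]] := @separate _ m p m p (fun i => p i r)
    (fun _ => False) p1 anti (fun _ => False_ind _) (fun _ _ _ => False_ind _).
exists (w, \sum_i s i) => P pP vP nPa.
have idP := prime_is_ideal pP.
have vw : vanishes_at P (q + a *: w).
  move=> f; have L : linear (f \o fst : Q * R^o -> R^o).
    by move=> b x y; rewrite /= linearP.
  exact: vP (lin_of L).
have rP : P (r + a * \sum_i s i).
  have L : linear (snd : Q * R^o -> R^o) by [].
  exact: vP (lin_of L).
have [i pi] := p3 P pP (proj2 (order_idealP _ _) vw).
have npa : ~ p i a by move/pi.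
apply: (depth_geS (P := p i)) => //.
  by apply: wP => //; apply/order_idealP.
split=> // Ppi; have := Ppi _ rP; rewrite (bigD1 i) //= => h.
have hr : p i (\sum_(j | j != i) s j).
  by apply: ideal_sum => // j ji; apply: s3; rewrite eq_sym.
have [ir|nir] := pselect (p i r).
  have : p i (a * s i).
    apply: (ideal_subr (pid i) (y := r + a * \sum_(j | j != i) s j)).
      by rewrite addrCA -mulrDr.
    by apply: (ideal_add (pid i)) => //; apply: (ideal_mul _ (pid i)).
  by case: (p1 i) => _ _ pm /pm[]//; apply: s1.
apply: (nir); apply: (ideal_subr (pid i) h); rewrite (s2 i) // add0r.
exact: (ideal_mul _ (pid i)).
Qed.

End StableRange.

(** * Alternating forms *)

Definition perfect (R : comPzRingType) (Q : lmodType R) (b : Q -> Q -> R) :=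
  forall f : {linear Q -> R^o}, exists y, forall x, f x = b y x.

Definition alternating (R : comPzRingType) (Q : lmodType R) (b : Q -> Q -> R) :=
  @alternating_bilinear R Q R^o b.

Section AlternatingTheory.
Variables (R : comPzRingType) (Q : lmodType R) (b : Q -> Q -> R).
Hypothesis ab : alternating b.

Lemma altDl x y z : b (x + y) z = b x z + b y z.
Proof. by case: ab => h _ _; have := h 1 x y z; rewrite !scale1r. Qed.

Lemma altDr x y z : b z (x + y) = b z x + b z y.
Proof. by case: ab => _ h _; have := h 1 x y z; rewrite !scale1r. Qed.

Lemma altxx x : b x x = 0.
Proof. by case: ab. Qed.

Lemma alt0l z : b 0 z = 0.
Proof.
by apply: (addrI (b 0 z)); rewrite addr0 -altDl addr0.
Qed.

Lemma alt0r z : b z 0 = 0.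
Proof.
by apply: (addrI (b z 0)); rewrite addr0 -altDr addr0.
Qed.

Lemma altZl a x z : b (a *: x) z = a * b x z.
Proof.
by case: ab => h _ _; have := h a x 0 z; rewrite addr0 alt0l addr0.
Qed.

Lemma altZr a x z : b z (a *: x) = a * b z x.
Proof.
by case: ab => _ h _; have := h a x 0 z; rewrite addr0 alt0r addr0.
Qed.

Lemma altC x y : b y x = - b x y.
Proof.
apply/eqP; rewrite -addr_eq0 addrC; apply/eqP.
by have := altxx (x + y); rewrite altDl !altDr !altxx add0r addr0.
Qed.

Lemma altNl x z : b (- x) z = - b x z.
Proof. by rewrite -scaleN1r altZl mulN1r. Qed.

Lemma altNr x z : b z (- x) = - b z x.
Proof. by rewrite -scaleN1r altZr mulN1r. Qed.

Lemma altBl x y z : b (x - y) z = b x z - b y z.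
Proof. by rewrite altDl altNl. Qed.

Lemma altBr x y z : b z (x - y) = b z x - b z y.
Proof. by rewrite altDr altNr. Qed.

Lemma alt_linl z : linear (fun x => b x z : R^o).
Proof. by case: ab => h _ _ a x y; apply: h. Qed.

Lemma alt_linr z : linear (fun x => b z x : R^o).
Proof. by case: ab => _ h _ a x y; apply: h. Qed.

Lemma alt_suml (T : finType) (A : pred T) (F : T -> Q) z :
  b (\sum_(i | A i) F i) z = \sum_(i | A i) b (F i) z.
Proof.
by apply: (big_morph (fun x => b x z)) => [x y|]; [exact: altDl | exact: alt0l].
Qed.

Lemma alt_sumr (T : finType) (A : pred T) (F : T -> Q) z :
  b z (\sum_(i | A i) F i) = \sum_(i | A i) b z (F i).
Proof.
by apply: (big_morph (b z)) => [x y|]; [exact: altDr | exact: alt0r].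
Qed.

End AlternatingTheory.

(** * General position in rank two and the stable range *)

Section RankTwoGeneralPosition.
Local Open Scope classical_set_scope.
Variables (R : comPzRingType) (Q : lmodType R) (b : Q -> Q -> R).
Hypothesis noeth : noetherian R.
Hypothesis ab : alternating b.
Hypothesis pb : perfect b.
Hypothesis Q_nonzero :
  forall P : set R, prime_ideal P -> exists z : Q, ~ vanishes_at P z.

Lemma nonvanishing_pairing P z : ~ vanishes_at P z -> exists w, ~ P (b z w).
Proof.
move=> /existsNP[f nf]; have [y yP] := pb f; exists (- y).
by rewrite (altNr ab) -(altC ab) -yP.
Qed.

(** First move [z] off the minimal primes.  Then pick [q] such that
    [c = b z q] avoids the minimal primes too, while [q] survives at the primes
    minimal over the order ideal of [z].  Replacing [z] by [z + a s q] keeps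
    [c = b (z + a s q) q] in the order ideal, so the bad primes contain a prime
    minimal over [c], hence have height at least one; a suitable [s] removes
    these finitely many primes as well. *)
Lemma general_position_rank2 : general_position Q 2.
Proof.
move=> a z0.
have zid : is_ideal ([set 0] : set R).
  split=> [|x y -> ->|c x ->] //=; first by rewrite addr0.
  by rewrite mulr0.
have [m [p [[p1 p2 p3] anti]]] := minimal_primes noeth zid.
have pid i := prime_is_ideal (p1 i).
have sub0P (P : set R) : prime_ideal P -> [set 0] `<=` P.
  by move=> pP x ->; apply: ideal0; apply: prime_is_ideal.
have [e eP] := choice (fun i => Q_nonzero (p1 i)).
have [z [u [zE zP]]] : exists z u, z = z0 + a *: u /\
    forall i, ~ p i a -> ~ vanishes_at (p i) z.
  have [s [s1 s2 s3 _]] := @separate _ m p m p (fun i => vanishes_at (p i) z0)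
    (fun _ => False) p1 anti (fun _ => False_ind _) (fun _ _ _ => False_ind _).
  exists (z0 + a *: \sum_i s i *: e i), (\sum_i s i *: e i); split=> // i nai.
  rewrite (bigD1 i) //= => h.
  have hr : vanishes_at (p i) (\sum_(j | j != i) s j *: e j).
    apply: vanishes_at_sum => // j ji; apply: vanishes_at_coef => //.
    by apply: s3; rewrite eq_sym.
  have h1 : vanishes_at (p i) (z0 + a *: (s i *: e i)).
    apply: (vanishes_at_subr (pid i) (y := a *: (\sum_(j | j != i) s j *: e j))).
      by rewrite -addrA -scalerDr.
    exact: vanishes_atZ.
  have [vi|nvi] := pselect (vanishes_at (p i) z0).
    apply: (eP i); apply: (vanishes_at_prime (p1 i) (s1 i vi)).
    apply: (vanishes_at_prime (p1 i) nai).
    by apply: (vanishes_at_subr (pid i) (y := z0)); rewrite // addrC.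
  by apply: (nvi); apply: (vanishes_at_subr (pid i) h1); rewrite s2 // scale0r scaler0;
    exact: vanishes_at0.
have [m1 [p' [[p'1 p'2 p'3] anti']]] := minimal_primes noeth (order_ideal_ideal z).
have p'id i := prime_is_ideal (p'1 i).
have [e' e'P] := choice (fun i => Q_nonzero (p'1 i)).
have [s' [s'1 s'2 s'3 _]] := @separate _ m1 p' m1 p' (fun i => True)
    (fun _ => False) p'1 anti' (fun _ => False_ind _) (fun _ _ _ => False_ind _).
pose q1 := \sum_i s' i *: e' i.
have q1P i : ~ vanishes_at (p' i) q1.
  rewrite /q1 (bigD1 i) //= => h; apply: (e'P i).
  apply: (vanishes_at_prime (p'1 i) (s'1 i I)).
  apply: (vanishes_at_subr (p'id i) h).
  apply: vanishes_at_sum => // j ji; apply: vanishes_at_coef => //.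
  by apply: s'3; rewrite eq_sym.
pose B i := ~ p i a /\ p i (b z q1).
have wex i : exists w, ~ p i a -> ~ p i (b z w).
  have [h|h] := pselect (p i a); first by exists 0.
  by have [w hw] := nonvanishing_pairing (zP i h); exists w.
have [w wP] := choice wex.
(* No [p' j] is contained in a [p i] that avoids [a], since [z] vanishes at
   [p' j] but not at [p i].  Hence the correction terms can be chosen inside
   all the [p' j], where they leave the class of [q1] unchanged. *)
have [s [s1 s2 s3 s4]] := @separate _ m p m1 p' B (fun j => ~ p' j a)
    p1 anti (fun j _ => p'id j) (fun i j (Bi : B i) _ h =>
      zP i Bi.1 (proj1 (order_idealP z (p i)) (subset_trans (p'2 j) h))).
pose q := q1 + \sum_i s i *: w i.
have qP' j : ~ p' j a -> ~ vanishes_at (p' j) q.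
  move=> nja h; apply: (q1P j); apply: (vanishes_at_subr (p'id j) h).
  by apply: vanishes_at_sum => // i _; apply: vanishes_at_coef => //; apply: s4.
pose c := b z q.
have cP i : ~ p i a -> ~ p i c.
  move=> nia; rewrite /c /q (bigD1 i) //= !(altDr ab) (altZr ab) => h.
  have h1 : p i (b z q1 + s i * b z (w i)).
    apply: (ideal_subr (pid i) (y := b z (\sum_(j | j != i) s j *: w j))).
      by rewrite -addrA.
    rewrite (alt_sumr ab); apply: ideal_sum => // j ji; rewrite (altZr ab).
    by apply: ideal_mulr => //; apply: s3; rewrite eq_sym.
  have [Bi|nB] := pselect (p i (b z q1)).
    have : p i (s i * b z (w i)).
      by apply: (ideal_subr (pid i) (y := b z q1)); rewrite // addrC.
    by case: (p1 i) => _ _ pm /pm[]; [apply: s1 | apply: wP].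
  apply: (nB); apply: (ideal_subr (pid i) h1); rewrite s2 ?mul0r.
    exact: ideal0.
  by case.
have cid : is_ideal (fun x : R => exists d, x = d * c).
  split=> [|_ _ [d ->] [d' ->]|d _ [d' ->]].
  - by exists 0; rewrite mul0r.
  - by exists (d + d'); rewrite mulrDl.
  - by exists (d * d'); rewrite mulrA.
have [m2 [p'' [[p''1 p''2 p''3] anti'']]] := minimal_primes noeth cid.
have p''id i := prime_is_ideal (p''1 i).
have p''c i : p'' i c by apply: p''2; exists 1; rewrite mul1r.
have [t [t1 t2 t3 _]] := @separate _ m2 p'' m2 p'' (fun i => vanishes_at (p'' i) z)
    (fun _ => False) p''1 anti'' (fun _ => False_ind _) (fun _ _ _ => False_ind _).
pose tt := \sum_i t i.
pose z' := z + a *: (tt *: q).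
have ttE i : exists2 x, p'' i x & tt = t i + x.
  exists (\sum_(j | j != i) t j); last by rewrite /tt (bigD1 i).
  by apply: ideal_sum => // j ji; apply: t3; rewrite eq_sym.
have z'P i : ~ p'' i a -> ~ vanishes_at (p'' i) z'.
  move=> nia h; have [x px ttx] := ttE i.
  have [vi|nvi] := pselect (vanishes_at (p'' i) z); last first.
    apply: (nvi); apply: (vanishes_at_subr (p''id i) h).
    apply: vanishes_atZ => //; apply: vanishes_at_coef => //.
    by rewrite ttx t2 // add0r.
  have [j pj] := p'3 _ (p''1 i) (proj2 (order_idealP _ _) vi).
  have pjc : p' j c.
    apply: p'2; have L := alt_linl ab q.
    by exists (lin_of L).
  have [k pk] : exists k, p'' k `<=` p' j.
    by apply: p''3 => // _ [d ->]; apply: ideal_mul.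
  have eki : k = i by apply: anti''; apply: subset_trans pj.
  rewrite eki in pk.
  have vq : vanishes_at (p'' i) q.
    have nt : ~ p'' i tt.
      move=> htt; apply: (t1 i vi); apply: (ideal_subr (y := x)) => //.
      by rewrite -ttx.
    apply: (vanishes_at_prime (p''1 i) nt); apply: (vanishes_at_prime (p''1 i) nia).
    by apply: (vanishes_at_subr (p''id i) (y := z)); rewrite // addrC.
  apply: (qP' j); first by move/pj.
  by move=> f; apply: pk.
exists (u + tt *: q) => P pP vP nPa.
have {}vP : vanishes_at P z' by rewrite /z' zE -addrA -scalerDr.
have cz' : b z' q = c by rewrite (altDl ab) !(altZl ab) (altxx ab) !mulr0 addr0.
have Pc : P c.
  by rewrite -cz'; have L := alt_linl ab q; apply: (vP (lin_of L)).
have [k pk] : exists k, p'' k `<=` P.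
  by apply: p''3 => // _ [d ->]; apply: ideal_mul => //; apply: prime_is_ideal.
have nka : ~ p'' k a by move/pk.
have [i pi] := p3 (p'' k) (p''1 k) (sub0P _ (p''1 k)).
apply: (depth_geS (P := p'' k)) => //; last first.
  by split=> // h; apply: (z'P k nka) => f; apply: h.
apply: (depth_geS (P := p i)) => //; first exact: depth_ge0.
split=> // h; apply: (cP i) => [/pi//|]; exact: h.
Qed.

End RankTwoGeneralPosition.

Section Bass.
Local Open Scope classical_set_scope.
Variable R : comPzRingType.
Hypothesis noeth : noetherian R.

Definition stable_range (Q : lmodType R) : Prop :=
  forall (a : R) (z : Q), (exists (f : {linear Q -> R^o}) c, f z + c * a = 1) ->
  exists w (f : {linear Q -> R^o}), f (z + a *: w) = 1.

(** If the order ideal of [z + a *: w] were proper, it would lie in a prime.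
    That prime cannot avoid [a], because it would be too high, and it cannot
    contain [a], because [z] and [a] together are unimodular. *)
Lemma stable_range_of_general_position (Q : lmodType R) d n : krull_dim_le R d ->
  (d < n)%N -> general_position Q n -> stable_range Q.
Proof.
move=> dim dn gp a z [f [c fz]]; have [w wP] := gp a z; exists w.
apply: contrapT => none.
have [] := proper_sub_prime noeth (order_ideal_ideal (z + a *: w)).
  by case=> g e; apply: none; exists g.
move=> P [pP /order_idealP vP].
have [Pa|nPa] := pselect (P a); last first.
  have [p [cp _]] := wP P pP vP nPa.
  by have := dim _ _ cp; rewrite leqNgt dn.
case: (pP) => idP n1 _; apply: n1; rewrite -fz.
apply: ideal_add => //; last exact: ideal_mul.
have := vP f; rewrite linearD => h; apply: (ideal_subr idP h).
by rewrite linearZ; apply: ideal_mulr.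
Qed.

End Bass.

(** * Pfaffians of lists of vectors *)

Section Contraction.
Variables (R : comPzRingType) (T : Type) (b : T -> T -> R).
Implicit Types (G : seq T -> R) (s : seq T).

(** The signed sum of [b x y * G s'] over all ways of removing an entry [y]
    from [s], leaving [s']: interior multiplication by [b x] in the exterior
    algebra, acting on functions of lists. *)
Fixpoint contract (x : T) G s : R :=
  if s is y :: s' then b x y * G s' - contract x (fun t => G (y :: t)) s'
  else 0.

(** The Pfaffian of the Gram matrix of a list of length [k.*2]; lists of any
    other length get the value 0. *)
Fixpoint pfl (k : nat) s : R :=
  if k is k'.+1 then (if s is x :: s' then contract x (pfl k') s' else 0)
  else (if s is [::] then 1 else 0).

Lemma eq_contract x G G' s : G =1 G' -> contract x G s = contract x G' s.
Proof.
elim: s G G' => [//|y s IH] G G' e /=.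
by rewrite e (IH _ (fun t => G' (y :: t))) // => t; rewrite e.
Qed.

Lemma contract_lin x a G G' s :
  contract x (fun t => a * G t + G' t) s = a * contract x G s + contract x G' s.
Proof.
elim: s G G' => [|y s IH] G G' /=; first by rewrite mulr0 addr0.
by rewrite IH; ring.
Qed.

Lemma contract_zero x s : contract x (fun _ => 0) s = 0.
Proof. by elim: s => [//|y s IH] /=; rewrite IH; ring. Qed.

(** Interior multiplications square to zero; this is what makes Pfaffians
    alternating. *)
Lemma contract_contract x G s : contract x (contract x G) s = 0.
Proof.
elim: s G => [//|y s IH] G /=.
rewrite (@eq_contract x (fun t => contract x G (y :: t))
  (fun t => (-1) * contract x (fun u => G (y :: u)) t + (b x y * G t + 0)));
  last by move=> t /=; ring.
by rewrite contract_lin IH contract_lin contract_zero; ring.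
Qed.

Lemma contract_map x G m (v : 'I_m.+1 -> T) :
  contract x G [seq v i | i <- enum 'I_m.+1] =
  \sum_(j < m.+1) (-1) ^+ j * b x (v j) * G [seq v (lift j i) | i <- enum 'I_m].
Proof.
elim: m G v => [|m IH] G v.
  rewrite enum_ordSl /= enum_ord0 big_ord_recl big_ord0 /=.
  by rewrite expr0 addr0 subr0 mul1r.
rewrite [in LHS]enum_ordSl map_cons -map_comp /= IH [RHS]big_ord_recl expr0 mul1r.
congr (_ + _).
rewrite -sumrN; apply: eq_bigr => j _.
rewrite exprS -!mulrA mulN1r; congr (- (_ * (_ * G _))).
rewrite [in RHS]enum_ordSl /= -map_comp; congr (_ :: _).
  by congr v; apply: val_inj.
apply: eq_map => i /=; congr v; apply: val_inj => /=.
by rewrite /bump /= !add1n ltnS addnS.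
Qed.

End Contraction.

Lemma pf_pfl (R : comPzRingType) (T : Type) (b : T -> T -> R) n
    (v : 'I_(n.*2) -> T) :
  pf (\matrix_(i, j) b (v i) (v j)) = pfl b n [seq v i | i <- enum 'I_(n.*2)].
Proof.
elim: n v => [|n IH] v; first by rewrite enum_ord0.
change (\sum_(j < (n.*2).+1) (-1) ^+ j *
  (\matrix_(i, j) b (v i) (v j)) ord0 (lift ord0 j) *
  pf (\matrix_(k < n.*2, l < n.*2) (\matrix_(i, j) b (v i) (v j))
     (lift ord0 (lift j k)) (lift ord0 (lift j l))) =
  pfl b n.+1 [seq v i | i <- enum 'I_((n.*2).+2)]).
rewrite enum_ordSl /= -map_comp contract_map; apply: eq_bigr => j _.
rewrite !mxE; congr (_ * _).
rewrite -(IH (fun i => v (lift ord0 (lift j i)))); congr pf.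
by apply/matrixP=> k l; rewrite !mxE.
Qed.

Section AlternatingMultilinear.
Variables (R : comPzRingType) (V : lmodType R).
Implicit Types (G : seq V -> R) (s : seq V).

Definition list_additive G : Prop := forall s1 a u v s2,
  G (s1 ++ (a *: u + v) :: s2) = a * G (s1 ++ u :: s2) + G (s1 ++ v :: s2).

Definition list_alternating G : Prop := forall s1 u s2,
  G (s1 ++ [:: u, u & s2]) = 0.

Lemma list_additive_cons G x :
  list_additive G -> list_additive (fun t => G (x :: t)).
Proof. by move=> h s1 a u v s2; apply: (h (x :: s1)). Qed.

Lemma list_alternating_cons G x :
  list_alternating G -> list_alternating (fun t => G (x :: t)).
Proof. by move=> h s1 u s2; apply: (h (x :: s1)). Qed.

Section Pfaffian.
Variable b : V -> V -> R.
Hypothesis ab : alternating b.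

Lemma contract_additive G x :
  list_additive G -> list_additive (contract b x G).
Proof.
move=> h s1; elim: s1 G h => [|y s1 IH] G h a u v s2 /=.
  rewrite (altDr ab) (altZr ab).
  rewrite (@eq_contract _ _ b x _ (fun t => a * G (u :: t) + G (v :: t))); last first.
    by move=> t; apply: (h [::]).
  by rewrite contract_lin; ring.
rewrite h (IH _ (list_additive_cons y h)); ring.
Qed.

Lemma contract_alternating G x :
  list_alternating G -> list_alternating (contract b x G).
Proof.
move=> h s1; elim: s1 G h => [|y s1 IH] G h u s2 /=.
  rewrite (@eq_contract _ _ b x _ (fun _ => 0)); last by move=> t; apply: (h [::]).
  by rewrite contract_zero; ring.
by rewrite h (IH _ (list_alternating_cons y h)) mulr0 subr0.
Qed.

Lemma contract_linl G x y a s :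
  contract b (a *: x + y) G s = a * contract b x G s + contract b y G s.
Proof.
elim: s G => [|z s IH] G /=; first by rewrite mulr0 addr0.
by rewrite IH (altDl ab) (altZl ab); ring.
Qed.

Lemma pfl_additive k : list_additive (pfl b k).
Proof.
elim: k => [|k IH] [|x s1] a u v s2 /=.
- by rewrite mulr0 addr0.
- by rewrite mulr0 addr0.
- exact: contract_linl.
- exact: contract_additive.
Qed.

Lemma pfl_alternating k : list_alternating (pfl b k).
Proof.
elim: k => [|k IH] [|x s1] u s2 //=; last exact: contract_alternating.
rewrite (altxx ab) mul0r sub0r.
case: k {IH} => [|k] /=; first by rewrite contract_zero oppr0.
by rewrite contract_contract oppr0.
Qed.

End Pfaffian.

Lemma list_additive0 G s1 s2 : list_additive G -> G (s1 ++ 0 :: s2) = 0.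
Proof.
move=> h; have := h s1 1 0 0 s2; rewrite scale1r addr0 mul1r => e.
by apply: (addrI (G (s1 ++ 0 :: s2))); rewrite addr0 -e.
Qed.

Lemma list_additive_sum G s1 s2 (I : Type) (r : seq I) (c : I -> R) (F : I -> V) :
  list_additive G ->
  G (s1 ++ (\sum_(i <- r) c i *: F i) :: s2) =
  \sum_(i <- r) c i * G (s1 ++ F i :: s2).
Proof.
move=> h; elim: r => [|i r IH]; first by rewrite !big_nil list_additive0.
by rewrite !big_cons h IH.
Qed.

Section Vanishing.
Variable G : seq V -> R.
Hypotheses (aG : list_additive G) (dG : list_alternating G).

Lemma list_swap s1 u v s2 :
  G (s1 ++ [:: u, v & s2]) = - G (s1 ++ [:: v, u & s2]).
Proof.
apply/eqP; rewrite -addr_eq0; apply/eqP.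
have := dG s1 (u + v) s2.
have h x y t s : G (s ++ (x + y) :: t) = G (s ++ x :: t) + G (s ++ y :: t).
  by have := aG s 1 x y t; rewrite scale1r mul1r.
rewrite h.
have h2 x y z t s : G (s ++ [:: z, x + y & t]) =
    G (s ++ [:: z, x & t]) + G (s ++ [:: z, y & t]).
  by have := h x y t (s ++ [:: z]); rewrite -!catA.
by rewrite !h2 !dG add0r addr0.
Qed.

Lemma list_move s1 s2 u s3 : G (s1 ++ s2 ++ u :: s3) =
  (-1) ^+ size s2 * G (s1 ++ u :: s2 ++ s3).
Proof.
elim: s2 s1 => [|v s2 IH] s1 /=; first by rewrite mul1r.
have := IH (s1 ++ [:: v]); rewrite -!catA /= => ->.
by rewrite list_swap exprS; ring.
Qed.

Lemma list_dup s1 s : ~~ uniq s -> G (s1 ++ s) = 0.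
Proof.
elim: s s1 => [//|x s IH] s1.
rewrite cons_uniq negb_and negbK => /orP[|nu]; last first.
  by have := IH (s1 ++ [:: x]) nu; rewrite -catA.
case/splitPr => s2 s3.
have := list_move (s1 ++ [:: x]) s2 x s3; rewrite -!catA /= => ->.
by rewrite dG mulr0.
Qed.

Lemma list_perm0 s0 s t : perm_eq s t -> G (s0 ++ t) = 0 -> G (s0 ++ s) = 0.
Proof.
elim: t s s0 => [|x t IH] s s0 st h0; first by rewrite (perm_nilP st).
have xs : x \in s by rewrite (perm_mem st) mem_head.
case/splitPr: xs st => s1 s2 st.
have st' : perm_eq (s1 ++ s2) t.
  rewrite -(perm_cons x); apply: perm_trans st.
  by rewrite -(cat1s x (s1 ++ s2)) perm_catCA.
rewrite list_move; have := IH (s1 ++ s2) (s0 ++ [:: x]) st'.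
by rewrite -!catA /= => /(_ h0) ->; rewrite mulr0.
Qed.

(** Expanding every entry along the spanning family [e] reduces to lists of
    members of [e]; those with a repetition vanish, the others are
    permutations of [e]. *)
Lemma list_vanish m (e : 'I_m -> V) :
  (forall x, exists c : 'I_m -> R, x = \sum_i c i *: e i) ->
  G [seq e i | i <- enum 'I_m] = 0 ->
  forall s, size s = m -> G s = 0.
Proof.
move=> spn G0 s sz.
have basis (t : seq 'I_m) : size t = m -> G [seq e i | i <- t] = 0.
  move=> szt; have [ut|nut] := boolP (uniq [seq e i | i <- t]); last exact: (list_dup [::]).
  have {}ut := map_uniq ut.
  apply: (@list_perm0 [::] _ [seq e i | i <- enum 'I_m]) G0.
  apply: perm_map; apply: uniq_perm => //; first exact: enum_uniq.
  have sub : {subset t <= enum 'I_m} by move=> i _; rewrite mem_enum.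
  by have [|_ h] := uniq_min_size ut sub; first by rewrite size_enum_ord szt.
have gen (t : seq 'I_m) : (size t + size s = m)%N -> G ([seq e i | i <- t] ++ s) = 0.
  elim: s t {sz} => [|x s IH] t; first by rewrite addn0 cats0; apply: basis.
  move=> szt; have [c ->] := spn x.
  rewrite list_additive_sum // big1 // => i _.
  have := IH (rcons t i); rewrite size_rcons addSnnS => /(_ szt).
  by rewrite map_rcons cat_rcons => ->; rewrite mulr0.
exact: (gen [::]).
Qed.

End Vanishing.
End AlternatingMultilinear.

Section DeterminantUnique.
Variable R : comPzRingType.

Definition detl m (s : seq 'rV[R]_m) : R :=
  if size s == m then \det (\matrix_(i, j) nth 0 s i 0 j) else 0.

Lemma detl_additive m : list_additive (@detl m).
Proof.
move=> s1 a u v s2; rewrite /detl !size_cat /=.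
case: eqP => [sz|_]; last by rewrite mulr0 addr0.
have h : (size s1 < m)%N.
  by rewrite -[X in (_ < X)%N]sz addnS ltnS leq_addr.
rewrite -[X in _ = _ + X]mul1r.
apply: (determinant_multilinear (i0 := Ordinal h)).
- by apply/rowP=> j; rewrite !mxE !nth_cat ltnn subnn /= !mxE mul1r.
- apply/matrixP=> i j; rewrite !mxE !nth_cat; case: ltnP => // le.
  case E : (_ - _)%N => //=.
  by move/eqP: (neq_lift (Ordinal h) i); case; apply: val_inj => /=;
     apply/eqP; rewrite eqn_leq le -subn_eq0 E.
- apply/matrixP=> i j; rewrite !mxE !nth_cat; case: ltnP => // le.
  case E : (_ - _)%N => //=.
  by move/eqP: (neq_lift (Ordinal h) i); case; apply: val_inj => /=;
     apply/eqP; rewrite eqn_leq le -subn_eq0 E.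
Qed.

Lemma detl_alternating m : list_alternating (@detl m).
Proof.
move=> s1 u s2; rewrite /detl !size_cat /=; case: eqP => [sz|//].
have h1 : ((size s1).+1 < m)%N.
  by rewrite -[X in (_ < X)%N]sz !addnS !ltnS leq_addr.
apply: (@determinant_alternate _ _ _ (Ordinal (ltnW h1)) (Ordinal h1)).
  by rewrite -val_eqE /= neq_ltn leqnn.
by move=> j; rewrite !mxE !nth_cat /= ltnn subnn ltnNge leqnSn /= subSnn.
Qed.

Lemma nth_map_enum (T : Type) m (x0 : T) (v : 'I_m -> T) (i : 'I_m) :
  nth x0 [seq v i | i <- enum 'I_m] i = v i.
Proof. by rewrite (nth_map i) ?size_enum_ord // nth_ord_enum. Qed.

(** Uniqueness of the determinant: both sides are alternating and multilinear
    in the rows of [E] and they agree on the identity matrix. *)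
Lemma alternating_det (V : lmodType R) (G : seq V -> R) m (e : 'I_m -> V)
    (E : 'M[R]_m) : list_additive G -> list_alternating G ->
  G [seq \sum_j E i j *: e j | i <- enum 'I_m] =
  \det E * G [seq e i | i <- enum 'I_m].
Proof.
move=> aG dG; pose phi (v : 'rV[R]_m) := \sum_j v 0 j *: e j.
pose g0 := G [seq e i | i <- enum 'I_m].
pose H (s : seq 'rV[R]_m) := G [seq phi v | v <- s] - detl s * g0.
have aH : list_additive H.
  move=> s1 a u v s2; rewrite /H detl_additive !map_cat /=.
  have -> : phi (a *: u + v) = a *: phi u + phi v.
    rewrite /phi scaler_sumr -big_split; apply: eq_bigr => j _ /=.
    by rewrite !mxE scalerDl scalerA.
  by rewrite aG; ring.
have dH : list_alternating H.
  by move=> s1 u s2; rewrite /H detl_alternating map_cat /= dG mul0r subr0.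
have := @list_vanish _ _ H aH dH m (fun i => delta_mx 0 i) _ _
  [seq row i E | i <- enum 'I_m].
rewrite size_map size_enum_ord /H => hh; apply/eqP; rewrite -subr_eq0; apply/eqP.
rewrite -[RHS]hh //.
- rewrite -map_comp /detl size_map size_enum_ord eqxx.
  congr (_ + - (_ * _)).
    congr G; apply: eq_map => i /=; rewrite /phi; apply: eq_bigr => j _.
    by rewrite mxE.
  congr (\det _).
  by apply/matrixP=> i j; rewrite mxE nth_map_enum mxE.
- by move=> x; exists (fun i => x 0 i); rewrite -row_sum_delta.
- rewrite -map_comp /detl size_map size_enum_ord eqxx.
  rewrite [X in G X](_ : _ = [seq e i | i <- enum 'I_m]).
    rewrite [X in \det X](_ : _ = 1%:M) ?det1 ?mul1r ?subrr //.
    by apply/matrixP=> i j; rewrite mxE nth_map_enum !mxE eqxx /= eq_sym.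
  apply: eq_map => i /=; rewrite /phi (bigD1 i) //= big1 => [|j ji].
    by rewrite mxE !eqxx scale1r addr0.
  by rewrite mxE (negbTE ji) andbF scale0r.
Qed.

Definition gram n (b : 'rV[R]_n -> 'rV[R]_n -> R) : 'M[R]_n :=
  \matrix_(i, j) b (delta_mx 0 i) (delta_mx 0 j).

Lemma gram_mul n (b : 'rV[R]_n -> 'rV[R]_n -> R) v w : alternating b ->
  b v w = (v *m gram b *m w^T) 0 0.
Proof.
move=> ab; rewrite {1}(row_sum_delta v) {1}(row_sum_delta w).
rewrite (alt_suml ab) [RHS]mxE.
transitivity (\sum_i \sum_j v 0 i * (w 0 j * gram b i j)).
  apply: eq_bigr => i _; rewrite (alt_sumr ab); apply: eq_bigr => j _.
  by rewrite (altZl ab) (altZr ab) mxE.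
rewrite exchange_big; apply: eq_bigr => j _ /=.
by rewrite mxE mulr_suml; apply: eq_bigr => i _; rewrite [w^T _ _]mxE; ring.
Qed.

Lemma pf_gram n (b : 'rV[R]_(n.*2) -> 'rV[R]_(n.*2) -> R) :
  pf (gram b) = pfl b n [seq delta_mx 0 i | i <- enum 'I_(n.*2)].
Proof. exact: pf_pfl. Qed.

End DeterminantUnique.

Section Splitting.
Variables (R : comPzRingType) (T : Type) (b : T -> T -> R).
Implicit Types (s t : seq T).

Fixpoint all_orth x t : Prop :=
  if t is y :: t' then b x y = 0 /\ all_orth x t' else True.

Fixpoint orth s t : Prop :=
  if s is x :: s' then all_orth x t /\ orth s' t else True.

Lemma all_orth_map (U : Type) x (f : U -> T) (s : seq U) :
  (forall v, b x (f v) = 0) -> all_orth x (map f s).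
Proof. by move=> h; elim: s => [//|v s IH] /=. Qed.

Lemma contract_orth x G t : all_orth x t -> contract b x G t = 0.
Proof. by elim: t G => [//|y t IH] G /= [-> h]; rewrite IH // mul0r subr0. Qed.

Lemma contract_cat x G s t : all_orth x t ->
  contract b x G (s ++ t) = contract b x (fun u => G (u ++ t)) s.
Proof.
move=> xt; elim: s G => [|y s IH] G /=; first exact: contract_orth.
by rewrite IH.
Qed.

Lemma contract_ext t x k s (G G' : seq T -> R) :
  (forall u, size u = k -> orth u t -> G u = G' u) ->
  size s = k.+1 -> orth s t -> contract b x G s = contract b x G' s.
Proof.
elim: s k G G' => [//|y s IH] k G G' h [sz] [yt st] /=.
rewrite h //; congr (_ - _).
case: k h sz => [|k] h sz; first by rewrite (size0nil sz).
by apply: (IH k) => // u su ut; apply: h => //=; rewrite su.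
Qed.

Lemma pfl_cat k l s t : size s = k.*2 -> orth s t ->
  pfl b (k + l) (s ++ t) = pfl b k s * pfl b l t.
Proof.
elim: k s => [|k IH] [|x s] //=; first by rewrite mul1r.
move=> [sz] [xt st]; rewrite contract_cat //.
rewrite (@contract_ext t x k.*2 s _ (fun u => pfl b l t * pfl b k u + 0)) //.
  by rewrite contract_lin contract_zero; ring.
by move=> u su ut; rewrite IH //; ring.
Qed.

End Splitting.

Section PflMap.
Variables (R : comPzRingType) (T U : Type) (b : U -> U -> R) (f : T -> U).

Lemma contract_comp x G s :
  contract b (f x) G (map f s) =
  contract (fun x y => b (f x) (f y)) x (fun t => G (map f t)) s.
Proof. by elim: s G => [//|y s IH] G /=; rewrite IH. Qed.

Lemma pfl_map k s :
  pfl b k (map f s) = pfl (fun x y => b (f x) (f y)) k s.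
Proof.
elim: k s => [|k IH] [|x s] //=.
by rewrite contract_comp; apply: eq_contract => t; apply: IH.
Qed.
End PflMap.

Lemma eq_contract_form (R : comPzRingType) (T : Type) (b b' : T -> T -> R) x G s :
  (forall x y, b x y = b' x y) -> contract b x G s = contract b' x G s.
Proof. by move=> e; elim: s G => [//|y s IH] G /=; rewrite e IH. Qed.

Lemma eq_pfl (R : comPzRingType) (T : Type) (b b' : T -> T -> R) k s :
  (forall x y, b x y = b' x y) -> pfl b k s = pfl b' k s.
Proof.
move=> e; elim: k s => [//|k IH] [|x s] //=.
by rewrite (eq_contract_form _ _ _ e); apply: eq_contract.
Qed.

(** * Determinants of endomorphisms of projective modules *)

Section Lin1.
Variable R : comPzRingType.

Lemma row_lin1 m n (f : 'rV[R]_m -> 'rV[R]_n) l :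
  row l (lin1_mx f) = f (delta_mx 0 l).
Proof. by apply/rowP=> k; rewrite !mxE. Qed.

Lemma lin1_mx_comp m n p (f : {linear 'rV[R]_m -> 'rV[R]_n})
    (g : {linear 'rV[R]_n -> 'rV[R]_p}) :
  lin1_mx f *m lin1_mx g = lin1_mx (g \o f).
Proof. by apply/row_matrixP=> l; rewrite row_mul !row_lin1 /= mul_rV_lin1. Qed.

End Lin1.

Section Embeddings.
Variable R : comPzRingType.

(** Direct summands of free modules, for which [has_det] takes a value. *)
Definition embeddable (P : lmodType R) : Prop :=
  exists n (i : {linear P -> 'rV[R]_n}) (r : {linear 'rV[R]_n -> P}), cancel i r.

Lemma embeddable_rV n : embeddable 'rV[R]_n.
Proof. by exists n, idfun, idfun. Qed.

Lemma embeddable_prod (P Q : lmodType R) :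
  embeddable P -> embeddable Q -> embeddable (P * Q)%type.
Proof.
move=> [n [i [r ir]]] [m [j [s js]]].
have iL : linear (fun x : P * Q => row_mx (i x.1) (j x.2)).
  by move=> a x y; rewrite !linearP scale_row_mx add_row_mx.
have rL : linear (fun v : 'rV[R]_(n + m) => (r (lsubmx v), s (rsubmx v)) : P * Q).
  by move=> a x y; rewrite !linearP.
exists (n + m)%N, (lin_of iL), (lin_of rL) => -[x y] /=.
by rewrite row_mxKl row_mxKr ir js.
Qed.

Lemma embeddable_free1 : embeddable R^o.
Proof.
have iL : linear (fun x : R^o => x%:M : 'rV[R]_1).
  by move=> a x y; apply/rowP=> k; rewrite !mxE !ord1 eqxx !mulr1n.
have rL : linear (fun v : 'rV[R]_1 => v 0 0 : R^o).
  by move=> a x y; rewrite !mxE.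
by exists 1%N, (lin_of iL), (lin_of rL) => x /=; rewrite mxE eqxx mulr1n.
Qed.

Lemma ext_mxE (P : lmodType R) n (i : {linear P -> 'rV[R]_n})
    (r : {linear 'rV[R]_n -> P}) (phi : {linear P -> P}) v :
  v *m ext_mx i r phi = i (phi (r v)) + (v - i (r v)).
Proof.
exact: (mul_rV_lin1 ((i \o phi \o r) \+ (idfun \- (i \o r)))).
Qed.

Lemma has_det_ex (P : lmodType R) (phi : {linear P -> P}) :
  embeddable P -> exists d, has_det phi d.
Proof.
by move=> [n [i [r ir]]]; exists (\det (ext_mx i r phi)), n, i, r.
Qed.

Lemma has_detE (P : lmodType R) (phi : {linear P -> P}) d n
    (i : {linear P -> 'rV[R]_n}) (r : {linear 'rV[R]_n -> P}) :
  cancel i r -> has_det phi d -> \det (ext_mx i r phi) = d.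
Proof. by move=> ir; apply: has_det_inj; exists n, i, r. Qed.

Lemma has_det_comp (P : lmodType R) (phi psi : {linear P -> P}) d d' :
  has_det phi d -> has_det psi d' -> has_det (phi \o psi) (d * d').
Proof.
case=> n [i [r [ir ed]]] hpsi; exists n, i, r; split=> //.
rewrite -(has_detE ir hpsi) ed mulrC -det_mulmx; congr (\det _).
apply/row_matrixP=> l; rewrite rowE [RHS]rowE mulmxA; set v := 'e_l.
have rW : r (v *m ext_mx i r psi) = psi (r v).
  by rewrite ext_mxE linearD linearB !ir subrr addr0.
by rewrite (ext_mxE i r (phi \o psi)) (ext_mxE i r phi) rW (ext_mxE i r psi) [i (psi _) + _]addrC addrK.
Qed.

Lemma has_det_ext (P : lmodType R) (phi psi : {linear P -> P}) d :
  phi =1 psi -> has_det phi d -> has_det psi d.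
Proof.
move=> e [n [i [r [ir ->]]]]; exists n, i, r; split=> //; congr (\det _).
by apply/row_matrixP=> l; rewrite rowE [RHS]rowE !ext_mxE e.
Qed.

(** Sylvester's identity for projective modules.  It contains the invariance
    of the determinant under isomorphisms and under stabilization, and it
    computes the determinant of every unipotent map below. *)
Lemma has_det_sylvester (P Q : lmodType R) (delta : {linear Q -> P})
    (rho : {linear P -> Q}) (phi : {linear P -> P}) (g : {linear Q -> Q}) d :
  embeddable P -> (forall x, phi x = x + delta (rho x)) ->
  (forall y, g y = y + rho (delta y)) -> has_det g d -> has_det phi d.
Proof.
move=> [n [i [r ir]]] ephi eg [m [j [s [js ->]]]]; exists n, i, r; split=> //.
have -> : ext_mx i r phi = 1%:M + lin1_mx (j \o rho \o r) *m lin1_mx (i \o delta \o s).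
  apply/row_matrixP=> l; rewrite rowE ext_mxE linearD /= row1 lin1_mx_comp row_lin1 /= js.
  by rewrite ephi linearD /= addrC addrA subrK.
have -> : ext_mx j s g = 1%:M + lin1_mx (i \o delta \o s) *m lin1_mx (j \o rho \o r).
  apply/row_matrixP=> l; rewrite rowE ext_mxE linearD /= row1 lin1_mx_comp row_lin1 /= ir.
  by rewrite eg linearD /= addrC addrA subrK.
by rewrite det_1DM.
Qed.

Lemma has_det_id (P : lmodType R) : embeddable P ->
  has_det (idfun : {linear P -> P}) 1.
Proof.
move=> [n [i [r ir]]]; exists n, i, r; split=> //.
rewrite -(det1 _ n); congr (\det _); apply/row_matrixP=> l.
by rewrite [RHS]rowE [LHS]rowE ext_mxE mulmx1 /= addrC subrK.
Qed.

Lemma has_det_unipotent (P Q : lmodType R) (delta : {linear Q -> P})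
    (rho : {linear P -> Q}) (phi : {linear P -> P}) :
  embeddable P -> embeddable Q -> (forall x, phi x = x + delta (rho x)) ->
  (forall y, rho (delta y) = 0) -> has_det phi 1.
Proof.
move=> eP eQ ephi e0.
by apply: (has_det_sylvester eP ephi (g := idfun)) (has_det_id eQ) => y /=;
  rewrite e0 addr0.
Qed.

(** Here [phi] is [g] on the summand [Q] of [P] and the identity on the
    complement: the case [delta = u (g - 1)] of Sylvester's identity. *)
Lemma has_det_stabilize (P Q : lmodType R) (u : {linear Q -> P})
    (rho : {linear P -> Q}) (phi : {linear P -> P}) (g : {linear Q -> Q}) d :
  embeddable P -> cancel u rho ->
  (forall x, phi x = u (g (rho x)) + (x - u (rho x))) ->
  has_det g d -> has_det phi d.
Proof.
move=> eP ur ephi; apply: (has_det_sylvester (delta := u \o (g \- idfun)) (rho := rho)) => // [x|y] /=.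
  by rewrite ephi linearB addrCA.
by rewrite ur addrC subrK.
Qed.

Lemma has_det_conj (P Q : lmodType R) (u : {linear Q -> P})
    (rho : {linear P -> Q}) (phi : {linear P -> P}) (g : {linear Q -> Q}) d :
  embeddable P -> cancel u rho -> cancel rho u ->
  (forall x, phi x = u (g (rho x))) -> has_det g d -> has_det phi d.
Proof.
move=> eP ur ru ephi; apply: (has_det_stabilize eP ur) => x.
by rewrite ru subrr addr0.
Qed.

Lemma has_det1_inv (P : lmodType R) (phi : {linear P -> P}) : has_det phi 1 ->
  exists psi : {linear P -> P}, [/\ cancel phi psi, cancel psi phi & has_det psi 1].
Proof.
move=> hphi; case: (hphi) => n [i [r [ir ed]]].
pose M := ext_mx i r phi; pose N := \adj M.
have MN : M *m N = 1%:M by rewrite mul_mx_adj -ed.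
have NM : N *m M = 1%:M by rewrite mul_adj_mx -ed.
have L : linear (fun x => r (i x *m N)).
  by move=> a x y; rewrite linearP mulmxDl -scalemxAl linearP.
have iM y : i y *m M = i (phi y) by rewrite ext_mxE ir subrr addr0.
have c1 : cancel phi (lin_of L) by move=> y /=; rewrite -iM -mulmxA MN mulmx1 ir.
have c2 : cancel (lin_of L) phi.
  move=> x /=; have : r (i x *m N *m M) = r (i x) by rewrite -mulmxA NM mulmx1.
  by rewrite ext_mxE linearD linearB !ir subrr addr0.
exists (lin_of L); split=> //.
have eP : embeddable P by exists n, i, r.
have [d hd] := has_det_ex (lin_of L) eP.
have := has_det_comp hphi hd; rewrite mul1r => h.
have -> : 1 = d; last by [].
apply: has_det_inj (has_det_id eP) _; apply: has_det_ext h => x.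
exact: c2.
Qed.

Lemma is_SL_det (P : lmodType R) (phi : {linear P -> P}) :
  has_det phi 1 -> is_SL phi.
Proof.
by move=> h; split=> //; have [psi [c1 c2 _]] := has_det1_inv h; exists psi.
Qed.

End Embeddings.

(** * Oriented projective modules of rank two *)

Lemma sum_ord2 (V : nmodType) (F : 'I_2 -> V) :
  \sum_i F i = F ord0 + F ord_max.
Proof.
rewrite big_ord_recl big_ord_recl big_ord0 addr0; congr (_ + F _).
exact: val_inj.
Qed.

(** A form that makes [Q] an oriented module of rank two: the displayed
    identity says that three vectors satisfy the linear relation which holds
    in a plane, and the values of the form generate the unit ideal. *)
Definition symplectic_plane (R : comPzRingType) (Q : lmodType R)
    (b : Q -> Q -> R) : Prop :=
  [/\ alternating b,
      forall x y z, b x y *: z = b z y *: x + b x z *: y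
    & exists N (x y : 'I_N.+1 -> Q), \sum_k b (x k) (y k) = 1].

Section LocalCoordinates.
Variables (R : comPzRingType) (P0 : lmodType R) (p : set R).
Hypotheses (pp : prime_ideal p) (fgP : finitely_generated P0)
  (prP : projective P0).
Hypothesis rkP : exists (Rp : comPzRingType) (f : {rmorphism R -> Rp})
           (Pp : lmodType Rp) (g : {additive P0 -> Pp}),
      [/\ is_localization p f, is_localized_module p f g & free_of_rank Pp 2].

Lemma nprimeM x y : ~ p x -> ~ p y -> ~ p (x * y).
Proof. by move=> hx hy h; case: pp => _ _ /(_ x y h)[]. Qed.

(** Clearing denominators in a basis of the localization at [p] and in its dual
    basis produces vectors [x0], [x1] and functionals [u0], [u1] over [R]
    itself, dual to each other up to elements outside [p]. *)
Lemma local_coordinates : exists (x0 x1 : P0) (u0 u1 : {linear P0 -> R^o}),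
  ~ p (u0 x0 * u1 x1 - u1 x0 * u0 x1) /\
  forall z, exists t a b, ~ p t /\ t *: z = a *: x0 + b *: x1.
Proof.
have [Rp [f [Pp [g [[l1 l2 l3] [m1 m2 m3] [e eP]]]]]] := rkP.
have [c cP] := choice eP.
have cE z : z = c z 0 0 *: e ord0 + c z 0 ord_max *: e ord_max.
  by case: (cP z) => h _; rewrite {1}h sum_ord2.
have cU z (v : 'rV[Rp]_2) : z = v 0 0 *: e ord0 + v 0 ord_max *: e ord_max -> c z = v.
  by move=> h; case: (cP z) => _; apply; rewrite {1}h sum_ord2.
have cL a x y : c (a *: x + y) = a *: c x + c y.
  apply: cU; rewrite !mxE {1}(cE x) {1}(cE y) !scalerDl scalerDr !scalerA.
  by rewrite -!addrA; congr (_ + _); rewrite addrCA.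
have c0 : c 0 = 0.
  by apply: cU; rewrite !mxE !scale0r addr0.
have cZ a x : c (a *: x) = a *: c x by have := cL a x 0; rewrite !addr0 c0 addr0.
have cD x y : c (x + y) = c x + c y by have := cL 1 x y; rewrite !scale1r.
have ce0 : c (e ord0) = delta_mx 0 0.
  by apply: cU; rewrite !mxE /= scale1r scale0r addr0.
have ce1 : c (e ord_max) = delta_mx 0 ord_max.
  by apply: cU; rewrite !mxE /= scale1r scale0r add0r.
have [x0 [s0 [ns0 hx0]]] := m2 (e ord0).
have [x1 [s1 [ns1 hx1]]] := m2 (e ord_max).
have [n [gg ggP]] := fgP.
have GL : linear (fun v : 'rV[R]_n => \sum_i v 0 i *: gg i).
  move=> a x y; rewrite scaler_sumr -big_split; apply: eq_bigr => i _ /=.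
  by rewrite !mxE scalerDl scalerA.
have [|h hP] := @prP _ _ (lin_of GL) idfun.
  by move=> y; have [d ->] := ggP y; exists (\row_i d i) => /=;
     apply: eq_bigr => i _; rewrite mxE.
have cg x j : c (g x) 0 j = \sum_i f (h x 0 i) * c (g (gg i)) 0 j.
  rewrite -{1}[x]hP /= raddf_sum (big_morph (fun z => c z 0 j) (id1 := 0) (op1 := +%R)).
  - by apply: eq_bigr => i _; rewrite m1 cZ mxE.
  - by move=> y z; rewrite cD mxE.
  - by rewrite c0 mxE.
have lin j : exists (u : {linear P0 -> R^o}) T, ~ p T /\
    forall x, f (u x) = f T * c (g x) 0 j.
  have [r rP] := choice (fun i => l2 (c (g (gg i)) 0 j)).
  have [t tP] := choice rP.
  pose u x : R := \sum_i h x 0 i * (r i * \prod_(k | k != i) t k).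
  have uL : linear (u : P0 -> R^o).
    move=> a x y; rewrite /u linearP scaler_sumr -big_split; apply: eq_bigr => i _ /=.
    by rewrite !mxE mulrDl; congr (_ + _); rewrite -mulrA.
  exists (lin_of uL), (\prod_i t i); split.
    by apply: prime_prod => // i; case: (tP i).
  move=> x /=; rewrite /u rmorph_sum cg mulr_sumr; apply: eq_bigr => i _.
  rewrite !rmorphM [X in _ = f X * _](bigD1 i) //= rmorphM; case: (tP i) => _ <-.
  by ring.
have [u0 [T0 [nT0 hu0]]] := lin ord0.
have [u1 [T1 [nT1 hu1]]] := lin ord_max.
have cx0 j : c (g x0) 0 j = f s0 * (j == 0)%:R by rewrite -hx0 cZ ce0 !mxE.
have cx1 j : c (g x1) 0 j = f s1 * (j == ord_max)%:R by rewrite -hx1 cZ ce1 !mxE.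
exists x0, x1, u0, u1; split.
  move=> hp; have e1 : f (u0 x0 * u1 x1 - u1 x0 * u0 x1 - T0 * T1 * (s0 * s1)) = 0.
    rewrite !rmorphB !rmorphM !hu0 !hu1 !cx0 !cx1 /=; ring.
  have [s [ns es]] := l3 _ e1.
  have : ~ p (s * (T0 * T1 * (s0 * s1))) by do ?apply: nprimeM.
  apply; move: es => /eqP; rewrite mulrBr subr_eq0 => /eqP <-.
  by apply: ideal_mul => //; case: pp.
move=> z; have [r0 [D0 [nD0 h0]]] := l2 (c (g z) 0 0).
have [r1 [D1 [nD1 h1]]] := l2 (c (g z) 0 ord_max).
have : g (s0 * s1 * (D0 * D1) *: z - (s1 * D1 * r0 *: x0 + s0 * D0 * r1 *: x1)) = 0.
  rewrite raddfB raddfD !m1 -hx0 -hx1 {1}(cE (g z)) scalerDr !scalerA.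
  apply/eqP; rewrite subr_eq0; apply/eqP.
  by congr (_ *: _ + _ *: _); rewrite !rmorphM -?h0 -?h1; ring.
move=> /m3[s [ns es]].
exists (s * (s0 * s1 * (D0 * D1))), (s * (s1 * D1 * r0)), (s * (s0 * D0 * r1)).
split; first by do ?apply: nprimeM.
move: es => /eqP; rewrite scalerBr subr_eq0 => /eqP.
by rewrite scalerDr !scalerA.
Qed.

End LocalCoordinates.

Section PlaneOfRankTwo.
Variables (R : comPzRingType) (P0 : lmodType R) (b : P0 -> P0 -> R).
Hypotheses (noeth : noetherian R) (fgP : finitely_generated P0)
  (prP : projective P0) (rkP : constant_rank P0 2) (ab : alternating b).
Hypothesis univ : forall K : P0 -> P0 -> R, alternating K ->
  exists c, forall x y, K x y = c * b x y.

(** Both conditions are local, and at each prime they are computed in the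
    coordinates of [local_coordinates]. *)
Lemma symplectic_plane_of_rank2 : symplectic_plane b.
Proof.
have loc p (pp : prime_ideal p) := local_coordinates pp fgP prP (rkP pp).
split=> //.
  move=> x y z; pose T x y z := b x y *: z + (b y z *: x + b z x *: y).
  have aid : is_ideal (fun r : R => r *: T x y z = 0).
    split=> [|r s hr hs|r s hs]; first by rewrite scale0r.
      by rewrite scalerDl hr hs addr0.
    by rewrite -scalerA hs scaler0.
  have T0 : T x y z = 0.
    rewrite -[T x y z]scale1r; apply: contrapT => n1.
    have [p [pp sp]] := proper_sub_prime noeth aid n1.
    have [x0 [x1 [_ [_ [_ H]]]]] := loc p pp.
    have [t [a [a' [nt ex]]]] := H x.
    have [t' [c [c' [nt' ey]]]] := H y.
    have [t'' [d [d' [nt'' ez]]]] := H z.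
    have : p (t * t' * t'').
      apply: sp; rewrite /T !scalerDr !scalerA.
      rewrite (_ : t * t' * t'' * b x y = b (t *: x) (t' *: y) * t''); last first.
        by rewrite (altZl ab) (altZr ab); ring.
      rewrite (_ : t * t' * t'' * b y z = b (t' *: y) (t'' *: z) * t); last first.
        by rewrite (altZl ab) (altZr ab); ring.
      rewrite (_ : t * t' * t'' * b z x = b (t'' *: z) (t *: x) * t'); last first.
        by rewrite (altZl ab) (altZr ab); ring.
      rewrite -!scalerA ex ey ez !(altDl ab) !(altDr ab) !(altZl ab) !(altZr ab).
      rewrite !(altxx ab) (altC ab x0 x1) !scalerDr !scalerA.
      set h := b x0 x1.
      rewrite [X in _ + X = 0]addrACA [LHS]addrACA -!scalerDl.
      by rewrite [X in X *: x0](_ : _ = 0) ?[X in X *: x1](_ : _ = 0) ?scale0r ?addr0 //;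
        ring.
    by apply: nprimeM => //; apply: nprimeM.
  move/eqP: T0; rewrite /T addr_eq0 opprD => /eqP ->.
  by rewrite -!scaleNr -!(altC ab).
pose I : set R := fun z => exists N (x y : 'I_N -> P0), z = \sum_k b (x k) (y k).
have Iid : is_ideal I.
  split.
  - by exists 0%N, (fun _ => 0), (fun _ => 0); rewrite big_ord0.
  - move=> _ _ [N [x [y ->]]] [N' [x' [y' ->]]].
    exists (N + N')%N, (fun i => match split i with inl j => x j | inr j => x' j end),
      (fun i => match split i with inl j => y j | inr j => y' j end).
    rewrite big_split_ord /=; congr (_ + _); apply: eq_bigr => i _.
      by rewrite (unsplitK (inl i)).
    by rewrite (unsplitK (inr i)).
  - move=> a _ [N [x [y ->]]]; exists N, (fun i => a *: x i), y.
    by rewrite mulr_sumr; apply: eq_bigr => i _; rewrite (altZl ab).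
have [N [x [y e1]]] : I 1.
  apply: contrapT => n1; have [p [pp sp]] := proper_sub_prime noeth Iid n1.
  have [x0 [x1 [u0 [u1 [nu _]]]]] := loc p pp.
  have [|c cP] := univ (K := fun x y => u0 x * u1 y - u1 x * u0 y).
    split=> [a v w z|a v w z|v]; rewrite ?linearP ?[in RHS]/GRing.scale /=.
    - by rewrite /GRing.scale /=; ring.
    - by rewrite /GRing.scale /=; ring.
    - by ring.
  apply: nu; rewrite cP; apply: ideal_mul; first by case: pp.
  by apply: sp; exists 1%N, (fun _ => x0), (fun _ => x1); rewrite big_ord_recl big_ord0 addr0.
exists N, (fun i => if unlift ord0 i is Some j then x j else 0),
  (fun i => if unlift ord0 i is Some j then y j else 0).
rewrite big_ord_recl unlift_none (alt0l ab) add0r e1.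
by apply: eq_bigr => i _; rewrite liftK.
Qed.

End PlaneOfRankTwo.

Section PlaneTheory.
Variables (R : comPzRingType) (Q : lmodType R) (b : Q -> Q -> R).
Hypothesis pl : symplectic_plane b.

Lemma plane_alt : alternating b. Proof. by case: pl. Qed.

Lemma plane_perfect : perfect b.
Proof.
have ab := plane_alt; case: pl => _ plk [N [x [y e1]]] f.
exists (\sum_k (f (y k) *: x k - f (x k) *: y k)) => z.
rewrite (alt_suml ab) -[z in LHS]scale1r -e1 scaler_suml linear_sum /=.
apply: eq_bigr => k _; rewrite plk (altBl ab) !(altZl ab) linearD !linearZ /=.
by rewrite [b (y k) z](altC ab) [b z (y k)](altC ab) /GRing.scale /=; ring.
Qed.

Lemma plane_nonzero (P : set R) : prime_ideal P ->
  exists z : Q, ~ vanishes_at P z.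
Proof.
have ab := plane_alt; case: pl => _ plk [N [x [y e1]]] pP.
apply: contrapT => none; case: (pP) => idP n1 _; apply: n1; rewrite -e1.
apply: ideal_sum => // k _; apply: contrapT => nk; apply: none.
by exists (x k) => h; apply: nk; apply: (h (lin_of (alt_linl ab (y k)))).
Qed.

End PlaneTheory.

(** * The relative Pfaffian *)

Section Spanning.
Variables (R : comPzRingType) (V : lmodType R).

(** Spanning by successive subtraction, which is convenient for lists that are
    given explicitly. *)
Fixpoint in_span (L : seq V) (x : V) : Prop :=
  if L is y :: L' then exists a : R, in_span L' (x - a *: y) else x = 0.

Lemma in_spanP L x : in_span L x ->
  exists c : 'I_(size L) -> R, x = \sum_i c i *: nth 0 L i.
Proof.
elim: L x => [|y L IH] x /=; first by move=> ->; exists (fun _ => 0); rewrite big_ord0.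
case=> a /IH[c ec]; exists (fun i => if unlift ord0 i is Some j then c j else a).
rewrite big_ord_recl unlift_none /= (eq_bigr (fun i => c i *: nth 0 L i)) => [|i _].
  by rewrite -ec addrC subrK.
by rewrite liftK.
Qed.

Lemma list_enum (T : Type) (x0 : T) (L : seq T) :
  [seq nth x0 L (i : 'I_(size L)) | i <- enum 'I_(size L)] = L.
Proof.
by rewrite -[X in map X](_ : nth x0 L \o val = _) // map_comp val_enum_ord map_nth_iota0 // take_size.
Qed.

(** [D] is the determinant of any matrix that expresses [T] on [L]. *)
Lemma spanning_det (T : {linear V -> V}) (L : seq V) : (forall x, in_span L x) ->
  exists D, forall G : seq V -> R, list_additive G -> list_alternating G ->
    G (map T L) = D * G L.
Proof.
move=> spL; have [E EP] := choice (fun i : 'I_(size L) => in_spanP (spL (T (nth 0 L i)))).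
exists (\det (\matrix_(i, j) E i j)) => G aG dG.
rewrite -[X in _ * G X](list_enum 0 L) -alternating_det //; congr G.
rewrite -[X in map _ X](list_enum 0 L) -map_comp; apply: eq_map => i /=.
by rewrite EP; apply: eq_bigr => j _; rewrite mxE.
Qed.

Lemma list_scale (h : R) (L : seq V) (G : seq V -> R) :
  list_additive G -> list_alternating G ->
  G [seq h *: x | x <- L] = h ^+ size L * G L.
Proof.
move=> aG dG; rewrite -det_scalar -[X in _ * G X](list_enum 0 L) -alternating_det //; congr G.
rewrite -[X in map _ X](list_enum 0 L) -map_comp; apply: eq_map => i /=.
rewrite (bigD1 i) //= big1 => [|j ji]; first by rewrite mxE eqxx addr0.
by rewrite mxE eq_sym (negbTE ji) scale0r.
Qed.

End Spanning.

(** A large power of the sum of the [h k] is a combination of their [m]-th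
    powers. *)
Lemma comaximal_powers (R : comPzRingType) n (h : 'I_n -> R) (m : nat) z :
  \sum_k h k = 1 -> (forall k, h k ^+ m * z = 0) -> z = 0.
Proof.
move=> e1 hz; have : exists M, (\sum_k h k) ^+ M * z = 0.
  apply: (big_ind (fun u => exists M, u ^+ M * z = 0)) => [|u v [M hM] [M' hM']|k _].
  - by exists 1%N; rewrite mul0r.
  - exists (M + M')%N; rewrite exprDn mulr_suml big1 // => i _.
    rewrite mulrnAl; have [le|lt] := leqP M' i.
      rewrite -(subnKC le) exprD.
      rewrite (_ : _ * z = u ^+ (M + M' - (M' + (i - M'))) * v ^+ (i - M') *
        (v ^+ M' * z)); last by ring.
      by rewrite hM' mulr0 mul0rn.
    have le : (M <= M + M' - i)%N by rewrite -addnBA ?leq_addr // ltnW.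
    rewrite -(subnKC le) exprD.
    rewrite (_ : _ * z = u ^+ (M + M' - i - M) * v ^+ i * (u ^+ M * z)); last by ring.
    by rewrite hM mulr0 mul0rn.
  - by exists m.
by rewrite e1 => -[M]; rewrite expr1n mul1r.
Qed.

Section Hat.
Variables (R : comPzRingType) (P V : lmodType R).
Variables (i : {linear P -> V}) (r : {linear V -> P}).

(** The form on [V] that is [chi] on the summand [P] and [Psi] on its
    complement. *)
Definition hat (Psi : V -> V -> R) (chi : P -> P -> R) (v w : V) : R :=
  chi (r v) (r w) + Psi (v - i (r v)) (w - i (r w)).

(** [i] embeds [(P, chi)] isometrically in [(V, Psi)], with [r] the orthogonal
    projection. *)
Definition isometric_retract (Psi : V -> V -> R) (chi : P -> P -> R) : Prop :=
  [/\ cancel i r, forall z v, Psi (i z) v = chi z (r v)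
    & forall z v, Psi v (i z) = chi (r v) z].

Lemma hat_alt Psi chi : alternating Psi -> alternating chi ->
  alternating (hat Psi chi).
Proof.
move=> aP ac; rewrite /hat.
have kE a x y : a *: x + y - i (r (a *: x + y)) =
    a *: (x - i (r x)) + (y - i (r y)).
  by rewrite (linearP r) (linearP i) scalerBr opprD addrACA.
split=> [a x y z|a x y z|x].
- rewrite kE linearP (altDl ac) (altZl ac) (altDl aP (a *: _)) (altZl aP).
  by rewrite /GRing.scale /=; ring.
- rewrite kE linearP (altDr ac) (altZr ac) (altDr aP (a *: _)) (altZr aP).
  by rewrite /GRing.scale /=; ring.
- by rewrite (altxx aP) (altxx ac) addr0.
Qed.

Lemma hat_retract Psi chi : alternating Psi -> isometric_retract Psi chi ->
  forall v w, hat Psi chi v w = Psi v w.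
Proof.
move=> aP [ir h1 h2] v w; rewrite /hat (altBl aP) !(altBr aP) !h1 !h2 ir.
by ring.
Qed.

End Hat.

Section PerpPsi2.
Variables (R : comPzRingType) (P : lmodType R) (chi : P -> P -> R).

Lemma perp_psi2_alt : alternating chi -> alternating (perp_psi2 chi).
Proof.
move=> ac; rewrite /perp_psi2; split=> [a x y z|a x y z|x] /=.
- by rewrite /GRing.scale /= (altDl ac) (altZl ac); ring.
- by rewrite /GRing.scale /= (altDr ac) (altZr ac); ring.
- by rewrite (altxx ac); ring.
Qed.

Definition inj1 (x : P) : P * R^o * R^o := (x, 0, 0).
Definition vec3 : P * R^o * R^o := (0, 1, 0).
Definition vec4 : P * R^o * R^o := (0, 0, 1).

Definition plane_list (s : seq P) : seq (P * R^o * R^o) :=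
  [:: vec3; vec4] ++ map inj1 s.

Lemma plane_list_span s : (forall x, in_span s x) ->
  forall x, in_span (plane_list s) x.
Proof.
move=> sp [[x a] c]; exists a, c.
rewrite (_ : _ - _ - _ = inj1 x); last first.
  rewrite /inj1; congr (_, _, _); rewrite /= ?scaler0 ?subr0 //.
    by rewrite /GRing.scale /=; ring.
  by rewrite /GRing.scale /=; ring.
elim: s x {sp} (sp x) => [|y s IH] x /= ; first by move=> ->.
case=> t /IH h; exists t; congr in_span: h; rewrite /inj1.
by congr (_, _, _); rewrite /= /GRing.scale /= ?mulr0 ?subr0.
Qed.

Lemma plane_list_pfl k s : alternating chi ->
  pfl (perp_psi2 chi) k.+1 (plane_list s) = pfl chi k s.
Proof.
move=> ac; rewrite -(add1n k) pfl_cat //; last first.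
  by do ?split; elim: s => [//|y s IH] /=; split=> //;
    rewrite /perp_psi2 /= (alt0l ac); ring.
rewrite pfl_map /= /perp_psi2 /= (alt0l ac).
rewrite (_ : _ - _ = 1) ?mul1r; last by ring.
by apply: eq_pfl => x y; ring.
Qed.

End PerpPsi2.

Section PfaffianFormula.
Variables (R : comPzRingType) (Q V : lmodType R) (b : Q -> Q -> R)
  (psi : V -> V -> R).
Variables (i : {linear Q -> V}) (r : {linear V -> Q}).
Hypotheses (pl : symplectic_plane b) (apsi : alternating psi)
  (iso : isometric_retract i r psi b).
Variables (N : nat) (s : seq V).
Hypotheses (span_s : forall v, in_span s v)
  (pf_s : pfl psi N s = 1).

Let Q4 := (Q * R^o * R^o)%type.
Let V4 := (V * R^o * R^o)%type.

Definition i4_fun (x : Q4) : V4 := (i x.1.1, x.1.2, x.2).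
Definition r4_fun (x : V4) : Q4 := (r x.1.1, x.1.2, x.2).
Lemma i4_lin : linear i4_fun.
Proof. by move=> a x y; rewrite /i4_fun /= linearP. Qed.
Lemma r4_lin : linear r4_fun.
Proof. by move=> a x y; rewrite /r4_fun /= linearP. Qed.
Definition i4 := lin_of i4_lin.
Definition r4 := lin_of r4_lin.

Lemma iso4 : isometric_retract i4 r4 (perp_psi2 psi) (perp_psi2 b).
Proof.
case: iso => ir h1 h2; split=> [[[x a] c]|[[z a] c] [[v d] e]|[[z a] c] [[v d] e]].
- by rewrite /= /i4_fun /r4_fun /= ir.
- by rewrite /perp_psi2 /= h1.
- by rewrite /perp_psi2 /= h2.
Qed.

Section Form.
Variable chi : Q4 -> Q4 -> R.

Definition relative_pf : R := pfl (hat i4 r4 (perp_psi2 psi) chi) N.+1 (plane_list s).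

(** [kappa] is the Pfaffian of [chi] relative to [b], computed on the
    four vectors [x], [y], [vec3], [vec4]. *)
Definition has_pf (kappa : R) : Prop := forall x y : Q,
  chi (inj1 x) (inj1 y) * chi (vec3 Q) (vec4 Q)
  - chi (inj1 x) (vec3 Q) * chi (inj1 y) (vec4 Q)
  + chi (inj1 x) (vec4 Q) * chi (inj1 y) (vec3 Q) = kappa * b x y.

End Form.

Let V6 := (V4 * R^o * R^o)%type.
Let form6 chi : V6 -> V6 -> R := perp_psi2 (hat i4 r4 (perp_psi2 psi) chi).

Let L6 := plane_list (plane_list s).

Section Trick.
Variables x y : Q.
Let h := b x y.

(** The summand [Q] of [V] is exchanged with the last free plane: the pair
    [(v.1.2, v.2)] becomes the vector with these coefficients at [x] and [y],
    and a vector of [Q] becomes minus its coordinates with respect to [x] and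
    [y], up to the factor [h]. *)
Definition swap_fun (v : V6) : V6 :=
  ((v.1.1.1.1 - i (r v.1.1.1.1)) + (v.1.2 *: i x + v.2 *: i y),
   v.1.1.1.2, v.1.1.2, - b (r v.1.1.1.1) y, - b x (r v.1.1.1.1)).
Definition unswap_fun (v : V6) : V6 :=
  (h *: (v.1.1.1.1 - i (r v.1.1.1.1)) - (v.1.2 *: i x + v.2 *: i y),
   h * v.1.1.1.2, h * v.1.1.2, b (r v.1.1.1.1) y, b x (r v.1.1.1.1)).

Let ab := plane_alt pl.

Let k_lin a v w : a *: v + w - i (r (a *: v + w)) =
  a *: (v - i (r v)) + (w - i (r w)).
Proof. by rewrite (linearP r) (linearP i) scalerBr opprD addrACA. Qed.

Lemma swap_lin : linear swap_fun.
Proof.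
move=> a [[[[v al] be] p1] p2] [[[[w al'] be'] p1'] p2']; rewrite /swap_fun.
congr (_, _, _, _, _); rewrite /= ?k_lin /=.
- rewrite !scalerDl !scalerDr !scalerA; rewrite [X in _ + X = _]addrACA.
  by rewrite [LHS]addrACA.
- by rewrite linearP /GRing.scale /= (altDl ab) (altZl ab); ring.
- by rewrite linearP /GRing.scale /= (altDr ab) (altZr ab); ring.
Qed.

Lemma unswap_lin : linear unswap_fun.
Proof.
move=> a [[[[v al] be] p1] p2] [[[[w al'] be'] p1'] p2']; rewrite /unswap_fun.
congr (_, _, _, _, _); rewrite /= ?k_lin /=.
- rewrite !scalerDl !scalerDr !scalerA [h * a]mulrC !scalerN !scalerDr !scalerA.
  rewrite !opprD [X in _ + X = _]addrACA.
  by rewrite [LHS]addrACA.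
- by rewrite /GRing.scale /=; ring.
- by rewrite /GRing.scale /=; ring.
- by rewrite linearP /GRing.scale /= (altDl ab) (altZl ab); ring.
- by rewrite linearP /GRing.scale /= (altDr ab) (altZr ab); ring.
Qed.

Let ir : cancel i r. Proof. by case: iso. Qed.

Let rk v : r (v - i (r v)) = 0.
Proof. by rewrite linearB /= ir subrr. Qed.

Let iE p q : p *: i x + q *: i y = i (p *: x + q *: y).
Proof. by rewrite linearD !linearZ. Qed.

Lemma swapK v : swap_fun (unswap_fun v) = h *: v.
Proof.
have [_ plk _] := pl.
case: v => [[[[v al] be] p1] p2]; rewrite /swap_fun /unswap_fun /=.
have rE : r (h *: (v - i (r v)) - (p1 *: i x + p2 *: i y)) = - (p1 *: x + p2 *: y).
  by rewrite linearB linearZ rk linearD !linearZ /= !ir scaler0 sub0r.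
rewrite rE; congr (_, _, _, _, _); rewrite /=.
- by rewrite !iE (linearN i) opprK subrK -plk linearZ /= -scalerDr subrK.
- by rewrite (altNl ab) opprK (altDl ab) !(altZl ab) (altxx ab) mulr0 addr0 mulrC.
- by rewrite (altNr ab) opprK (altDr ab) !(altZr ab) (altxx ab) mulr0 add0r mulrC.
Qed.

Let form_swap chi v w :
  form6 chi (swap_fun v) (swap_fun w) =
  psi (v.1.1.1.1 - i (r v.1.1.1.1)) (w.1.1.1.1 - i (r w.1.1.1.1))
  + h * b (r v.1.1.1.1) (r w.1.1.1.1)
  + chi (v.1.2 *: x + v.2 *: y, v.1.1.1.2, v.1.1.2)
        (w.1.2 *: x + w.2 *: y, w.1.1.1.2, w.1.1.2).
Proof.
have [_ plk _] := pl.
case: v w => [[[[v al] be] p1] p2] [[[[w al'] be'] p1'] p2'] /=.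
have rE u p q : r (u - i (r u) + (p *: i x + q *: i y)) = p *: x + q *: y.
  by rewrite linearD rk add0r linearD !linearZ /= !ir.
rewrite /form6 /perp_psi2 /hat /swap_fun /= /r4_fun /i4_fun /= !rE.
rewrite !iE !addrK.
have -> : h * b (r v) (r w) = b (r v) y * b x (r w) - b x (r v) * b (r w) y.
  rewrite /h -(altZl ab) plk (altDl ab) !(altZl ab) [b y _](altC ab).
  by ring.
by rewrite !subrr; ring.
Qed.

Lemma pf_swap chi kappa : alternating chi -> has_pf chi kappa ->
  pfl (form6 chi) N.+2 (map swap_fun L6) =
  kappa * h * pfl (fun v w => psi (v - i (r v)) (w - i (r w)) + h * b (r v) (r w)) N s.
Proof.
move=> ac hk; rewrite pfl_map.
rewrite (@eq_pfl _ _ _ _ _ _ (form_swap chi)).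
rewrite -add2n (_ : L6 = [:: (0, 0, 0, 1, 0); (0, 0, 0, 0, 1); (0, 1, 0, 0, 0);
   (0, 0, 1, 0, 0)] ++ [seq (v, 0, 0, 0, 0) | v <- s]); last first.
  by rewrite /L6 /plane_list /= -map_comp.
have c0 u : chi u (0, 0, 0) = 0 by apply: (alt0r ac).
rewrite pfl_cat //; last first.
  do ?split=> //; apply: all_orth_map => v /=;
    by rewrite (linear0 r) (linear0 i) subr0 (alt0l apsi) (alt0l ab) !scale0r
      ?addr0 c0; ring.
rewrite pfl_map; congr (_ * _).
  rewrite /= (linear0 r) (linear0 i) subr0 !(alt0l apsi) !(alt0l ab) !scale0r.
  rewrite !scale1r ?addr0 ?add0r; have := hk x y; rewrite /inj1 /vec3 /vec4 -/h => <-.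
  by ring.
apply: eq_pfl => v w /=.
by rewrite !scale0r addr0 c0 addr0.
Qed.

End Trick.

(** After stabilizing by a free plane, [swap_fun x y] carries the form built
    from [chi] to an orthogonal sum of a form independent of [chi] and the
    Gram form of [x], [y], [vec3], [vec4] under [chi].  Comparing with
    [chi = b _|_ psi_2] gives [D * (relative_pf chi - kappa) = 0], where [D]
    divides a power of [b x y]. *)
Lemma relative_pfE chi kappa : alternating chi -> has_pf chi kappa ->
  relative_pf chi = kappa.
Proof.
move=> ac hk; have ab := plane_alt pl; have [_ _ [M [x [y e1]]]] := pl.
apply/eqP; rewrite -subr_eq0; apply/eqP.
apply: (comaximal_powers (m := size L6) e1) => k.
have spL6 : forall v, in_span L6 v by do 2 apply: plane_list_span.
have [D DP] := spanning_det (lin_of (@swap_lin (x k) (y k))) spL6.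
have [D' D'P] := spanning_det (lin_of (@unswap_lin (x k) (y k))) spL6.
have hA chi' : alternating chi' ->
    alternating (hat i4 r4 (perp_psi2 psi) chi').
  by move=> h; apply: hat_alt h; apply: perp_psi2_alt.
have pfL6 chi' : alternating chi' -> pfl (form6 chi') N.+2 L6 = relative_pf chi'.
  by move=> h; rewrite plane_list_pfl //; apply: hA.
have ab4 := perp_psi2_alt ab.
have hk1 : has_pf (perp_psi2 b) 1.
  by move=> u v; rewrite /perp_psi2 /= !(alt0l ab) !(alt0r ab); ring.
have rel1 : relative_pf (perp_psi2 b) = 1.
  rewrite -pf_s -(plane_list_pfl _ _ apsi); apply: eq_pfl => u v.
  by apply: hat_retract; [apply: perp_psi2_alt | apply: iso4].
have eD chi' kappa' : alternating chi' -> has_pf chi' kappa' ->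
    D * relative_pf chi' = kappa' * D.
  move=> h hk'; have a6 := perp_psi2_alt (hA _ h).
  have := DP _ (pfl_additive a6 N.+2) (pfl_alternating a6 N.+2).
  rewrite pfL6 // => <-; rewrite (pf_swap _ _ h hk').
  have a6' := perp_psi2_alt (hA _ ab4).
  have := DP _ (pfl_additive a6' N.+2) (pfl_alternating a6' N.+2).
  rewrite pfL6 // rel1 mulr1 => <-; rewrite (pf_swap _ _ ab4 hk1).
  by ring.
have DD : D * D' = b (x k) (y k) ^+ size L6.
  have a6' := perp_psi2_alt (hA _ ab4).
  have aG := pfl_additive a6' N.+2; have dG := pfl_alternating a6' N.+2.
  have := list_scale (b (x k) (y k)) L6 aG dG.
  rewrite pfL6 // rel1 mulr1 => <-.
  rewrite -(eq_map (@swapK (x k) (y k))) map_comp.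
  pose T := lin_of (@swap_lin (x k) (y k)); pose G6 := pfl (form6 (perp_psi2 b)) N.+2.
  have aT : list_additive (fun t => G6 (map T t)).
    by move=> s1 a u v s2; rewrite /G6 !map_cat !map_cons (linearP T) aG.
  have dT : list_alternating (fun t => G6 (map T t)).
    by move=> s1 u s2; rewrite /G6 map_cat !map_cons dG.
  refine (etrans _ (esym (D'P _ aT dT))).
  by rewrite /G6 (DP _ aG dG) pfL6 // rel1; ring.
rewrite -DD; transitivity (D' * (D * relative_pf chi - kappa * D)); first by ring.
by rewrite (eD _ _ ac hk) subrr mulr0.
Qed.

End PfaffianFormula.

(** * Unimodular functionals and hyperbolic planes *)

Section Inclusion.
Variables (R : comPzRingType) (P : lmodType R).

Lemma pair0_lin : linear (fun x : P => (x, 0) : (P * R^o)%type).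
Proof. by move=> a x z; congr (_, _); rewrite /= scaler0 addr0. Qed.

Definition inl1 : {linear P -> (P * R^o)%type} := lin_of pair0_lin.

Lemma pair_split (x : (P * R^o)%type) : x = inl1 x.1 + x.2 *: ((0, 1) : (P * R^o)%type).
Proof.
case: x => x t; congr (_, _); rewrite /= ?scaler0 ?addr0 // add0r.
by rewrite /GRing.scale /= mulr1.
Qed.

End Inclusion.

Section TriangularMaps.
Variables (R : comPzRingType) (P : lmodType R).
Hypothesis eP : embeddable P.
Local Notation plus1 M := (M * R^o)%type.

Let eP1 : embeddable (plus1 P) := embeddable_prod eP (embeddable_free1 R).

Lemma shear_snd (f : {linear P -> R^o}) :
  exists phi : {linear plus1 P -> plus1 P},
    has_det phi 1 /\ forall x, phi x = (x.1, x.2 + f x.1).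
Proof.
have L : linear (fun x : plus1 P => (x.1, x.2 + f x.1) : plus1 P).
  move=> a x y; congr (_, _); rewrite /= linearP /GRing.scale /=; ring.
have dL : linear (fun c : R^o => (0, c) : plus1 P).
  by move=> a x y; congr (_, _); rewrite /= scaler0 addr0.
exists (lin_of L); split=> //.
apply: (has_det_unipotent (delta := lin_of dL) (rho := f \o fst) eP1 (embeddable_free1 R)).
  by move=> [x t]; congr (_, _); rewrite /= addr0.
by move=> y /=; rewrite linear0.
Qed.

Lemma shear_fst (y : P) : exists phi : {linear plus1 P -> plus1 P},
  has_det phi 1 /\ forall x, phi x = (x.1 + x.2 *: y, x.2).
Proof.
have L : linear (fun x : plus1 P => (x.1 + x.2 *: y, x.2) : plus1 P).
  move=> a x z; congr (_, _); rewrite /= scalerDl scalerDr scalerA; exact: addrACA.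
have dL : linear (fun c : R^o => (c *: y, 0) : plus1 P).
  move=> a x z; congr (_, _); rewrite /= ?scaler0 ?addr0 //.
  by rewrite scalerDl scalerA.
exists (lin_of L); split=> //.
apply: (has_det_unipotent (delta := lin_of dL) (rho := snd) eP1 (embeddable_free1 R)).
  by move=> [x t]; congr (_, _); rewrite /= addr0.
by [].
Qed.

Lemma extend_id (g : {linear P -> P}) d : has_det g d ->
  exists phi : {linear plus1 P -> plus1 P},
    has_det phi d /\ forall x, phi x = (g x.1, x.2).
Proof.
move=> hg; have L : linear (fun x : plus1 P => (g x.1, x.2) : plus1 P).
  by move=> a x z; rewrite /= linearP.
have uL : linear (fun x : P => (x, 0) : plus1 P).
  by move=> a x z; congr (_, _); rewrite /= scaler0 addr0.
exists (lin_of L); split=> //.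
apply: (has_det_stabilize (u := inl1 P) (rho := fst) eP1) hg => // -[x t].
by congr (_, _); rewrite /= ?subrr ?addr0 // add0r subr0.
Qed.

(** [h] is the composition of [g (+) id] with a shear, and shears have
    determinant one. *)
Lemma fix_last (h : {linear plus1 P -> plus1 P}) :
  h (0, 1) = (0, 1) -> has_det h 1 ->
  exists g : {linear P -> P}, has_det g 1 /\ forall x, (h x).1 = g x.1.
Proof.
move=> h01 hd.
pose g : {linear P -> P} := fst \o h \o inl1 P.
have hE x : h x = h (inl1 P x.1) + x.2 *: ((0, 1) : (P * R^o)%type).
  by rewrite -h01 -linearZ -linearD -pair_split.
exists g; split; last by move=> x; rewrite hE /= scaler0 addr0.
have [d hg] := has_det_ex g eP.
have [phi [hphi phiE]] := extend_id hg.
have [psi [hpsi psiE]] := shear_snd (snd \o h \o inl1 P).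
have -> : 1 = d; last by [].
apply: has_det_inj hd _; have := has_det_comp hphi hpsi; rewrite mulr1.
apply: has_det_ext => x; rewrite /= psiE phiE hE.
by congr (_, _); rewrite /= ?scaler0 ?addr0 // addrC /GRing.scale /= mulr1.
Qed.

Lemma fix_quotient (h : {linear plus1 P -> plus1 P}) :
  (forall x, (h x).2 = x.2) -> has_det h 1 ->
  exists g : {linear P -> P}, has_det g 1 /\ forall x, h (x, 0) = (g x, 0).
Proof.
move=> h2 hd.
pose g : {linear P -> P} := fst \o h \o inl1 P.
exists g; split; last by move=> x /=; rewrite [LHS]surjective_pairing h2.
have [d hg] := has_det_ex g eP.
have [phi [hphi phiE]] := extend_id hg.
have [psi [hpsi psiE]] := shear_fst (h (0, 1)).1.
have -> : 1 = d; last by [].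
apply: has_det_inj hd _; have := has_det_comp hpsi hphi; rewrite mul1r.
apply: has_det_ext => x; rewrite /= phiE psiE /= [RHS]surjective_pairing h2.
by congr (_, _); rewrite [in RHS](pair_split x) linearD linearZ.
Qed.

End TriangularMaps.

Section Transitivity.
Variable R : comPzRingType.
Local Notation plus1 M := (M * R^o)%type.

(** Transitivity on unimodular functionals, with the last coordinate as base
    point. *)
Definition rectifiable (Q : lmodType R) : Prop :=
  forall a : {linear plus1 Q -> R^o}, is_Um a ->
  exists phi : {linear plus1 Q -> plus1 Q}, has_det phi 1 /\
    forall x, a (phi x) = x.2.

Lemma rectifiable_of_transitive (Q : lmodType R) :
  SL_transitive_on_Um (plus1 Q) -> rectifiable Q.
Proof.
move=> tr a ua; have [|phi [[_ hphi] e]] := tr a (snd : {linear plus1 Q -> R^o}) ua.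
  by move=> c; exists (0, c).
by exists phi; split=> // x; rewrite -e.
Qed.

(** A self-dual module in the stable range: the functional [(b z, s)] is moved
    to [(b z', s)] with [b z'] unimodular, then to [(b z', 1)], then to
    [(0, 1)]. *)
Lemma rectifiable_of_stable_range (Q : lmodType R) (b : Q -> Q -> R) :
  embeddable Q -> alternating b -> perfect b -> stable_range Q -> rectifiable Q.
Proof.
move=> eQ ab pb sr a ua.
have [z zP] := pb (a \o inl1 Q); pose s := a (0, 1).
have aE p t : a (p, t) = b z p + s * t.
  by rewrite -zP /= (pair_split (p, t)) linearD linearZ /= [s * t]mulrC.
have [[p t] apt] := ua 1.
have [|w [f fz]] := sr s z.
  exists (lin_of (alt_linl ab p)), t; rewrite /= -apt aE; ring.
have [y yP] := pb f; rewrite yP in fz.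
pose z' := z + s *: w.
have [phi1 [d1 e1]] := shear_snd eQ (lin_of (alt_linr ab w)).
have [phi2 [d2 e2]] := shear_fst eQ (- (1 - s) *: y).
have [phi3 [d3 e3]] := shear_snd eQ (lin_of (alt_linr ab (- z'))).
exists (phi1 \o phi2 \o phi3); split.
  by have := has_det_comp (has_det_comp d1 d2) d3; rewrite !mulr1.
move=> [x u]; rewrite /= e3 e2 e1 /= aE !(altDr ab) !(altZr ab) (altNl ab).
rewrite /z' (altDl ab) (altZl ab).
have e4 : b z y + s * b w y = - 1.
  by rewrite -(altZl ab) -(altDl ab) (altC ab) fz.
have -> : b z y = - 1 - s * b w y by rewrite -e4; ring.
by ring.
Qed.

Lemma perfect_pull (Q : lmodType R) (b : Q -> Q -> R) (phi : {linear Q -> Q}) :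
  has_det phi 1 -> perfect b -> perfect (fun x y => b (phi x) (phi y)).
Proof.
move=> hd pb f; have [psi [c1 c2 _]] := has_det1_inv hd.
have [y yP] := pb (f \o psi); exists (psi y) => x.
by rewrite c2 -yP /= c1.
Qed.

Lemma alternating_pull (P Q : lmodType R) (b : Q -> Q -> R) (phi : {linear P -> Q}) :
  alternating b -> alternating (fun x y => b (phi x) (phi y)).
Proof.
move=> ab; split=> [a x y z|a x y z|x].
- by rewrite linearP (altDl ab) (altZl ab).
- by rewrite linearP (altDr ab) (altZr ab).
- by rewrite (altxx ab).
Qed.

Lemma perfect_perp (Q : lmodType R) (chi : Q -> Q -> R) :
  alternating chi -> perfect (perp_psi2 chi) <-> perfect chi.
Proof.
move=> ac; split=> pc f.
  have [y yP] := pc (f \o fst \o fst); exists y.1.1 => x.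
  have := yP (x, 0, 0); rewrite /= => ->; rewrite /perp_psi2 /=; ring.
have [y yP] := pc (f \o inl1 (plus1 Q) \o inl1 Q).
exists (y, f (vec4 Q), - f (vec3 Q)) => x.
rewrite {1}(pair_split x) linearD linearZ {1}(pair_split x.1) !linearD !linearZ /=.
by rewrite /perp_psi2 /= -yP /GRing.scale /=; ring.
Qed.

(** Splitting off a hyperbolic plane.  Rectify the functional [omega(-, e4)] on
    [Q (+) R e3]; after that [e3] and [e4] are a hyperbolic pair, and a shear
    along [e4] makes [Q] orthogonal to both. *)
Lemma split_hyperbolic (Q : lmodType R) (omega : plus1 (plus1 Q) -> plus1 (plus1 Q) -> R) :
  embeddable Q -> rectifiable Q -> alternating omega -> perfect omega ->
  exists (Phi : {linear plus1 (plus1 Q) -> plus1 (plus1 Q)}) (chi : Q -> Q -> R),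
    [/\ has_det Phi 1, Phi (vec4 Q) = vec4 Q, alternating chi, perfect chi &
        forall x y, omega (Phi x) (Phi y) = perp_psi2 chi x y].
Proof.
move=> eQ rec ao po.
have eQ1 := embeddable_prod eQ (embeddable_free1 R).
pose al : {linear plus1 Q -> R^o} := lin_of (alt_linl ao (vec4 Q)) \o inl1 (plus1 Q).
have ua : is_Um al.
  move=> c; have [y yP] := po (snd : {linear plus1 (plus1 Q) -> R^o}).
  have h1 : omega y (vec4 Q) = 1 by rewrite -yP.
  exists (c *: y.1) => /=.
  have -> : (c *: y.1, 0) = c *: (y - y.2 *: vec4 Q).
    case: y {yP h1} => y t; congr (_, _); rewrite /= ?scaler0 ?subr0 //.
    by rewrite /GRing.scale /=; ring.
  by rewrite (altZl ao) (altBl ao) (altZl ao) (altxx ao) h1; ring.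
have [g [hg gP]] := rec _ ua; rewrite /= in gP.
have [Phi1 [d1 e1]] := extend_id eQ1 hg.
pose om1 x y := omega (Phi1 x) (Phi1 y).
have ao1 : alternating om1 by apply: alternating_pull.
have Phi1v4 : Phi1 (vec4 Q) = vec4 Q by rewrite e1 /= linear0.
have [Phi2 [d2 e2]] := shear_snd eQ1
  (lin_of (alt_linl ao1 (vec3 Q)) \o inl1 (plus1 Q) \o inl1 Q \o fst).
pose Phi := Phi1 \o Phi2.
have om0 v : om1 (0, 0, 0) v = 0 by apply: (alt0l ao1).
have Phi4 : Phi (vec4 Q) = vec4 Q.
  by rewrite /Phi /= e2 /= om0 addr0.
pose u q := Phi (inj1 q).
have om4 x : omega (Phi x) (vec4 Q) = x.1.2.
  rewrite /Phi /= e1 e2 /= -(gP x.1) /al /= (pair_split (g x.1, _)).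
  by rewrite (altDl ao) (altZl ao) (altxx ao) mulr0 addr0.
have om3 q : omega (u q) (Phi (vec3 Q)) = 0.
  have uE : u q = Phi1 (inj1 q) + om1 (inj1 q) (vec3 Q) *: vec4 Q.
    rewrite /u /Phi /= e2 (pair_split (_, _)) linearD linearZ /= Phi1v4 add0r.
    by [].
  have vE : Phi (vec3 Q) = Phi1 (vec3 Q).
    by rewrite /Phi /= e2 /= om0 addr0.
  rewrite uE (altDl ao) (altZl ao) (altC ao _ (vec4 Q)) om4 /= vE.
  by rewrite /om1; ring.
have PhiE x : Phi x = u x.1.1 + x.1.2 *: Phi (vec3 Q) + x.2 *: vec4 Q.
  rewrite -Phi4 -!linearZ -!linearD; congr (Phi _).
  by rewrite {1}(pair_split x) {1}(pair_split x.1) linearD linearZ.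
have ac : alternating (fun p q => omega (u p) (u q)).
  exact: (alternating_pull (Phi \o inl1 (plus1 Q) \o inl1 Q) ao).
have E x y : omega (Phi x) (Phi y) = perp_psi2 (fun p q => omega (u p) (u q)) x y.
  have hu4 q : omega (u q) (vec4 Q) = 0 by rewrite om4.
  have h34 : omega (Phi (vec3 Q)) (vec4 Q) = 1 by rewrite om4.
  have h43 : omega (vec4 Q) (Phi (vec3 Q)) = -1 by rewrite (altC ao) h34.
  have h4u q : omega (vec4 Q) (u q) = 0 by rewrite (altC ao) hu4 oppr0.
  have h3u q : omega (Phi (vec3 Q)) (u q) = 0 by rewrite (altC ao) om3 oppr0.
  rewrite (PhiE y) (PhiE x) !(altDl ao) !(altDr ao) !(altZl ao) !(altZr ao).
  by rewrite om3 hu4 h34 h43 h4u h3u !(altxx ao) /perp_psi2 /=; ring.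
have dPhi : has_det Phi 1 by have := has_det_comp d1 d2; rewrite mulr1.
exists Phi, (fun p q => omega (u p) (u q)); split=> //.
apply/(perfect_perp ac) => f; have [y yP] := perfect_pull dPhi po f.
by exists y => x; rewrite -E.
Qed.

End Transitivity.

(** * Symplectic transvections and cancellation *)

Section Symplectic.
Variable R : comPzRingType.
Local Notation plus1 M := (M * R^o)%type.
Local Notation plus2 M := (M * R^o * R^o)%type.

Section Transvections.
Variables (Q : lmodType R) (chi : Q -> Q -> R).
Hypotheses (eQ : embeddable Q) (ac : alternating chi).

Definition special_isometry (phi : {linear plus2 Q -> plus2 Q}) : Prop :=
  has_det phi 1 /\
  forall x y, perp_psi2 chi (phi x) (phi y) = perp_psi2 chi x y.

Lemma special_isometry_comp phi psi :
  special_isometry phi -> special_isometry psi -> special_isometry (phi \o psi).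
Proof.
move=> [d1 i1] [d2 i2]; split; last by move=> x y /=; rewrite i1 i2.
by have := has_det_comp d1 d2; rewrite mulr1.
Qed.

Let eF := embeddable_free1 R.
Let eQ2 : embeddable (plus2 Q) := embeddable_prod (embeddable_prod eQ eF) eF.

Lemma transvection4 q : exists phi, special_isometry phi /\
  forall x, phi x = (x.1.1 + x.2 *: q, x.1.2 - chi x.1.1 q, x.2).
Proof.
have L : linear (fun x : plus2 Q =>
    (x.1.1 + x.2 *: q, x.1.2 - chi x.1.1 q, x.2) : plus2 Q).
  move=> a x y; congr (_, _, _); rewrite /=.
    by rewrite scalerDl scalerDr scalerA addrACA.
  by rewrite (altDl ac) (altZl ac) /GRing.scale /=; ring.
have dL : linear (fun c : (R^o * R^o)%type => (c.1 *: q, - c.2, 0) : plus2 Q).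
  move=> a x y; congr (_, _, _); rewrite /= ?scaler0 ?addr0 //.
    by rewrite scalerDl scalerA.
  by rewrite /GRing.scale /=; ring.
have rL : linear (fun x : plus2 Q => (x.2, chi x.1.1 q) : (R^o * R^o)%type).
  by move=> a x y; congr (_, _); rewrite /= (altDl ac) (altZl ac).
exists (lin_of L); split; [split|by []].
  apply: (has_det_unipotent (delta := lin_of dL) (rho := lin_of rL) eQ2) => [|x|y].
  - exact: embeddable_prod.
  - by congr (_, _, _); rewrite /= ?addr0.
  - by congr (_, _); rewrite /= (altZl ac) (altxx ac) mulr0.
move=> x y; rewrite /perp_psi2 /= !(altDl ac) !(altDr ac) !(altZl ac) !(altZr ac).
by rewrite (altxx ac) (altC ac y.1.1 q); ring.
Qed.

Lemma transvection3 q : exists phi, special_isometry phi /\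
  forall x, phi x = (x.1.1 + x.1.2 *: q, x.1.2, x.2 + chi x.1.1 q).
Proof.
have L : linear (fun x : plus2 Q =>
    (x.1.1 + x.1.2 *: q, x.1.2, x.2 + chi x.1.1 q) : plus2 Q).
  move=> a x y; congr (_, _, _); rewrite /=.
    by rewrite scalerDl scalerDr scalerA addrACA.
  by rewrite (altDl ac) (altZl ac) /GRing.scale /=; ring.
have dL : linear (fun c : (R^o * R^o)%type => (c.1 *: q, 0, c.2) : plus2 Q).
  move=> a x y; congr (_, _, _); rewrite /= ?scaler0 ?addr0 //.
  by rewrite scalerDl scalerA.
have rL : linear (fun x : plus2 Q => (x.1.2, chi x.1.1 q) : (R^o * R^o)%type).
  by move=> a x y; congr (_, _); rewrite /= (altDl ac) (altZl ac).
exists (lin_of L); split; [split|by []].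
  apply: (has_det_unipotent (delta := lin_of dL) (rho := lin_of rL) eQ2) => [|x|y].
  - exact: embeddable_prod.
  - by congr (_, _, _); rewrite /= ?addr0.
  - by congr (_, _); rewrite /= (altZl ac) (altxx ac) mulr0.
move=> x y; rewrite /perp_psi2 /= !(altDl ac) !(altDr ac) !(altZl ac) !(altZr ac).
by rewrite (altxx ac) (altC ac y.1.1 q); ring.
Qed.

Lemma transvection34 t : exists phi, special_isometry phi /\
  forall x, phi x = (x.1.1, x.1.2 + t * x.2, x.2).
Proof.
have L : linear (fun x : plus2 Q => (x.1.1, x.1.2 + t * x.2, x.2) : plus2 Q).
  by move=> a x y; congr (_, _, _); rewrite /= /GRing.scale /=; ring.
have dL : linear (fun c : R^o => (0, t * c, 0) : plus2 Q).
  move=> a x y; congr (_, _, _); rewrite /= ?scaler0 ?addr0 //.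
  by rewrite /GRing.scale /=; ring.
exists (lin_of L); split; [split|by []].
  apply: (has_det_unipotent (delta := lin_of dL) (rho := snd) eQ2 eF) => [x|y] //.
  by congr (_, _, _); rewrite /= ?addr0.
by move=> x y; rewrite /perp_psi2 /=; ring.
Qed.

Lemma transvection43 t : exists phi, special_isometry phi /\
  forall x, phi x = (x.1.1, x.1.2, x.2 + t * x.1.2).
Proof.
have L : linear (fun x : plus2 Q => (x.1.1, x.1.2, x.2 + t * x.1.2) : plus2 Q).
  by move=> a x y; congr (_, _, _); rewrite /= /GRing.scale /=; ring.
have dL : linear (fun c : R^o => (0, 0, t * c) : plus2 Q).
  move=> a x y; congr (_, _, _); rewrite /= ?scaler0 ?addr0 //.
  by rewrite /GRing.scale /=; ring.
exists (lin_of L); split; [split|by []].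
  apply: (has_det_unipotent (delta := lin_of dL) (rho := snd \o fst) eQ2 eF) => [x|y] //.
  by congr (_, _, _); rewrite /= ?addr0.
by move=> x y; rewrite /perp_psi2 /=; ring.
Qed.

(** The stable range makes the coordinates other than the last unimodular by
    adding multiples of the last one to them; the last coordinate can then be
    changed to 1, and the others are cleared with it. *)
Lemma special_isometry_transitive (v : plus2 Q) : perfect chi ->
  stable_range (plus1 Q) -> (exists f : {linear plus2 Q -> R^o}, f v = 1) ->
  exists sigma, special_isometry sigma /\ sigma v = vec4 Q.
Proof.
move=> pc sr [f fv]; case: v fv => [[x r] s] fv.
have [|[q t] [g gz]] := sr s (x, r).
  exists (f \o inl1 (plus1 Q)), (f (0, 1)).
  by rewrite -[RHS]fv (pair_split (x, r, s)) linearD linearZ /= mulrC.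
have [y yP] := pc (g \o inl1 Q); pose beta := g (0, 1).
have gE a c : g (a, c) = chi y a + beta * c.
  by rewrite (pair_split (a, c)) linearD linearZ /= -yP [beta * c]mulrC.
pose x' := x + s *: q; pose r' := r - chi x q + t * s; pose y' := y - beta *: q.
have e1 : chi y' x' + beta * r' = 1.
  have e0 : g (x', r + s * t) = 1 by exact: gz.
  rewrite -e0 gE /y' /x' /r'.
  rewrite !(altDl ac) !(altDr ac) (altNl ac) (altNl ac) !(altZl ac) !(altZr ac) (altxx ac).
  by rewrite (altC ac x q); ring.
have [s1 [h1 E1]] := transvection4 q.
have [s2 [h2 E2]] := transvection34 t.
have [s3 [h3 E3]] := transvection3 (- (1 - s) *: y').
have [s4 [h4 E4]] := transvection43 ((1 - s) * beta).
pose x'' := x' + r' *: (- (1 - s) *: y').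
have [s5 [h5 E5]] := transvection4 (- x'').
have [s6 [h6 E6]] := transvection34 (- r').
exists (s6 \o (s5 \o (s4 \o (s3 \o (s2 \o s1))))); split.
  have C := special_isometry_comp; exact: C h6 (C _ _ h5 (C _ _ h4 (C _ _ h3 (C _ _ h2 h1)))).
rewrite /= E1 E2 E3 E4 E5 E6 /= -/x' -/r' -/x''.
have -> : s + chi x' (- (1 - s) *: y') + (1 - s) * beta * r' = 1.
  rewrite (altZr ac) (altC ac y' x').
  have -> : chi y' x' = 1 - beta * r' by rewrite -e1; ring.
  by ring.
congr (_, _, _); first by rewrite scale1r subrr.
by rewrite (altNr ac) (altxx ac); ring.
Qed.

(** Transvections correct the isometry so that it fixes [vec4]; it then acts on
    the orthogonal of [vec4] modulo [vec4], which is [Q]. *)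
Lemma cancel_hyperbolic (chi' : Q -> Q -> R) (Phi : {linear plus2 Q -> plus2 Q}) :
  perfect chi -> stable_range (plus1 Q) -> has_det Phi 1 -> alternating chi' ->
  (forall x y, perp_psi2 chi (Phi x) (Phi y) = perp_psi2 chi' x y) ->
  exists g : {linear Q -> Q}, has_det g 1 /\
    forall x y, chi (g x) (g y) = chi' x y.
Proof.
move=> pc sr dPhi ac' iso.
have ap := perp_psi2_alt ac.
have [|sg [[dsg isg] esg]] := @special_isometry_transitive (Phi (vec4 Q)) pc sr.
  exists (lin_of (alt_linr ap (Phi (vec3 Q)))).
  by rewrite /= iso /perp_psi2 /= (alt0l ac'); ring.
pose F := sg \o Phi.
have dF : has_det F 1 by have := has_det_comp dsg dPhi; rewrite mulr1.
have iF x y : perp_psi2 chi (F x) (F y) = perp_psi2 chi' x y by rewrite /F /= isg iso.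
have F4 : F (vec4 Q) = vec4 Q by [].
have F2 x : (F x).1.2 = x.1.2.
  have := iF x (vec4 Q); rewrite F4 /perp_psi2 /= (alt0r ac) (alt0r ac').
  by rewrite !mulr1 !mulr0 !add0r !subr0.
have eQ1 : embeddable (plus1 Q) by apply: embeddable_prod.
have [g1 [dg1 g1E]] := fix_last eQ1 F4 dF.
have g12 x : (g1 x).2 = x.2.
  by have := g1E (x, 0); have := F2 (x, 0) => /= <- <-.
have [g [dg gE]] := fix_quotient eQ g12 dg1.
exists g; split=> // x y.
have E z : (F (inj1 z)).1 = (g z, 0) by rewrite g1E /= gE.
have := iF (inj1 x) (inj1 y); rewrite /perp_psi2 !E /=.
by rewrite !mul0r !mulr0 subrr !addr0.
Qed.

End Transvections.

(** Iterated orthogonal sums with hyperbolic planes; each step adds one plane,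
    so that the lemmas on a single plane apply by induction. *)
Fixpoint tower (B : lmodType R) (k : nat) : lmodType R :=
  if k is k'.+1 then plus2 (tower B k') else B.

Fixpoint tower_form (B : lmodType R) (b : B -> B -> R) (k : nat) :
    tower B k -> tower B k -> R :=
  if k is k'.+1 then perp_psi2 (@tower_form B b k') else b.

Section Tower.
Variable B : lmodType R.
Hypothesis eB : embeddable B.

Lemma tower_embeddable k : embeddable (tower B k).
Proof.
by elim: k => [//|k IH] /=; do 2 (apply: embeddable_prod; last exact: embeddable_free1).
Qed.

Lemma tower_alt b k : alternating b -> alternating (@tower_form B b k).
Proof. by move=> ab; elim: k => [//|k IH]; apply: perp_psi2_alt. Qed.

Lemma tower_perfect b k : alternating b -> perfect b -> perfect (@tower_form B b k).
Proof.
move=> ab pb; elim: k => [//|k IH] /=.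
exact: (perfect_perp (tower_alt k ab)).2 IH.
Qed.

Lemma tower_general_position d k : noetherian R ->
  general_position B d -> general_position (tower B k) (d + k.*2).
Proof.
move=> noeth gp; elim: k => [|k IH]; first by rewrite addn0.
rewrite doubleS !addnS /=.
by do 2 (apply: general_position_free => //).
Qed.

Lemma tower_cancel b b' k (Phi : {linear tower B k -> tower B k}) :
  alternating b -> perfect b -> alternating b' ->
  (forall j, stable_range (plus1 (tower B j))) -> has_det Phi 1 ->
  (forall x y, @tower_form B b k (Phi x) (Phi y) = @tower_form B b' k x y) ->
  exists g : {linear B -> B}, has_det g 1 /\ forall x y, b (g x) (g y) = b' x y.
Proof.
move=> ab pb ab' sr; elim: k Phi => [|k IH] Phi dPhi iPhi; first by exists Phi.
have [g [dg ig]] := cancel_hyperbolic (tower_embeddable k) (tower_alt k ab)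
  (tower_perfect ab pb) (sr k) dPhi (tower_alt k ab') iPhi.
exact: IH dg ig.
Qed.

Lemma tower_split k (omega : tower B k -> tower B k -> R) :
  (forall j, rectifiable (tower B j)) -> alternating omega -> perfect omega ->
  exists (Phi : {linear tower B k -> tower B k}) b,
    [/\ has_det Phi 1, alternating b &
        forall x y, omega (Phi x) (Phi y) = @tower_form B b k x y].
Proof.
move=> rec; elim: k omega => [|k IH] omega ao po.
  by exists idfun, omega; split=> //; apply: has_det_id.
have ek := tower_embeddable k.
have [Phi [chi [dPhi _ ac pc iPhi]]] := split_hyperbolic ek (rec k) ao po.
have [g [b [dg ab ig]]] := IH chi ac pc.
have [g1 [dg1 g1E]] := extend_id ek dg.
have ek1 := embeddable_prod ek (embeddable_free1 R).
have [g2 [dg2 g2E]] := extend_id ek1 dg1.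
exists (Phi \o g2), b; split=> //.
  by have := has_det_comp dPhi dg2; rewrite mulr1.
by move=> x y /=; rewrite iPhi !g2E /= !g1E /perp_psi2 /= ig.
Qed.

End Tower.
End Symplectic.

(** * Standard symplectic matrices *)

Section MatrixForms.
Variable R : comPzRingType.

Definition mform n (M : 'M[R]_n) (v w : 'rV[R]_n) : R := (v *m M *m w^T) 0 0.

Lemma mform_alt n (M : 'M[R]_n) : alternating_mx M -> alternating (mform M).
Proof.
move=> [MT M0]; rewrite /mform; split=> [a x y z|a x y z|x].
- by rewrite !mulmxDl -!scalemxAl !mxE.
- by rewrite linearP mulmxDr -scalemxAr !mxE.
rewrite mxE; pose F i j := x 0 i * M i j * x 0 j.
transitivity (\sum_j \sum_i F i j).
  by apply: eq_bigr => j _; rewrite !mxE mulr_suml.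
pose S (i j : 'I_n) := if (i < j)%N then F i j else 0.
have FS (i j : 'I_n) : F i j = S i j - S j i.
  rewrite /S /F; case: ltngtP => [lt|lt|/val_inj ->].
  - by rewrite subr0.
  - have -> : M i j = - M j i by rewrite -[in LHS](trmxK M) mxE MT mxE.
    by rewrite sub0r; ring.
  - by rewrite M0 mulr0 mul0r subrr.
rewrite (eq_bigr (fun j => \sum_i S i j - \sum_i S j i)) => [|j _].
  by rewrite sumrB exchange_big subrr.
by rewrite -sumrB; apply: eq_bigr => i _.
Qed.

Lemma gram_mform n (M : 'M[R]_n) : gram (mform M) = M.
Proof. by apply/matrixP=> i j; rewrite mxE /mform -rowE trmx_delta -colE !mxE. Qed.

Lemma mform_gram n (b : 'rV[R]_n -> 'rV[R]_n -> R) : alternating b ->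
  forall v w, mform (gram b) v w = b v w.
Proof. by move=> ab v w; rewrite (gram_mul v w ab). Qed.

Lemma gram_alternating n (b : 'rV[R]_n -> 'rV[R]_n -> R) : alternating b ->
  alternating_mx (gram b).
Proof.
move=> ab; split=> [|i]; last by rewrite mxE (altxx ab).
by apply/matrixP=> i j; rewrite !mxE (altC ab).
Qed.

Lemma mform_perp m n (M : 'M[R]_m) (N : 'M[R]_n) v w :
  mform (perp M N) v w =
  mform M (lsubmx v) (lsubmx w) + mform N (rsubmx v) (rsubmx w).
Proof.
rewrite /mform /perp -{1}(hsubmxK v) -{1}(hsubmxK w) mul_row_block !mulmx0 addr0 add0r.
by rewrite tr_row_mx mul_row_col mxE.
Qed.

(** The entries depend only on the indices as natural numbers; this makes the
    casts between matrix sizes and the associativity of orthogonal sums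
    immediate. *)
Definition psi_entry (i j : nat) : R :=
  (~~ odd i && (j == i.+1))%:R - (~~ odd j && (i == j.+1))%:R.

Definition psimx n : 'M[R]_n := \matrix_(i, j) psi_entry i j.

Lemma castmx_psimx m n (e : (m = n)%N) : castmx (e, e) (psimx m) = psimx n.
Proof. by case: n / e; rewrite castmx_id. Qed.

Lemma psi_entryC i j : psi_entry j i = - psi_entry i j.
Proof. by rewrite /psi_entry opprB. Qed.

Lemma psi_entry_cross m i j : ~~ odd m -> (i < m)%N -> psi_entry i (m + j) = 0.
Proof.
move=> em lt; rewrite /psi_entry.
have -> : (i == (m + j).+1) = false.
  by apply/negbTE; rewrite neq_ltn (leq_trans lt) // -addnS leq_addr.
rewrite andbF subr0; case: (boolP (odd i)) => //= ei.
have [e|//] := eqVneq (m + j)%N i.+1.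
have em1 : m = i.+1 by apply/eqP; rewrite eqn_leq lt -e leq_addr.
by rewrite em1 /= ei in em.
Qed.

Lemma psi_entry_shift m i j : ~~ odd m -> psi_entry (m + i) (m + j) = psi_entry i j.
Proof.
by move=> em; rewrite /psi_entry -!addnS !eqn_add2l !oddD (negbTE em).
Qed.

Lemma psimx_perp m n : ~~ odd m -> perp (psimx m) (psimx n) = psimx (m + n).
Proof.
move=> em; rewrite -[RHS]submxK; congr block_mx; apply/matrixP=> i j;
  rewrite !mxE //=.
- by rewrite psi_entry_cross.
- by rewrite psi_entryC psi_entry_cross ?oppr0.
- by rewrite psi_entry_shift.
Qed.

Lemma psi2E : psi2 R = psimx 2.
Proof.
apply/matrixP=> i j; rewrite !mxE /psi_entry.
by case: i j => [[|[|//]] ?] [[|[|//]] ?].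
Qed.

Lemma psiE n : psi R n = psimx n.*2.
Proof.
elim: n => [|n IH]; first by apply/matrixP=> -[].
by rewrite /= IH psi2E psimx_perp ?odd_double // castmx_psimx.
Qed.

Lemma psimx_alt n : alternating_mx (psimx n).
Proof.
split=> [|i]; last by rewrite mxE /psi_entry subrr.
by apply/matrixP=> i j; rewrite !mxE psi_entryC.
Qed.

Definition stdform n := mform (psimx n).

Lemma stdform_alt n : alternating (@stdform n).
Proof. exact/mform_alt/psimx_alt. Qed.

(** The free plane is put in front of [R^n] because [2 + n.*2] computes to
    [n.+1.*2]. *)
Definition front_fun n (x : ('rV[R]_n * R^o * R^o)%type) : 'rV[R]_(2 + n) :=
  row_mx (\row_(j < 2) (if j == 0 then x.1.2 else x.2)) x.1.1.

Lemma front_lin n : linear (@front_fun n).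
Proof.
move=> a x y; rewrite /front_fun scale_row_mx add_row_mx; congr row_mx.
by apply/rowP=> j; rewrite !mxE; case: eqP.
Qed.

Definition back_fun n (v : 'rV[R]_(2 + n)) : ('rV[R]_n * R^o * R^o)%type :=
  (rsubmx v, lsubmx v 0 0, lsubmx v 0 1).

Lemma back_lin n : linear (@back_fun n).
Proof.
move=> a x y; congr (_, _, _); rewrite /=; first by rewrite linearP.
  by rewrite !mxE.
by rewrite !mxE.
Qed.

Definition front n := lin_of (@front_lin n).
Definition back n := lin_of (@back_lin n).

Lemma frontK n : cancel (@front n) (@back n).
Proof.
case=> [[v a] c]; rewrite /= /front_fun /back_fun row_mxKl row_mxKr.
by rewrite !mxE.
Qed.

Lemma backK n : cancel (@back n) (@front n).
Proof.
move=> v; rewrite /= /front_fun /back_fun /= -[RHS]hsubmxK; congr row_mx.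
apply/rowP=> j; rewrite mxE; case: eqP => [->//|nj].
congr (lsubmx v _ _); apply: val_inj.
by case: j nj => [[|[|//]] lt] // nj; case: nj; apply: val_inj.
Qed.

Lemma stdform_front n x y :
  stdform (front n x) (front n y) = perp_psi2 (@stdform n) x y.
Proof.
rewrite /stdform /= -(psimx_perp n (m := 2)) // mform_perp /front_fun.
rewrite !row_mxKl !row_mxKr /perp_psi2 addrC; congr (_ + _).
rewrite /mform mxE sum_ord2 !mxE !sum_ord2 !mxE /psi_entry /=.
by ring.
Qed.

Lemma front_list n :
  [seq front n x | x <- plane_list [seq delta_mx 0 i | i <- enum 'I_n]] =
  [seq delta_mx 0 i | i <- enum 'I_(2 + n)].
Proof.
rewrite [enum 'I_(2 + n)]enum_ordSl enum_ordSl /= -!map_comp; congr [:: _, _ & _].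
- rewrite /front_fun /=; apply/rowP=> j; rewrite !mxE; case: splitP => k e.
    by rewrite !mxE /= -!val_eqE /= e; case: k {e} => [[|[|//]] ?].
  by rewrite !mxE /= -!val_eqE /= e.
- rewrite /front_fun /=; apply/rowP=> j; rewrite !mxE; case: splitP => k e.
    by rewrite !mxE /= -!val_eqE /= e; case: k {e} => [[|[|//]] ?].
  by rewrite !mxE /= -!val_eqE /= e.
apply: eq_map => i; rewrite /= /front_fun /=; apply/rowP=> j.
rewrite !mxE; case: splitP => k e.
  by rewrite !mxE /= -!val_eqE /= e; case: k {e} => [[|[|//]] ?].
by rewrite !mxE /= -!val_eqE /= e.
Qed.

Lemma rV_span n (x : 'rV[R]_n) : in_span [seq delta_mx 0 i | i <- enum 'I_n] x.
Proof.
rewrite [x]row_sum_delta -big_enum; elim: (enum 'I_n) => [|i s IH] /=.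
  by rewrite big_nil.
by exists (x 0 i); rewrite big_cons addrC addrK.
Qed.

Lemma pfl_stdform n :
  pfl (@stdform n.*2) n [seq delta_mx 0 i | i <- enum 'I_(n.*2)] = 1.
Proof.
elim: n => [|n IH]; first by rewrite enum_ord0.
rewrite -[in X in map _ X]/(2 + n.*2)%N -front_list pfl_map.
by rewrite (eq_pfl _ _ (@stdform_front _)) plane_list_pfl //; apply: stdform_alt.
Qed.

End MatrixForms.

Section Embedding.
Variable R : comPzRingType.

(** Coordinates with respect to the vectors [x k], [y k]; the Gram matrix of
    such coordinates is the standard one. *)
Lemma symplectic_coordinates (Q : lmodType R) (b : Q -> Q -> R) N (x y : 'I_N -> Q) :
  alternating b ->
  exists (i : {linear Q -> 'rV[R]_(N.*2)}) (r : {linear 'rV[R]_(N.*2) -> Q}),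
    (forall z v, stdform (i z) v = b z (r v)) /\
    forall z, r (i z) = \sum_k (b z (y k) *: x k + b (x k) z *: y k).
Proof.
move=> ab; elim: N x y => [|N IH] x y.
  have iL : linear (fun _ : Q => 0 : 'rV[R]_(0.*2)).
    by move=> a z w; rewrite scaler0 addr0.
  have rL : linear (fun _ : 'rV[R]_(0.*2) => 0 : Q).
    by move=> a z w; rewrite scaler0 addr0.
  exists (lin_of iL), (lin_of rL); split=> [z v|z] /=; last by rewrite big_ord0.
  by rewrite (alt0r ab) (alt0l (stdform_alt R _)).
have [i [r [h1 h2]]] := IH (fun k => x (lift ord0 k)) (fun k => y (lift ord0 k)).
have pL : linear (fun z => (i z, b z (y ord0), b (x ord0) z) : ('rV[R]_(N.*2) * R^o * R^o)%type).
  move=> a z w; congr (_, _, _); rewrite /= ?linearP //.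
    by rewrite (altDl ab) (altZl ab).
  by rewrite (altDr ab) (altZr ab).
have qL : linear (fun v : ('rV[R]_(N.*2) * R^o * R^o)%type =>
    v.1.2 *: x ord0 + v.2 *: y ord0 + r v.1.1).
  move=> a v w /=; rewrite linearP !scalerDl !scalerDr !scalerA.
  by rewrite [X in X + _]addrACA [LHS]addrACA.
exists (front R N.*2 \o lin_of pL), (lin_of qL \o back R N.*2); split=> [z v|z].
  rewrite -{1}(backK v); set v' := back R _ v.
  rewrite [LHS]stdform_front /perp_psi2 [r in RHS]/= h1 !(altDr ab) !(altZr ab) /=.
  by rewrite (altC ab z (x ord0)); ring.
transitivity (lin_of qL (lin_of pL z)).
  by rewrite -[in RHS](frontK (lin_of pL z)).
by rewrite /= h2 [RHS]big_ord_recl.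
Qed.

Lemma plane_embedding (Q : lmodType R) (b : Q -> Q -> R) : symplectic_plane b ->
  exists N (i : {linear Q -> 'rV[R]_(N.+1.*2)}) (r : {linear 'rV[R]_(N.+1.*2) -> Q}),
    isometric_retract i r (@stdform R N.+1.*2) b.
Proof.
move=> pl; have ab := plane_alt pl; have [_ plk [N [x [y e1]]]] := pl.
have [i [r [h1 h2]]] := symplectic_coordinates x y ab; exists N, i, r; split=> //.
  move=> z; rewrite h2 -[RHS]scale1r -e1 scaler_suml.
  by apply: eq_bigr => k _; rewrite (plk (x k) (y k) z).
by move=> z v; rewrite (altC (stdform_alt R _)) h1 -(altC ab).
Qed.

Lemma tower_matrix (B : lmodType R) k :
  exists (u : {linear tower B k -> (B * 'rV[R]_(k.*2))%type})
         (rho : {linear (B * 'rV[R]_(k.*2))%type -> tower B k}),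
    [/\ cancel u rho, cancel rho u & forall (b : B -> B -> R) x y,
        b (u x).1 (u y).1 + stdform (u x).2 (u y).2 = @tower_form R B b k x y].
Proof.
elim: k => [|k [u [rho [ur ru uE]]]].
  have uL : linear (fun x : B => (x, 0) : (B * 'rV[R]_0.*2)%type).
    by move=> a x y; congr (_, _); rewrite /= scaler0 addr0.
  exists (lin_of uL), fst; split=> //.
    by move=> [x v]; congr (_, _); apply/rowP=> -[].
  by move=> b x y /=; rewrite (alt0l (stdform_alt R _)) addr0.
pose u1 (x : tower B k.+1) : (B * 'rV[R]_(k.+1.*2))%type :=
  ((u x.1.1).1, front R k.*2 ((u x.1.1).2, x.1.2, x.2)).
have uL : linear u1.
  move=> a x y; have uD : u (a *: x + y).1.1 = a *: u x.1.1 + u y.1.1.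
    by rewrite -linearP.
  rewrite /u1 uD; congr (_, _); rewrite -[RHS](linearP (front R k.*2)).
  by congr (front _ _ _); congr (_, _, _).
pose r1 (w : (B * 'rV[R]_(k.+1.*2))%type) : tower B k.+1 :=
  let v := back R k.*2 w.2 in (rho (w.1, v.1.1), v.1.2, v.2).
have rL : linear r1.
  move=> a x y; rewrite /r1 (linearP (back R k.*2)); congr (_, _, _).
  by rewrite -[RHS](linearP rho).
exists (lin_of uL), (lin_of rL); split.
- move=> x; rewrite /= /r1 /u1 frontK /= -surjective_pairing ur.
  by case: x => [[? ?] ?].
- move=> [x v]; rewrite /= /u1 /r1; case E : (back R _ v) => [[v' a] c].
  by rewrite /= ru /= -[in RHS](backK v) E.
- move=> b x y; rewrite /= stdform_front /perp_psi2 /= -uE.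
  by ring.
Qed.

End Embedding.

Section Absorb.
Variables (R : comPzRingType) (Q : lmodType R) (n : nat).
Variables (i : {linear Q -> 'rV[R]_n}) (r : {linear 'rV[R]_n -> Q}).
Variables (Psi : 'rV[R]_n -> 'rV[R]_n -> R) (om chi : Q -> Q -> R).
Hypotheses (aPsi : alternating Psi) (iso : isometric_retract i r Psi om).

(** The complement of [Q] in [R^n] is absorbed by adding another copy of [Q]:
    as [R^n (+) Q] is isomorphic to [Q (+) R^n], an isometry between forms on
    [R^n] that agree off [Q] becomes one between [chi _|_ Psi] and
    [om _|_ Psi]. *)
Lemma absorb_complement (A : {linear 'rV[R]_n -> 'rV[R]_n}) :
  embeddable Q -> has_det A 1 ->
  (forall v w, Psi (A v) (A w) = hat i r Psi chi v w) ->
  exists Phi : {linear (Q * 'rV[R]_n)%type -> (Q * 'rV[R]_n)%type},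
    has_det Phi 1 /\ forall x y,
      om (Phi x).1 (Phi y).1 + Psi (Phi x).2 (Phi y).2 =
      chi x.1 y.1 + Psi x.2 y.2.
Proof.
move=> eQ dA iA; have [ir h1 h2] := iso.
pose Qn := (Q * 'rV[R]_n)%type.
have uL : linear (fun v => (r v, v - i (r v)) : Qn).
  move=> a v w; congr (_, _); first by rewrite /= linearP.
  by rewrite /= (linearP r) (linearP i) scalerBr opprD addrACA.
pose u := lin_of uL.
pose rho : {linear Qn -> 'rV[R]_n} := (i \o fst) \+ ((idfun \- (i \o r)) \o snd).
pose cmp : {linear Qn -> 'rV[R]_n} := i \o r \o snd.
pose w := (u \o A \o rho).
have cL : linear (fun x : Qn => (0, cmp x) : Qn).
  by move=> a x y; congr (_, _); rewrite ?linearP //= scaler0 addr0.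
pose Phi : {linear Qn -> Qn} := (u \o A \o rho) \+ lin_of cL.
have eQn : embeddable Qn by apply: embeddable_prod => //; apply: embeddable_rV.
have urho v : rho (u v) = v.
  rewrite /= linearB /= ir subrr linear0 subr0; exact: subrKC.
have rr z : r (rho z) = z.1 by rewrite /= linearD linearB /= !ir subrr addr0.
have rk z : rho z - i (r (rho z)) = z.2 - i (r z.2) by rewrite rr /= addrC addKr.
exists Phi; split.
  apply: (has_det_stabilize (u := u) (rho := rho) eQn urho) dA => x.
  congr (_ + _); rewrite -[u (rho x)]/(r (rho x), rho x - i (r (rho x))) rk rr.
  by case: x => q v; congr (_, _); rewrite /= ?subrr // opprB addrC subrK.
move=> x y.
have E z : Phi z = (r (A (rho z)), A (rho z) - i (r (A (rho z))) + i (r z.2)).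
  by rewrite [LHS]surjective_pairing; congr (_, _); rewrite /= addr0.
rewrite !E /=.
have o1 v q : Psi (v - i (r v)) (i q) = 0.
  by rewrite h2 linearB /= ir subrr; have := h2 q 0;
     rewrite (alt0l aPsi) linear0 => <-.
have o2 v q : Psi (i q) (v - i (r v)) = 0 by rewrite (altC aPsi) o1 oppr0.
have o3 v q v' q' : Psi (v - i (r v) + i q) (v' - i (r v') + i q') =
    Psi (v - i (r v)) (v' - i (r v')) + Psi (i q) (i q').
  have := o1 v q'; have := o2 v' q; move: (v - _) (v' - _) => X Y hY hX.
  by rewrite (altDl aPsi) !(altDr aPsi) hX hY addr0 add0r.
rewrite o3 addrA.
rewrite -[om _ _ + _]/(hat i r Psi om (A (rho x)) (A (rho y))) (hat_retract aPsi iso) iA /hat.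
rewrite !rk !rr -addrA; congr (_ + _).
rewrite (altBl aPsi) !(altBr aPsi) !h1 !h2 !ir; ring.
Qed.

End Absorb.

(** * The relative Pfaffian as an invariant of matrices *)

Section HatExtension.
Variables (R : comPzRingType) (P : lmodType R) (n : nat).
Variables (i : {linear P -> 'rV[R]_n}) (r : {linear 'rV[R]_n -> P}).
Hypothesis ir : cancel i r.

(** [ext_mx] moves only the component in [P], and [hat] treats the component in
    [P] and the one in the complement separately. *)
Lemma hat_ext_mx (Psi : 'rV[R]_n -> 'rV[R]_n -> R) (chi : P -> P -> R)
    (phi : {linear P -> P}) v w :
  hat i r Psi chi (v *m ext_mx i r phi) (w *m ext_mx i r phi) =
  hat i r Psi (fun x y => chi (phi x) (phi y)) v w.
Proof.
have rE u : r (u *m ext_mx i r phi) = phi (r u).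
  by rewrite ext_mxE linearD linearB /= !ir subrr addr0.
have kE u : u *m ext_mx i r phi - i (phi (r u)) = u - i (r u).
  by rewrite ext_mxE addrC addKr.
by rewrite /hat !rE !kE.
Qed.

Lemma pfl_hat_ext (Psi : 'rV[R]_n -> 'rV[R]_n -> R) (chi : P -> P -> R)
    (phi : {linear P -> P}) d k :
  alternating Psi -> alternating chi -> has_det phi d ->
  pfl (hat i r Psi (fun x y => chi (phi x) (phi y))) k
    [seq delta_mx 0 j | j <- enum 'I_n] =
  d * pfl (hat i r Psi chi) k [seq delta_mx 0 j | j <- enum 'I_n].
Proof.
move=> aP ac hd; have ah := hat_alt i r aP ac.
rewrite -(eq_pfl _ _ (hat_ext_mx Psi chi phi)).
rewrite -(pfl_map (hat i r Psi chi) (fun v => v *m ext_mx i r phi)) -map_comp.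
rewrite -(has_detE ir hd) -(alternating_det _ _ (pfl_additive ah k) (pfl_alternating ah k)).
congr pfl; apply: eq_map => j /=.
by rewrite [LHS]row_sum_delta; apply: eq_bigr => l _; rewrite -rowE mxE.
Qed.

End HatExtension.

Section RelativePfaffian.
Variables (R : comPzRingType) (P0 : lmodType R) (chi0 : P0 -> P0 -> R).
Hypothesis pl : symplectic_plane chi0.
Variables (N : nat) (i : {linear P0 -> 'rV[R]_(N.*2)}) (r : {linear 'rV[R]_(N.*2) -> P0}).
Hypothesis iso : isometric_retract i r (@stdform R N.*2) chi0.

Local Notation P4 := (P0 * R^o * R^o)%type.
Let std := @stdform R N.*2.
Let s : seq 'rV[R]_(N.*2) := [seq delta_mx 0 j | j <- enum 'I_(N.*2)].
Let a0 := plane_alt pl.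
Let om0 := perp_psi2 chi0.
Let aom0 : alternating om0 := perp_psi2_alt a0.

Definition emb4 : {linear P4 -> 'rV[R]_(N.+1.*2)} := front R N.*2 \o i4 i.
Definition ret4 : {linear 'rV[R]_(N.+1.*2) -> P4} := r4 r \o back R N.*2.

Lemma emb4_iso : isometric_retract emb4 ret4 (@stdform R N.+1.*2) om0.
Proof.
have [ir h1 h2] := iso4 iso; split=> [z|z v|z v].
- by rewrite [LHS](congr1 (r4 r) (frontK (i4 i z))) ir.
- by rewrite -[in LHS](backK v) [LHS]stdform_front h1.
- by rewrite -[in LHS](backK v) [LHS]stdform_front h2.
Qed.

Definition form_mx (chi : P4 -> P4 -> R) : 'M[R]_(N.+1.*2) :=
  gram (hat emb4 ret4 (@stdform R N.+1.*2) chi).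

Lemma pf_form_mx chi : pf (form_mx chi) = relative_pf std i r N s chi.
Proof.
rewrite pf_gram /relative_pf -[in LHS](front_list R N.*2) pfl_map.
apply: eq_pfl => x y; rewrite /hat.
have rE z : ret4 (front R N.*2 z) = r4 r z.
  exact: (congr1 (r4 r) (frontK z)).
rewrite !rE; congr (_ + _).
have kE z : front R N.*2 z - emb4 (r4 r z) = front R N.*2 (z - i4 i (r4 r z)).
  by rewrite linearB.
by rewrite !kE stdform_front.
Qed.

Lemma pf_form_mx_has_pf chi kappa : alternating chi -> has_pf chi0 chi kappa ->
  pf (form_mx chi) = kappa.
Proof.
move=> ac hk; rewrite pf_form_mx.
exact: (relative_pfE pl (stdform_alt R _) iso (@rV_span R _) (pfl_stdform R N) ac hk).
Qed.

Lemma pf_form_mx_comp chi (phi : {linear P4 -> P4}) d : alternating chi ->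
  has_det phi d -> pf (form_mx (fun x y => chi (phi x) (phi y))) = d * pf (form_mx chi).
Proof.
move=> ac hd; rewrite !pf_gram; have [ir _ _] := emb4_iso.
by apply: (pfl_hat_ext ir); rewrite ?hd //; apply: stdform_alt.
Qed.

Lemma pf_form_mx_eq chi chi' : (forall x y, chi x y = chi' x y) ->
  pf (form_mx chi) = pf (form_mx chi').
Proof. by move=> e; rewrite !pf_gram; apply: eq_pfl => x y; rewrite /hat e. Qed.

Lemma has_pf_perp c : has_pf chi0 (perp_psi2 (fun x y => c * chi0 x y)) c.
Proof. by move=> x y; rewrite /perp_psi2 /= !(alt0r a0); ring. Qed.

Lemma scale_alt c : alternating (fun x y => c * chi0 x y).
Proof.
split=> [a x y z|a x y z|x]; rewrite ?(altDl a0) ?(altDr a0) ?(altZl a0) ?(altZr a0).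
- by rewrite /GRing.scale /=; ring.
- by rewrite /GRing.scale /=; ring.
- by rewrite (altxx a0) mulr0.
Qed.

Lemma pf_om0 : pf (form_mx om0) = 1.
Proof.
rewrite (pf_form_mx_eq (chi' := perp_psi2 (fun x y => 1 * chi0 x y))).
  apply: pf_form_mx_has_pf (has_pf_perp 1).
  exact: perp_psi2_alt (scale_alt 1).
by move=> x y; rewrite /om0 /perp_psi2 mul1r.
Qed.

(** The Pfaffian of [om0] is 1, and pulling back along [phi] multiplies it by
    the determinant of [phi]. *)
Lemma Sp_has_det1 (phi : {linear P4 -> P4}) :
  (forall x y, om0 (phi x) (phi y) = om0 x y) -> has_det phi 1.
Proof.
move=> iphi; have eP : embeddable P4.
  by exists N.+1.*2, emb4, ret4; case: emb4_iso.
have [d hd] := has_det_ex phi eP.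
have := pf_form_mx_comp aom0 hd; rewrite (pf_form_mx_eq iphi) pf_om0 mulr1.
by move=> ->.
Qed.

Lemma pfl_hat_scale c :
  pfl (hat i r std (fun x y => c * chi0 x y)) N s = c.
Proof.
have ac := scale_alt c; have ah := hat_alt i r (stdform_alt R _) ac.
rewrite -(plane_list_pfl _ _ ah) -[RHS](pf_form_mx_has_pf (perp_psi2_alt ac) (has_pf_perp c)).
rewrite pf_form_mx; apply: eq_pfl => x y.
rewrite /hat /perp_psi2 /= /r4_fun /i4_fun /= !subrr.
by rewrite addr0 addrAC.
Qed.

End RelativePfaffian.

(** * From transitivity to symplectic orbits and to [W_SL] *)

Section DirectSums.
Variable R : comPzRingType.

Lemma enum_rV_split m n :
  [seq delta_mx 0 j | j <- enum 'I_(m + n)] =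
  [seq row_mx v 0 | v <- [seq delta_mx 0 j | j <- enum 'I_m]] ++
  [seq row_mx 0 v | v <- [seq delta_mx 0 j | j <- enum 'I_n]] :> seq 'rV[R]_(m + n).
Proof.
have E k : [seq delta_mx 0 j | j <- enum 'I_k] =
    [seq (\row_(j < k) ((j : nat) == l)%:R : 'rV[R]_k) | l <- iota 0 k].
  rewrite -val_enum_ord -[RHS]map_comp; apply: eq_map => j; apply/rowP=> l.
  by rewrite !mxE eqxx -val_eqE.
rewrite !E iotaD map_cat add0n -!map_comp; congr (_ ++ _).
  apply/eq_in_map => l; rewrite mem_iota add0n => /= lt; apply/rowP=> j.
  rewrite !mxE; case: splitP => k ->; rewrite !mxE //.
  by case: eqP => // e1; rewrite -e1 ltnNge leq_addr in lt.
have -> : iota m n = [seq (m + l)%N | l <- iota 0 n] by rewrite -iotaDl addn0.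
rewrite -map_comp; apply: eq_map => l /=; apply/rowP=> j.
rewrite !mxE; case: splitP => k ->; rewrite !mxE.
  by case: eqP => // e1; have := ltn_ord k; rewrite e1 ltnNge leq_addr.
by rewrite eqn_add2l.
Qed.

Lemma pfl_orthogonal_sum m n (b1 : 'rV[R]_(m.*2) -> 'rV[R]_(m.*2) -> R)
    (b2 : 'rV[R]_(n.*2) -> 'rV[R]_(n.*2) -> R) : alternating b1 -> alternating b2 ->
  pfl (fun v w => b1 (lsubmx v) (lsubmx w) + b2 (rsubmx v) (rsubmx w)) (m + n)
    [seq delta_mx 0 j | j <- enum 'I_(m.*2 + n.*2)] =
  pfl b1 m [seq delta_mx 0 j | j <- enum 'I_(m.*2)] *
  pfl b2 n [seq delta_mx 0 j | j <- enum 'I_(n.*2)].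
Proof.
move=> a1 a2; rewrite enum_rV_split pfl_cat; last first.
- elim: [seq delta_mx _ _ | _ <- _] => [//|v s IH] /=; split=> //.
  apply: all_orth_map => w.
  by rewrite !row_mxKl !row_mxKr (alt0r a1) (alt0l a2) addr0.
- by rewrite 2!size_map size_enum_ord.
rewrite !pfl_map; congr (_ * _); apply: eq_pfl => v w.
  by rewrite !row_mxKl !row_mxKr (alt0l a2) addr0.
by rewrite !row_mxKl !row_mxKr (alt0l a1) add0r.
Qed.

Lemma pfl_mform n (M : 'M[R]_(n.*2)) :
  pfl (mform M) n [seq delta_mx 0 j | j <- enum 'I_(n.*2)] = pf M.
Proof. by rewrite -pf_gram gram_mform. Qed.

Lemma mform_perfect n (M : 'M[R]_n) : invertible_mx M -> perfect (mform M).
Proof.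
move=> [N [_ NM]] f; exists (\row_j f (delta_mx 0 j) *m N) => x.
rewrite /mform -[_ *m N *m M]mulmxA NM mulmx1 {1}(row_sum_delta x) linear_sum mxE.
by apply: eq_bigr => j _; rewrite linearZ !mxE mulrC.
Qed.

Lemma perfect_invertible n (b : 'rV[R]_n -> 'rV[R]_n -> R) :
  alternating b -> perfect b -> invertible_mx (gram b).
Proof.
move=> ab pb.
have cL j : linear (fun v : 'rV[R]_n => v 0 j : R^o).
  by move=> a x y; rewrite !mxE.
have [y yP] := choice (fun j => pb (lin_of (cL j))).
pose N : 'M[R]_n := \matrix_j y j.
have NM : N *m gram b = 1%:M.
  apply/matrixP=> j k; rewrite [RHS]mxE.
  have := yP j (delta_mx 0 k); rewrite /= mxE eqxx /= => ->.
  rewrite (gram_mul _ _ ab) trmx_delta -colE !mxE.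
  by apply: eq_bigr => l _; rewrite !mxE.
by exists N; split=> //; apply: mulmx1C.
Qed.

End DirectSums.

Section Plane.
Variables (R : comPzRingType) (P0 : lmodType R) (chi0 : P0 -> P0 -> R).
Hypotheses (noeth : noetherian R) (dim4 : krull_dim_le R 4).
Hypothesis pl : symplectic_plane chi0.
Hypothesis univ : forall K : P0 -> P0 -> R, alternating K ->
  exists c, forall x y, K x y = c * chi0 x y.

Local Notation P3 := (P0 * R^o)%type.
Local Notation P4 := (P0 * R^o * R^o)%type.
Local Notation P5 := (P0 * R^o * R^o * R^o)%type.
Let a0 := plane_alt pl.
Let om0 : P4 -> P4 -> R := perp_psi2 chi0.
Let aom0 : alternating om0 := perp_psi2_alt a0.
Let p0 := plane_perfect pl.

Lemma plane_embeddable : embeddable P0.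
Proof.
by have [N [i [r [ir _ _]]]] := plane_embedding pl; exists N.+1.*2, i, r.
Qed.

Let gp0 : general_position P0 2 :=
  general_position_rank2 noeth a0 p0 (plane_nonzero pl).

(** The tower has rank [2 + k.*2], which exceeds the bound 4 on the dimension
    once [k] is at least 2. *)
Lemma tower_stable_range k : (2 <= k)%N -> stable_range (tower P0 k).
Proof.
move=> le; have gpk := tower_general_position (k := k) noeth gp0.
have lt : (4 < 2 + k.*2)%N by rewrite add2n !ltnS ltnW // (leq_double 2).
exact: (stable_range_of_general_position noeth dim4 lt gpk).
Qed.

Lemma tower4_stable_range k : stable_range (tower P4 k * R^o)%type.
Proof.
apply: (stable_range_of_general_position noeth dim4 (n := (4 + k.*2).+1)) => //.
apply: general_position_free => //; apply: tower_general_position => //.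
exact: (tower_general_position (k := 1) noeth gp0).
Qed.

Lemma tower_rectifiable k : rectifiable P0 -> SL_transitive_on_Um P5 ->
  rectifiable (tower P0 k).
Proof.
move=> rec0 tr5; case: k => [//|[|k]]; first exact: rectifiable_of_transitive.
apply: (rectifiable_of_stable_range (b := @tower_form R P0 chi0 k.+2)).
- exact/tower_embeddable/plane_embeddable.
- exact: tower_alt.
- exact: tower_perfect.
- exact: tower_stable_range.
Qed.

Lemma rectifiable_of_trivial : Um_orbit_space_trivial P3 -> rectifiable P0.
Proof.
move=> [a1 [ua1 tr]]; apply: rectifiable_of_transitive => a b ua ub.
have [phi [[_ dphi] ephi]] := tr a ua.
have [psi [[_ dpsi] epsi]] := tr b ub.
have [phi' [c1 c2 dphi']] := has_det1_inv dphi.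
exists (phi' \o psi); split.
  by apply: is_SL_det; have := has_det_comp dphi' dpsi; rewrite mulr1.
by move=> x; rewrite ephi /= c2 epsi.
Qed.

Section Forward.
Hypothesis rec0 : rectifiable P0.

(** An automorphism of determinant one pulls [om0] back to a form which can be
    split while fixing the last vector; the splitting is [c chi0 _|_ psi_2],
    and Pfaffians give [c = 1]. *)
Lemma SL_orbit_sub_Sp y : SL_orbit (vec4 P0) y -> Sp_orbit om0 (vec4 P0) y.
Proof.
move=> [phi [[_ dphi] <-]]; have eP := plane_embeddable.
have [N [i [r iso]]] := plane_embedding pl.
have pom0 : perfect om0 by apply/perfect_perp.
have aphi := alternating_pull phi aom0.
have [Phi [K [dPhi Phi4 aK _ iPhi]]] :=
  split_hyperbolic eP rec0 aphi (perfect_pull dphi pom0).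
have [c cE] := univ aK.
have dc : has_det (phi \o Phi) 1 by have := has_det_comp dphi dPhi; rewrite mulr1.
have c1 : c = 1.
  rewrite -(pf_form_mx_has_pf pl iso (perp_psi2_alt (scale_alt pl c)) (has_pf_perp pl c)).
  rewrite -(pf_om0 pl iso) -[RHS]mul1r -(pf_form_mx_comp iso aom0 dc).
  by apply: pf_form_mx_eq => x z; rewrite [RHS]iPhi /perp_psi2 cE.
exists (phi \o Phi); split; last by rewrite /= Phi4.
split; first by case: (is_SL_det dc).
by move=> x z; rewrite [LHS]iPhi /perp_psi2 cE c1 mul1r.
Qed.

End Forward.

Lemma Sp_orbit_sub_SL y : Sp_orbit om0 (vec4 P0) y -> SL_orbit (vec4 P0) y.
Proof.
have [N [i [r iso]]] := plane_embedding pl.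
move=> [phi [[bij iphi] <-]]; exists phi; split=> //; split=> //.
exact: (Sp_has_det1 pl iso iphi).
Qed.

(** The form [chi0 _|_ M] on [P0 (+) R^2n] is split completely, into
    [c chi0 _|_ psi_2n]; comparing Pfaffians after adding the complement of
    [P0] gives [c = Pf M = 1], and the complement makes the isometry one of
    matrices. *)
Lemma WSL_trivial_of_rectifiable : rectifiable P0 -> SL_transitive_on_Um P5 ->
  WSL_trivial R.
Proof.
move=> rec0 tr5 n M [aM iM] pfM.
have [N [i [r iso]]] := plane_embedding pl; have [ir h1 h2] := iso.
have eP := plane_embeddable.
have aMf := mform_alt aM; have pMf := mform_perfect iM.
have [u [rho [ur ru uE]]] := tower_matrix P0 n.
pose om x y := chi0 (u x).1 (u y).1 + mform M (u x).2 (u y).2.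
pose PM := (P0 * 'rV[R]_(n.*2))%type.
pose bM (x y : PM) := chi0 x.1 y.1 + mform M x.2 y.2.
have abM : alternating bM.
  split=> [a x y z|a x y z|x]; rewrite /bM /=.
  - by rewrite (altDl a0) (altDl aMf) (altZl a0) (altZl aMf) /GRing.scale /=; ring.
  - by rewrite (altDr a0) (altDr aMf) (altZr a0) (altZr aMf) /GRing.scale /=; ring.
  - by rewrite (altxx a0) (altxx aMf) addr0.
have aom : alternating om := alternating_pull u abM.
have pom : perfect om.
  move=> f; have lL : linear (fun x : P0 => (x, 0) : PM).
    by move=> a x y; congr (_, _); rewrite /= scaler0 addr0.
  have rL : linear (fun v : 'rV[R]_(n.*2) => (0, v) : PM).
    by move=> a x y; congr (_, _); rewrite /= scaler0 addr0.
  have [y yP] := p0 (f \o rho \o lin_of lL).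
  have [w wP] := pMf (f \o rho \o lin_of rL).
  exists (rho (y, w)) => x; rewrite /om ru /= -yP -wP /= -!linearD -[in LHS](ur x).
  by congr (f (rho _)); case: (u x) => p v; congr (_, _); rewrite /= ?addr0 ?add0r.
have rec k := tower_rectifiable (k := k) rec0 tr5.
have [Phi [K [dPhi aK iPhi]]] := tower_split eP rec aom pom.
have [c cE] := univ aK.
have ePM : embeddable PM by apply: embeddable_prod => //; apply: embeddable_rV.
pose Psi : {linear PM -> PM} := u \o Phi \o rho.
have dPsi : has_det Psi 1 by apply: (has_det_conj (u := u) (rho := rho) ePM).
have iPsi x y : bM (Psi x) (Psi y) = c * chi0 x.1 y.1 + stdform x.2 y.2.
  rewrite -[LHS]/(om (Phi (rho x)) (Phi (rho y))) iPhi -uE !ru cE; ring.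
have jL : linear (fun x : PM => row_mx x.2 (i x.1)).
  by move=> a x y; rewrite scale_row_mx add_row_mx /= (linearP i).
have qL : linear (fun v : 'rV[R]_(n.*2 + N.+1.*2) => (r (rsubmx v), lsubmx v) : PM).
  by move=> a x y; rewrite !linearP.
pose j := lin_of jL; pose q := lin_of qL.
have jq : cancel j q by move=> [x v]; rewrite /= row_mxKl row_mxKr ir.
pose bT v w := mform (perp M (psimx R N.+1.*2)) v w.
have bTE v w : bT v w = mform M (lsubmx v) (lsubmx w) + stdform (rsubmx v) (rsubmx w).
  exact: mform_perp.
have aT : alternating bT.
  apply: mform_alt; case: aM => MT M0; split; last first.
    move=> k; rewrite /perp -[k]splitK /unsplit; case: (split k) => l.
      by rewrite block_mxEul M0.
    by rewrite block_mxEdr mxE /psi_entry subrr.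
  by rewrite /perp tr_block_mx !trmx0 MT (psimx_alt R _).1 opp_block_mx !oppr0.
have isoT : isometric_retract j q bT bM.
  split=> // [z v|z v]; rewrite bTE /= row_mxKl row_mxKr /bM /= ?h1 ?h2; exact: addrC.
have aS := stdform_alt R (n.*2).
pose bc (x y : PM) := c * chi0 x.1 y.1 + stdform x.2 y.2.
have EF v w : bT (v *m ext_mx j q Psi) (w *m ext_mx j q Psi) =
    stdform (lsubmx v) (lsubmx w) +
    hat i r (@stdform R N.+1.*2) (fun x y => c * chi0 x y) (rsubmx v) (rsubmx w).
  rewrite -(hat_retract aT isoT) hat_ext_mx // /hat iPsi bTE /=.
  have kl z : lsubmx (z - row_mx (lsubmx z) (i (r (rsubmx z)))) = 0.
    by rewrite linearB /= row_mxKl subrr.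
  have kr z : rsubmx (z - row_mx (lsubmx z) (i (r (rsubmx z)))) =
      rsubmx z - i (r (rsubmx z)).
    by rewrite linearB /= row_mxKr.
  by rewrite !kl !kr (alt0l aMf); ring.
have ah := hat_alt i r (stdform_alt R _) (scale_alt pl c).
have aN : alternating (@stdform R N.+1.*2) := stdform_alt R _.
have dF : \det (ext_mx j q Psi) = 1 by apply: has_detE.
pose F := ext_mx j q Psi.
have c1 : c = 1.
  pose L : seq 'rV[R]_(n.*2 + N.+1.*2) := [seq delta_mx 0 k | k <- enum 'I_(n.*2 + N.+1.*2)].
  have pT : pfl bT (n + N.+1) L = 1.
    by rewrite (eq_pfl _ _ bTE) (pfl_orthogonal_sum aMf aN) pfl_mform pfM pfl_stdform mul1r.
  have := alternating_det (fun k => delta_mx 0 k) F (pfl_additive aT (n + N.+1))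
    (pfl_alternating aT (n + N.+1)).
  rewrite dF mul1r pT => <-.
  have := pfl_orthogonal_sum aS ah.
  rewrite pfl_stdform mul1r (pfl_hat_scale pl iso) => <-.
  rewrite -(eq_pfl _ _ EF) -(pfl_map bT (fun v => v *m F)) -map_comp.
  congr pfl; apply: eq_map => k /=.
  by rewrite [LHS]row_sum_delta; apply: eq_bigr => l _; rewrite -rowE mxE.
have mxF : F *m perp M (psimx R N.+1.*2) *m F^T = psimx R (n.*2 + N.+1.*2).
  rewrite -[LHS]gram_mform -[RHS]gram_mform; apply/matrixP=> k l; rewrite !mxE.
  have mE v w : mform (F *m perp M (psimx R N.+1.*2) *m F^T) v w =
      bT (v *m F) (w *m F).
    by rewrite /bT /mform trmx_mul !mulmxA.
  rewrite mE EF -(psimx_perp R _ (negbT (odd_double n))) mform_perp; congr (_ + _).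
  by rewrite -[RHS](hat_retract aN iso); rewrite /hat c1 mul1r.
pose G := \adj F.
have GF : G *m F = 1%:M by rewrite mul_adj_mx dF.
have FG : F *m G = 1%:M by rewrite mul_mx_adj dF.
(* The summand psi_(2N+2) used for stabilization is psi_(2(1+s)) for s = N. *)
exists N, G^T; split.
  by rewrite det_tr -[LHS]mul1r -dF -det_mulmx FG det1.
rewrite trmxK !psiE psimx_perp ?odd_double // castmx_psimx.
rewrite -[in RHS]mxF !mulmxA GF mul1mx -mulmxA -trmx_mul GF trmx1 mulmx1.
by [].
Qed.

End Plane.

(** * From [W_SL] and symplectic orbits to transitivity *)

Section PerfectHat.
Variable R : comPzRingType.

Lemma stdform_perfect n : perfect (@stdform R n.*2).
Proof.
elim: n => [|n IH] f.
  by exists 0 => x; rewrite (_ : x = 0) ?linear0 ?(alt0r (stdform_alt R _)) //;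
    apply/rowP=> -[].
have pp := (perfect_perp (stdform_alt R n.*2)).2 IH.
have [y yP] := pp (f \o front R n.*2); exists (front R n.*2 y) => x.
by rewrite -{2}(backK x) [RHS]stdform_front -yP [RHS]/= -[RHS]/(f (front R _ _)) backK.
Qed.

Lemma hat_perfect (P V : lmodType R) (i : {linear P -> V}) (r : {linear V -> P})
    (Psi : V -> V -> R) (om chi : P -> P -> R) :
  alternating Psi -> isometric_retract i r Psi om -> perfect Psi -> perfect chi ->
  perfect (hat i r Psi chi).
Proof.
move=> aP [ir h1 h2] pP pc f.
have [y yP] := pc (f \o i); have [z zP] := pP f.
exists (i y + (z - i (r z))) => x.
have rE : r (i y + (z - i (r z))) = y by rewrite linearD linearB /= !ir subrr addr0.
rewrite /hat rE [i y + _]addrC addrK -yP /= (altBl aP) -zP h1.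
rewrite linearB /= linearB /= ir subrr.
have -> : om (r z) 0 = 0 by rewrite -(linear0 r) -h1 (alt0r aP).
by rewrite subr0 addrC subrK.
Qed.

Lemma has_det_mulmxr n (E : 'M[R]_n) :
  has_det (mulmxr E : {linear 'rV[R]_n -> 'rV[R]_n}) (\det E).
Proof.
exists n, idfun, idfun; split=> //; congr (\det _).
by apply/row_matrixP=> l; rewrite rowE [RHS]rowE ext_mxE /= subrr addr0.
Qed.

Lemma tower_of_matrix (B : lmodType R) (om chi : B -> B -> R) m k : m = k.*2 ->
  embeddable B ->
  (exists Phi : {linear (B * 'rV[R]_m)%type -> (B * 'rV[R]_m)%type},
    has_det Phi 1 /\ forall x y,
      om (Phi x).1 (Phi y).1 + stdform (Phi x).2 (Phi y).2 =
      chi x.1 y.1 + stdform x.2 y.2) ->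
  exists Phi : {linear tower B k -> tower B k}, has_det Phi 1 /\
    forall x y, tower_form om (Phi x) (Phi y) = tower_form chi x y.
Proof.
move=> -> {m} eB [Phi [dPhi iPhi]].
have [u [rho [ur ru uE]]] := tower_matrix B k.
exists (rho \o Phi \o u); split.
  exact: (has_det_conj (u := rho) (rho := u) (tower_embeddable eB k) ru ur _ dPhi).
by move=> x y; rewrite -uE /= !ru iPhi uE.
Qed.

End PerfectHat.

Section SectionForm.
Variables (R : comPzRingType) (P0 : lmodType R) (chi0 : P0 -> P0 -> R).
Hypothesis pl : symplectic_plane chi0.
Variables (a : {linear (P0 * R^o)%type -> R^o}) (sec : (P0 * R^o)%type).
Hypothesis a_sec : a sec = 1.

Local Notation P4 := (P0 * R^o * R^o)%type.
Let a0 := plane_alt pl.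

(** The alternating form on [P0 (+) R e3 (+) R e4] attached to a unimodular
    functional [a] and a section of it: pairing with [e4] gives [a], and the
    restriction to [P0 (+) R e3] is interior multiplication of the volume form
    by the section. *)
Definition section_form (x y : P4) : R :=
  sec.2 * chi0 x.1.1 y.1.1 - y.1.2 * chi0 x.1.1 sec.1 + x.1.2 * chi0 y.1.1 sec.1
  + a x.1 * y.2 - a y.1 * x.2.

Lemma section_form_alt : alternating section_form.
Proof.
split=> [c x y z|c x y z|x]; rewrite /section_form.
- rewrite (linearP a c x.1 y.1 : a (c *: x + y).1 = _) /=.
  by rewrite !(altDl a0) !(altZl a0) /GRing.scale /=; ring.
- rewrite (linearP a c x.1 y.1 : a (c *: x + y).1 = _) /=.
  by rewrite !(altDl a0) !(altDr a0) !(altZl a0) !(altZr a0) /GRing.scale /=; ring.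
- by rewrite (altxx a0); ring.
Qed.

Let d := a (0, 1).
Let aE p t : a (p, t) = a (inl1 P0 p) + t * d.
Proof. by rewrite (pair_split (p, t)) linearD linearZ. Qed.

Let plk_lin (f : {linear P0 -> R^o}) x y z :
  chi0 x y * f z = chi0 z y * f x + chi0 x z * f y.
Proof.
by case: pl => _ plk _; have := congr1 f (plk x y z); rewrite linearD !linearZ.
Qed.

Let e1 : a (inl1 P0 sec.1) + sec.2 * d = 1.
Proof. by rewrite -aE -[RHS]a_sec -surjective_pairing. Qed.

Lemma section_form_pf : has_pf chi0 section_form 1.
Proof.
move=> x y; rewrite /section_form /=.
have e2 : chi0 x y * a (inl1 P0 sec.1) = chi0 sec.1 y * a (inl1 P0 x) +
    chi0 x sec.1 * a (inl1 P0 y) := plk_lin (a \o inl1 P0) x y sec.1.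
have -> : 1 * chi0 x y = chi0 sec.1 y * a (inl1 P0 x) +
    chi0 x sec.1 * a (inl1 P0 y) + sec.2 * d * chi0 x y.
  by rewrite -e2 -{1}e1; ring.
rewrite -/d -[a (x, 0)]/(a (inl1 P0 x)) -[a (y, 0)]/(a (inl1 P0 y)).
rewrite [a (0, 0)](linear0 a) (altC a0 y sec.1) !(alt0l a0) !(alt0r a0).
by ring.
Qed.

(** The inverse of the Gram matrix of the section form, written out. *)
Lemma section_form_perfect : perfect section_form.
Proof.
move=> f; have [v vP] := plane_perfect pl (a \o inl1 P0).
have [w wP] := plane_perfect pl (f \o inl1 _ \o inl1 P0).
pose f3 := f (vec3 P0); pose f4 := f (vec4 P0);
exists (d *: w + f4 *: sec.1 - f3 *: v, sec.2 * f4 - chi0 v w,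
  - chi0 w sec.1 - sec.2 * f3) => x.
have fE : f x = chi0 w x.1.1 + x.1.2 * f3 + x.2 * f4.
  rewrite {1}(pair_split x) linearD linearZ {1}(pair_split x.1) !linearD !linearZ /=.
  by rewrite -wP.
have aE' p t : a (p, t) = chi0 v p + t * d by rewrite aE -vP.
have e1' : chi0 v sec.1 + sec.2 * d = 1 by rewrite -vP.
have e2 : chi0 v sec.1 * chi0 w x.1.1 =
    chi0 w sec.1 * chi0 v x.1.1 + chi0 v w * chi0 sec.1 x.1.1.
  exact: (plk_lin (lin_of (alt_linl a0 x.1.1)) v sec.1 w).
rewrite /section_form /= (surjective_pairing x.1) aE' aE' fE -[LHS]mul1r -e1'.
rewrite !(altBl a0) !(altDl a0) !(altBr a0) !(altDr a0) !(altZl a0) !(altZr a0).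
rewrite (altxx a0) (altxx a0) (altC a0 sec.1 x.1.1).
rewrite mulrDl !mulrDr e2 (altC a0 x.1.1 sec.1).
by ring.
Qed.

Lemma section_form4 x : section_form x (vec4 P0) = a x.1.
Proof.
rewrite /section_form /= (alt0r a0) (alt0l a0).
by rewrite (linear0 a : a (0, 0) = 0); ring.
Qed.

End SectionForm.

Section Backward.
Variables (R : comPzRingType) (P0 : lmodType R) (chi0 : P0 -> P0 -> R).
Hypotheses (noeth : noetherian R) (dim4 : krull_dim_le R 4).
Hypothesis pl : symplectic_plane chi0.

Local Notation P4 := (P0 * R^o * R^o)%type.
Let a0 := plane_alt pl.
Let om0 : P4 -> P4 -> R := perp_psi2 chi0.
Let aom0 : alternating om0 := perp_psi2_alt a0.

(** Adding the complement of [P4] in a free module turns [chi] into a matrix of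
    Pfaffian one, which is stably equivalent to a standard one.  Absorbing the
    complement turns this equivalence into an isometry between sums of [chi]
    and of [om0] with hyperbolic planes, and the planes are cancelled one by
    one. *)
Lemma isometric_of_WSL_trivial (chi : P4 -> P4 -> R) : WSL_trivial R ->
  alternating chi -> perfect chi -> has_pf chi0 chi 1 ->
  exists g : {linear P4 -> P4}, has_det g 1 /\
    forall x y, om0 (g x) (g y) = chi x y.
Proof.
move=> wsl ac pc hpf; have [N [i [r iso]]] := plane_embedding pl.
have iso4 := emb4_iso iso; set I := emb4 i in iso4; set J := ret4 r in iso4.
have aS := stdform_alt R N.+2.*2.
have ah := hat_alt I J aS ac.
pose M := form_mx i r chi.
have inA : in_A M.
  split; first exact: gram_alternating.
  apply: (perfect_invertible ah).
  exact: (hat_perfect aS iso4 (@stdform_perfect R N.+2) pc).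
have pfM : pf M = 1 := pf_form_mx_has_pf pl iso ac hpf.
have [s [E [dE]]] := wsl N.+2 M inA pfM.
rewrite !psiE psimx_perp ?odd_double // castmx_psimx => hE.
set m := (N.+2.*2 + (1 + s).*2)%N in E dE hE.
pose A : {linear 'rV[R]_m -> 'rV[R]_m} := mulmxr E^T.
have dA : has_det A 1 by have := has_det_mulmxr E^T; rewrite det_tr dE.
have aT := stdform_alt R m.
have iL : linear (fun x : P4 => row_mx (I x) 0 : 'rV[R]_m).
  by move=> c x y; rewrite (linearP I) scale_row_mx add_row_mx scaler0 addr0.
have rL : linear (fun v : 'rV[R]_m => J (lsubmx v)).
  by move=> c x y; rewrite !linearP.
have stdE v w : @stdform R m v w =
    stdform (lsubmx v) (lsubmx w) + stdform (rsubmx v) (rsubmx w).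
  by rewrite -mform_perp psimx_perp ?odd_double.
have isoT : isometric_retract (lin_of iL) (lin_of rL) (@stdform R m) om0.
  have [IJ h1 h2] := iso4; split=> [z|z v|z v].
  - by rewrite [LHS](congr1 J (row_mxKl _ _)) IJ.
  - rewrite stdE [lsubmx (lin_of iL z)]row_mxKl [rsubmx (lin_of iL z)]row_mxKr.
    by rewrite h1 (alt0l (stdform_alt R _)) addr0.
  - rewrite stdE [lsubmx (lin_of iL z)]row_mxKl [rsubmx (lin_of iL z)]row_mxKr.
    by rewrite h2 (alt0r (stdform_alt R _)) addr0.
have iA v w : stdform (A v) (A w) = hat (lin_of iL) (lin_of rL) (@stdform R m) chi v w.
  have -> : stdform (A v) (A w) = mform (perp M (psimx R (1 + s).*2)) v w.
    by rewrite hE /stdform /mform /= trmx_mul trmxK !mulmxA.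
  have kl z : lsubmx (z - lin_of iL (lin_of rL z)) = lsubmx z - I (J (lsubmx z)).
    by rewrite linearB /=; congr (_ - _); apply: row_mxKl.
  have kr z : rsubmx (z - lin_of iL (lin_of rL z)) = rsubmx z.
    by rewrite linearB /= -[RHS]subr0; congr (_ - _); apply: row_mxKr.
  rewrite mform_perp /M /form_mx mform_gram // /hat -addrA; congr (_ + _).
  rewrite stdE; congr (_ + _).
    by rewrite !kl.
  by rewrite !kr.
have eP4 : embeddable P4.
  by do 2 (apply: embeddable_prod; last exact: embeddable_free1);
    apply: (plane_embeddable pl).
have [Phi [dPhi iPhi]] := absorb_complement aT isoT eP4 dA iA.
have [||Psi [dPsi iPsi]] := @tower_of_matrix R P4 om0 chi m (N.+2 + (1 + s)) _ eP4.
- by rewrite /m -doubleD.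
- by exists Phi.
have pom0 : perfect om0 := (perfect_perp a0).2 (plane_perfect pl).
apply: (tower_cancel eP4 aom0 pom0 ac _ dPsi iPsi) => j.
exact: (tower4_stable_range noeth dim4 pl).
Qed.

(** Let [chi] be the section form of [b]; it is the pullback of [om0] under
    some [g], which can be corrected by a symplectic automorphism so as to fix
    [e4].  Pairing with [e4] then carries [b] to the last coordinate. *)
Lemma trivial_of_WSL_trivial : WSL_trivial R ->
  (forall y, SL_orbit (vec4 P0) y -> Sp_orbit om0 (vec4 P0) y) ->
  Um_orbit_space_trivial (P0 * R^o)%type.
Proof.
move=> wsl sub; exists snd; split; first by move=> c; exists (0, c).
move=> b ub; have [sec bsec] := ub 1.
have ac := section_form_alt pl b sec.
have pc := section_form_perfect pl bsec.
have [g [dg ig]] := isometric_of_WSL_trivial wsl ac pc (section_form_pf pl bsec).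
have [|sg [[bij isg] esg]] := sub (g (vec4 P0)).
  by exists g; split=> //; apply: is_SL_det.
have [N [i [r iso]]] := plane_embedding pl.
have dsg : has_det sg 1 := Sp_has_det1 pl iso isg.
have [sg' [c1 c2 dsg']] := has_det1_inv dsg.
pose h := sg' \o g.
have dh : has_det h 1 by have := has_det_comp dsg' dg; rewrite mulr1.
have h4 : h (vec4 P0) = vec4 P0 by rewrite /h /= -esg c1.
have ih x y : om0 (h x) (h y) = section_form chi0 b sec x y.
  by rewrite -ig /h /= -isg !c2.
have eP1 : embeddable (P0 * R^o)%type.
  by apply: embeddable_prod; [exact: (plane_embeddable pl) | exact: embeddable_free1].
have [g3 [dg3 g3E]] := fix_last eP1 h4 dh.
exists g3; split; first exact: is_SL_det.
move=> x; have := ih (x, 0) (vec4 P0).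
rewrite section_form4 // h4 => <-; rewrite -(g3E (x, 0)).
by rewrite /om0 /perp_psi2 /= (alt0r a0); ring.
Qed.

End Backward.

(** * The equivalence *)

Section Orientation.
Variables (R : comPzRingType) (P L : lmodType R) (wedge : P -> P -> L)
  (theta : {linear R^o -> L}) (theta_inv : L -> R).
Hypotheses (ext : is_exterior_square wedge) (thetaK : cancel theta theta_inv)
  (theta_invK : cancel theta_inv theta).

Lemma orientation_alt : alternating (fun p q => theta_inv (wedge p q)).
Proof.
have tL a x y : theta_inv (a *: x + y) = a * theta_inv x + theta_inv y.
  by rewrite -{1}(theta_invK x) -{1}(theta_invK y) -linearP thetaK.
case: ext => -[w1 w2 w3] _; split=> [a x y z|a x y z|x].
- by rewrite w1 tL.
- by rewrite w2 tL.
- by rewrite w3 -(linear0 theta) thetaK.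
Qed.

Lemma orientation_universal (K : P -> P -> R) : alternating K ->
  exists c, forall x y, K x y = c * theta_inv (wedge x y).
Proof.
move=> aK; case: ext => _ /(_ R^o K aK)[h [hE _]]; exists (h (theta 1)) => x y.
rewrite -hE -{1}(theta_invK (wedge x y)) mulrC.
by rewrite -[X in theta X]mulr1 -[X in theta X]/(_ *: (1 : R^o)) !linearZ.
Qed.

End Orientation.

Theorem corollary3p7 (R : comPzRingType) (P0 : lmodType R)
    (detP0 : lmodType R) (wedge : P0 -> P0 -> detP0)
    (theta0 : {linear R^o -> detP0}) (theta0_inv : detP0 -> R)
    (R_noetherian : noetherian R)
    (dim_R : krull_dim_le R 4)
    (P0_fg : finitely_generated P0)
    (P0_projective : projective P0)
    (P0_rank : constant_rank P0 2)
    (detP0_wedge : is_exterior_square wedge)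
    (theta0K : cancel theta0 theta0_inv)
    (theta0_invK : cancel theta0_inv theta0)
    (Um_P5 : SL_transitive_on_Um (P0 * R^o * R^o * R^o)%type) :
  let chi0 := fun p q : P0 => theta0_inv (wedge p q) in
  let e4 : (P0 * R^o * R^o)%type := (0, 0, 1) in
  Um_orbit_space_trivial (P0 * R^o)%type <->
  (WSL_trivial R /\ SL_orbit e4 = Sp_orbit (perp_psi2 chi0) e4).
Proof.
move=> chi0 e4.
have ab : alternating chi0 := orientation_alt detP0_wedge theta0K theta0_invK.
have univ : forall K : P0 -> P0 -> R, alternating K ->
    exists c, forall x y, K x y = c * chi0 x y.
  exact: (orientation_universal detP0_wedge theta0_invK).
have pl : symplectic_plane chi0 :=
  symplectic_plane_of_rank2 R_noetherian P0_fg P0_projective P0_rank ab univ.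
split=> [triv|[wsl orb]].
  have rec := rectifiable_of_trivial triv; split.
    exact: (WSL_trivial_of_rectifiable R_noetherian dim_R pl univ rec Um_P5).
  apply/seteqP; split=> y; first exact: (SL_orbit_sub_Sp pl univ rec).
  exact: (Sp_orbit_sub_SL pl).
apply: (trivial_of_WSL_trivial R_noetherian dim_R pl wsl) => y.
by rewrite -[SL_orbit _]/(SL_orbit e4) orb.
Qed.
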